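(* Suppose $E$ is a smooth vector bundle on a $3$-dimensional contact manifold. Suppose we are given subbundles $K_H\subseteq\Lambda_H^1\otimes E$ and $K_H'\subseteq\Lambda_H^1\otimes K_H$ such that $K_H''\equiv(\Lambda_H^1\otimes K_H')\cap(S_\perp^3\otimes E)\subset\bigotimes^3\Lambda_H^1\otimes E$ is also a subbundle. Suppose $$D_H:E\oplus K_H\oplus K_H'\longrightarrow(\Lambda_H^1\otimes E)\oplus(\Lambda_H^1\otimes K_H)\oplus(\Lambda_H^1\otimes K_H')/K_H''$$ is a first order differential operator of the form $$\begin{bmatrix}\sigma\\ \mu\\ \rho\end{bmatrix}\longmapsto\begin{bmatrix}\nabla_H\sigma-\mu\\ \nabla_H\mu+L(\sigma)-\rho\\ \nabla_H\rho+M(\sigma,\mu)\ \bmod K_H''\end{bmatrix}$$ for some partial connections on $E$, $K_H$, and $K_H'$ and smooth homomorphisms $L:E\to\Lambda_H^1\otimes K_H$ and $M:E\oplus K_H\to\Lambda_H^1\otimes K_H'$. Finally suppose that $K_H'''\equiv(\Lambda_H^1\otimes K_H'')\cap(S_\perp^4\otimes E)\subset\bigotimes^4\Lambda_H^1\otimes E$ is a subbundle. Then we can find a differential operator $$D_H':E\oplus K_H\oplus K_H'\oplus K_H''\longrightarrow(\Lambda_H^1\otimes E)\oplus(\Lambda_H^1\otimes K_H)\oplus(\Lambda_H^1\otimes K_H')\oplus(\Lambda_H^1\otimes K_H'')/K_H'''$$ of the form $$\begin{bmatrix}\sigma\\ \mu\\ \rho\\ \tau\end{bmatrix}\longmapsto\begin{bmatrix}\nabla_H\sigma-\mu\\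 \nabla_H\mu+L(\sigma)-\rho\\ \nabla_H\rho+M(\sigma,\mu)-\tau\\ \nabla_H\tau+N(\sigma,\mu,\rho)\ \bmod K_H'''\end{bmatrix}$$ (for some partial connection $\nabla_H$ on $K_H''$ and some smooth homomorphism $N:E\oplus K_H\oplus K_H'\to\Lambda_H^1\otimes K_H''$) with the same kernel as $D_H$, i.e. the projection $(\sigma,\mu,\rho,\tau)\mapsto(\sigma,\mu,\rho)$ maps the space of sections annihilated by $D_H'$ isomorphically onto the space of sections annihilated by $D_H$.
   Context: Everything is smooth. A 3-dimensional contact manifold carries a rank two distribution $H\subset TM$. Write $\Lambda^p=\Lambda^pT^*M$, $H^\perp\subset\Lambda^1$ for the line bundle annihilating $H$ (not to be confused with the homomorphism $L$ of the statement), and $\Lambda_H^1=\Lambda^1/H^\perp=H^*$. The contact condition is that, for a non-vanishing local section $\alpha$ of $H^\perp$, the Levi form $L_{ab}=d\alpha|_H$ is non-degenerate. Abstract indices are used for tensors on $H$ and round brackets denote symmetrisation. A partial connection on a bundle $V$ is a differential operator $\nabla_H:V\to\Lambda_H^1\otimes V$ with $\nabla_H(f\sigma)=f\nabla_H\sigma+d_Hf\otimes\sigma$, where $d_Hf$ is the image of $df$ in $\Lambda_H^1$. The subbundle $S_\perp^3\subset\bigotimes^3\Lambda_H^1$ is $$S_\perp^3=\{P_{abc}+Q_aL_{bc}+Q_bL_{ac}+Q_cL_{ab}\ \text{s.t.}\ P_{abc}=P_{(abc)}\},$$ and $S_\perp^4=(\Lambda_H^1\otimes S_\perp^3)\cap(S_\perp^3\otimes\Lambda_H^1)\subset\bigotimes^4\Lambda_H^1$.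 *)

(* Defs.v *)
From HB Require Import structures.
From mathcomp Require Import all_boot all_order all_algebra.
From mathcomp Require Import all_classical all_reals all_analysis.

Set Implicit Arguments.
Unset Strict Implicit.
Unset Printing Implicit Defensive.

Import Order.TTheory GRing.Theory Num.Theory.
Import numFieldNormedType.Exports.

Local Open Scope classical_set_scope.
Local Open Scope ring_scope.

Definition iter_partial (R : realType) (l : seq 'I_3) (f : 'rV[R]_3 -> R^o) :
    'rV[R]_3 -> R^o :=
  foldr (fun k g => 'D_(delta_mx 0 k) g) f l.

(* C^oo on the open set U: the iterated partial derivatives of all orders
   exist and are continuous at the points of U. *)
Definition smooth_on (R : realType) (U : set 'rV[R]_3) (f : 'rV[R]_3 -> R^o) :
    Prop :=
  forall (l : seq 'I_3) (y : 'rV[R]_3), U y ->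
    {for y, continuous (iter_partial l f)} /\
    (forall k : 'I_3, derivable (iter_partial l f) y (delta_mx 0 k)).

(* Each point x has a preferred chart chart_at x; the tangent space at x is
   'rV[R]_3, a vector being given by its components in that chart. *)
Record manifold3 (R : realType) := Manifold3 {
  carrier :> topologicalType;
  atlas : Type;
  cdom : atlas -> set carrier;
  cmap : atlas -> carrier -> 'rV[R]_3;
  cinv : atlas -> 'rV[R]_3 -> carrier;
  chart_at : carrier -> atlas;
  manifold_hausdorff : hausdorff_space carrier;
  manifold_second_countable : @second_countable carrier;
  cdom_open : forall i, open (cdom i);
  cimage_open : forall i, open (cmap i @` cdom i);
  cmapK : forall i x, cdom i x -> cinv i (cmap i x) = x;
  cmap_continuous : forall i x, cdom i x -> {for x, continuous (cmap i)};
  cinv_continuous : forall i y, (cmap i @` cdom i) y ->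
    {for y, continuous (cinv i)};
  chart_at_dom : forall x, cdom (chart_at x) x;
  transition_smooth : forall (i j : atlas) (k : 'I_3),
    smooth_on (cmap i @` (cdom i `&` cdom j))
              (fun y => cmap j (cinv i y) 0 k)
}.

Definition smooth_fun (R : realType) (M : manifold3 R) (W : set M)
    (f : M -> R^o) : Prop :=
  forall i : atlas M, smooth_on (cmap i @` (W `&` cdom i)) (f \o cinv i).

(* The components in the chart i of the tangent vector v at x. *)
Definition tangent_to_chart (R : realType) (M : manifold3 R) (i : atlas M)
    (x : M) (v : 'rV[R]_3) : 'rV[R]_3 :=
  'D_v (cmap i \o cinv (chart_at x)) (cmap (chart_at x) x).

(* The tangent vector at x whose components in the chart i are v. *)
Definition tangent_of_chart (R : realType) (M : manifold3 R) (i : atlas M)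
    (x : M) (v : 'rV[R]_3) : 'rV[R]_3 :=
  'D_v (cmap (chart_at x) \o cinv i) (cmap i x).

(* A family of finite-dimensional vector spaces together with its smooth local
   sections.  A section over an open set W is represented by a section over M
   whose values off W are irrelevant. *)
Record bundle (R : realType) (M : manifold3 R) := Bundle {
  fib : M -> vectType R;
  smooth_sec : set M -> (forall x : M, fib x) -> Prop
}.

Definition section (R : realType) (M : manifold3 R) (V : bundle M) : Type :=
  forall x : M, fib V x.

Definition eq_on (R : realType) (M : manifold3 R) (V : bundle M) (W : set M)
    (s t : section V) : Prop :=
  forall x : M, W x -> s x = t x.

Definition tangent_bundle (R : realType) (M : manifold3 R) : bundle M :=
  @Bundle R M (fun _ => 'rV[R]_3)
    (fun W X => forall (i : atlas M) (k : 'I_3),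
       smooth_fun (W `&` cdom i) (fun x => tangent_to_chart i x (X x) 0 k)).

Definition trivial_line (R : realType) (M : manifold3 R) : bundle M :=
  @Bundle R M (fun _ => R^o) (fun W f => smooth_fun W f).

Definition hom_bundle (R : realType) (M : manifold3 R) (A B : bundle M) :
    bundle M :=
  @Bundle R M (fun x => 'Hom(fib A x, fib B x))
    (fun W T => forall (W' : set M) (s : section A),
       open W' -> W' `<=` W -> smooth_sec W' s ->
       @smooth_sec R M B W' (fun x => T x (s x))).

Definition sum_bundle (R : realType) (M : manifold3 R) (A B : bundle M) :
    bundle M :=
  @Bundle R M (fun x => (fib A x * fib B x)%type)
    (fun W s => @smooth_sec R M A W (fun x => (s x).1) /\
                @smooth_sec R M B W (fun x => (s x).2)).

Definition sub_bundle (R : realType) (M : manifold3 R) (V : bundle M)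
    (K : forall x : M, {vspace fib V x}) : bundle M :=
  @Bundle R M (fun x => subvs_of (K x))
    (fun W s => @smooth_sec R M V W (fun x => val (s x))).

Definition is_subbundle (R : realType) (M : manifold3 R) (V : bundle M)
    (K : forall x : M, {vspace fib V x}) : Prop :=
  forall p : M, exists (U : set M) (n : nat) (e : 'I_n -> section V),
    [/\ open U, U p, (forall j, smooth_sec U (e j)) &
        forall x, U x -> basis_of (K x) [seq e j x | j <- enum 'I_n]].

Definition smooth_hom (R : realType) (M : manifold3 R) (A B : bundle M)
    (T : section (hom_bundle A B)) : Prop :=
  smooth_sec setT T.

(* A smooth vector bundle, given by an atlas of local trivialisations; the
   trivialisation i is recorded as the frame of the fibres that it defines
   over the open set tdom i. *)
Record vector_bundle (R : realType) (M : manifold3 R) := VectorBundle {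
  vfib : M -> vectType R;
  triv : Type;
  tdom : triv -> set M;
  trank : triv -> nat;
  tframe : forall (i : triv) (x : M), (trank i).-tuple (vfib x);
  tdom_open : forall i, open (tdom i);
  tdom_cover : forall x : M, exists i, tdom i x;
  tframe_basis : forall i x, tdom i x -> basis_of fullv (tframe i x);
  tframe_smooth : forall (i j : triv) (k : 'I_(trank i)) (l : 'I_(trank j)),
    smooth_fun (tdom i `&` tdom j)
               (fun x => coord (tframe i x) k (tnth (tframe j x) l))
}.

Definition bundle_of (R : realType) (M : manifold3 R) (E : vector_bundle M) :
    bundle M :=
  @Bundle R M (vfib E)
    (fun W s => forall (i : triv E) (k : 'I_(trank i)),
       smooth_fun (W `&` tdom i) (fun x => coord (tframe i x) k (s x))).

Coercion bundle_of : vector_bundle >-> bundle.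

(* The exterior derivative dα(u, v) = u(α(V)) - v(α(U)) - α([U, V]) at x, where
   U and V extend u and v with constant components in the chart at x, so that
   [U, V] = 0. *)
Definition ext_deriv (R : realType) (M : manifold3 R)
    (alpha : section (hom_bundle (tangent_bundle M) (trivial_line M)))
    (x : M) (u v : 'rV[R]_3) : R :=
  let c := chart_at x in
  let contract (w : 'rV[R]_3) (y : 'rV[R]_3) : R^o :=
    (alpha (cinv c y) : 'Hom('rV[R]_3, R^o))
      (tangent_of_chart c (cinv c y) w) in
  'D_u (contract v) (cmap c x) - 'D_v (contract u) (cmap c x).

(* A non-vanishing section over W of the annihilator of H. *)
Definition annihilating_form (R : realType) (M : manifold3 R)
    (H : forall x : M, {vspace fib (tangent_bundle M) x}) (W : set M)
    (alpha : section (hom_bundle (tangent_bundle M) (trivial_line M))) :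
    Prop :=
  [/\ smooth_sec W alpha,
      (forall x, W x -> alpha x != 0) &
      forall x (v : 'rV[R]_3), W x -> v \in H x ->
        (alpha x : 'Hom('rV[R]_3, R^o)) v = 0].

(* The Levi form is defined only up to scale, hence a predicate. *)
Definition is_levi_form (R : realType) (M : manifold3 R)
    (H : forall x : M, {vspace fib (tangent_bundle M) x}) (x : M)
    (L : subvs_of (H x) -> subvs_of (H x) -> R) : Prop :=
  exists (W : set M)
         (alpha : section (hom_bundle (tangent_bundle M) (trivial_line M))),
    [/\ open W, W x, annihilating_form H W alpha &
        L = fun a b => ext_deriv alpha x (val a) (val b)].

Record contact (R : realType) (M : manifold3 R) := Contact {
  distr : forall x : M, {vspace fib (tangent_bundle M) x};
  distr_subbundle : is_subbundle distr;
  distr_rank : forall x, \dim (distr x) = 2;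
  distr_contact : forall (x : M)
      (L : subvs_of (distr x) -> subvs_of (distr x) -> R),
    is_levi_form L ->
    forall a : subvs_of (distr x), (forall b, L a b = 0) -> a = 0
}.

Definition Hfib (R : realType) (M : manifold3 R) (C : contact M) (x : M) :
    vectType R := subvs_of (distr C x).

(* Λ_H^1 ⊗ V = H^* ⊗ V is the bundle of homomorphisms from H to V. *)
Definition LamH (R : realType) (M : manifold3 R) (C : contact M)
    (V : bundle M) : bundle M :=
  hom_bundle (sub_bundle (distr C)) V.

(* Evaluation of an element of Λ_H^1 ⊗ V at x on a vector of H. *)
Definition ev (R : realType) (M : manifold3 R) (C : contact M) (V : bundle M)
    (x : M) (T : fib (LamH C V) x) (a : Hfib C x) : fib V x :=
  (T : 'Hom(fib (sub_bundle (distr C)) x, fib V x)) a.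

Definition dH (R : realType) (M : manifold3 R) (C : contact M) (f : M -> R^o)
    (x : M) (a : Hfib C x) : R :=
  'D_(vsval a) (f \o cinv (chart_at x)) (cmap (chart_at x) x).

(* The operator acts on local sections over every open set. *)
Record partial_connection (R : realType) (M : manifold3 R) (C : contact M)
    (V : bundle M) := PartialConnection {
  nabla :> section V -> section (LamH C V);
  nabla_local : forall (W : set M) (s t : section V), open W ->
    eq_on W s t -> eq_on W (nabla s) (nabla t);
  nabla_smooth : forall (W : set M) (s : section V), open W ->
    smooth_sec W s -> smooth_sec W (nabla s);
  nabla_add : forall (W : set M) (s t : section V), open W ->
    smooth_sec W s -> smooth_sec W t ->
    eq_on W (nabla (fun x => s x + t x)) (fun x => nabla s x + nabla t x);
  nabla_leibniz : forall (W : set M) (f : M -> R^o) (s : section V), open W ->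
    smooth_fun W f -> smooth_sec W s ->
    forall (x : M) (a : Hfib C x), W x ->
      ev (nabla (fun y => f y *: s y) x) a =
      f x *: ev (nabla s x) a + dH f a *: s x
}.

(* Elements of the tensor powers of Λ_H^1 are handled as multilinear functions
   of vectors of H, the first argument corresponding to the first index. *)
Definition S3perp (R : realType) (M : manifold3 R) (C : contact M) (x : M)
    (s : Hfib C x -> Hfib C x -> Hfib C x -> R) : Prop :=
  exists (L : Hfib C x -> Hfib C x -> R)
         (P : 'Hom(Hfib C x, 'Hom(Hfib C x, 'Hom(Hfib C x, R^o))))
         (Q : 'Hom(Hfib C x, R^o)),
    [/\ @is_levi_form R M (distr C) x L,
        (forall a b c, P a b c = P b a c /\ P a b c = P a c b) &
        forall a b c,
          s a b c = P a b c + Q a * L b c + Q b * L a c + Q c * L a b].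

Definition S4perp (R : realType) (M : manifold3 R) (C : contact M) (x : M)
    (t : Hfib C x -> Hfib C x -> Hfib C x -> Hfib C x -> R) : Prop :=
  (exists (n : nat) (w : 'I_n -> 'Hom(Hfib C x, R^o))
          (s : 'I_n -> Hfib C x -> Hfib C x -> Hfib C x -> R),
     (forall i, S3perp (s i)) /\
     forall a b c d, t a b c d = \sum_(i < n) w i a * s i b c d) /\
  (exists (n : nat) (s : 'I_n -> Hfib C x -> Hfib C x -> Hfib C x -> R)
          (w : 'I_n -> 'Hom(Hfib C x, R^o)),
     (forall i, S3perp (s i)) /\
     forall a b c d, t a b c d = \sum_(i < n) s i a b c * w i d).

(* Membership in S_⊥^3 ⊗ V and in S_⊥^4 ⊗ V. *)
Definition S3perp_tensor (R : realType) (M : manifold3 R) (C : contact M)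
    (V : bundle M) (x : M)
    (t : Hfib C x -> Hfib C x -> Hfib C x -> fib V x) : Prop :=
  exists (n : nat) (s : 'I_n -> Hfib C x -> Hfib C x -> Hfib C x -> R)
         (e : 'I_n -> fib V x),
    (forall i, S3perp (s i)) /\
    forall a b c, t a b c = \sum_(i < n) s i a b c *: e i.

Definition S4perp_tensor (R : realType) (M : manifold3 R) (C : contact M)
    (V : bundle M) (x : M)
    (t : Hfib C x -> Hfib C x -> Hfib C x -> Hfib C x -> fib V x) : Prop :=
  exists (n : nat)
         (s : 'I_n -> Hfib C x -> Hfib C x -> Hfib C x -> Hfib C x -> R)
         (e : 'I_n -> fib V x),
    (forall i, S4perp (s i)) /\
    forall a b c d, t a b c d = \sum_(i < n) s i a b c d *: e i.

(* K is a family of subspaces of Λ_H^1 ⊗ E, K' of Λ_H^1 ⊗ K, K'' of Λ_H^1 ⊗ K'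
   and K''' of Λ_H^1 ⊗ K''; these are regarded inside the tensor powers of
   Λ_H^1 tensored with E by full evaluation. *)
Definition full_ev3 (R : realType) (M : manifold3 R) (C : contact M)
    (E : bundle M)
    (K : forall x : M, {vspace fib (LamH C E) x})
    (K' : forall x : M, {vspace fib (LamH C (sub_bundle K)) x})
    (x : M) (T : fib (LamH C (sub_bundle K')) x) (a b c : Hfib C x) :
    fib E x :=
  ev (vsval (ev (vsval (ev T a)) b)) c.

Definition full_ev4 (R : realType) (M : manifold3 R) (C : contact M)
    (E : bundle M)
    (K : forall x : M, {vspace fib (LamH C E) x})
    (K' : forall x : M, {vspace fib (LamH C (sub_bundle K)) x})
    (K'' : forall x : M, {vspace fib (LamH C (sub_bundle K')) x})
    (x : M) (T : fib (LamH C (sub_bundle K'')) x) (a b c d : Hfib C x) :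
    fib E x :=
  full_ev3 (vsval (ev T a)) b c d.

Definition is_K2 (R : realType) (M : manifold3 R) (C : contact M)
    (E : bundle M)
    (K : forall x : M, {vspace fib (LamH C E) x})
    (K' : forall x : M, {vspace fib (LamH C (sub_bundle K)) x})
    (K'' : forall x : M, {vspace fib (LamH C (sub_bundle K')) x}) : Prop :=
  forall (x : M) (T : fib (LamH C (sub_bundle K')) x),
    T \in K'' x <-> S3perp_tensor (full_ev3 T).

Definition is_K3 (R : realType) (M : manifold3 R) (C : contact M)
    (E : bundle M)
    (K : forall x : M, {vspace fib (LamH C E) x})
    (K' : forall x : M, {vspace fib (LamH C (sub_bundle K)) x})
    (K'' : forall x : M, {vspace fib (LamH C (sub_bundle K')) x})
    (K''' : forall x : M, {vspace fib (LamH C (sub_bundle K'')) x}) : Prop :=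
  forall (x : M) (T : fib (LamH C (sub_bundle K'')) x),
    T \in K''' x <-> S4perp_tensor (full_ev4 T).

(* The last component represents a class modulo K''. *)
Definition DH (R : realType) (M : manifold3 R) (C : contact M)
    (E : bundle M)
    (K : forall x : M, {vspace fib (LamH C E) x})
    (K' : forall x : M, {vspace fib (LamH C (sub_bundle K)) x})
    (nE : partial_connection C E)
    (nK : partial_connection C (sub_bundle K))
    (nK' : partial_connection C (sub_bundle K'))
    (L : section (hom_bundle E (LamH C (sub_bundle K))))
    (Mh : section (hom_bundle (sum_bundle E (sub_bundle K))
                              (LamH C (sub_bundle K'))))
    (sigma : section E) (mu : section (sub_bundle K))
    (rho : section (sub_bundle K')) :
    section (LamH C E) * section (LamH C (sub_bundle K)) *
    section (LamH C (sub_bundle K')) :=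
  ((fun x => nE sigma x - vsval (mu x)),
   (fun x => nK mu x +
      (L x : 'Hom(fib E x, fib (LamH C (sub_bundle K)) x)) (sigma x) -
      vsval (rho x)),
   (fun x => nK' rho x +
      (Mh x : 'Hom(fib (sum_bundle E (sub_bundle K)) x,
                   fib (LamH C (sub_bundle K')) x)) (sigma x, mu x))).

(* The last component represents a class modulo K'''. *)
Definition DH' (R : realType) (M : manifold3 R) (C : contact M)
    (E : bundle M)
    (K : forall x : M, {vspace fib (LamH C E) x})
    (K' : forall x : M, {vspace fib (LamH C (sub_bundle K)) x})
    (K'' : forall x : M, {vspace fib (LamH C (sub_bundle K')) x})
    (nE : partial_connection C E)
    (nK : partial_connection C (sub_bundle K))
    (nK' : partial_connection C (sub_bundle K'))
    (nK'' : partial_connection C (sub_bundle K''))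
    (L : section (hom_bundle E (LamH C (sub_bundle K))))
    (Mh : section (hom_bundle (sum_bundle E (sub_bundle K))
                              (LamH C (sub_bundle K'))))
    (N : section (hom_bundle (sum_bundle (sum_bundle E (sub_bundle K))
                                         (sub_bundle K'))
                             (LamH C (sub_bundle K''))))
    (sigma : section E) (mu : section (sub_bundle K))
    (rho : section (sub_bundle K')) (tau : section (sub_bundle K'')) :
    section (LamH C E) * section (LamH C (sub_bundle K)) *
    section (LamH C (sub_bundle K')) * section (LamH C (sub_bundle K'')) :=
  ((fun x => nE sigma x - vsval (mu x)),
   (fun x => nK mu x +
      (L x : 'Hom(fib E x, fib (LamH C (sub_bundle K)) x)) (sigma x) -
      vsval (rho x)),
   (fun x => nK' rho x +
      (Mh x : 'Hom(fib (sum_bundle E (sub_bundle K)) x,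
                   fib (LamH C (sub_bundle K')) x)) (sigma x, mu x) -
      vsval (tau x)),
   (fun x => nK'' tau x +
      (N x : 'Hom(fib (sum_bundle (sum_bundle E (sub_bundle K))
                                  (sub_bundle K')) x,
                  fib (LamH C (sub_bundle K'')) x))
        (sigma x, mu x, rho x))).

(* The sections over W annihilated by DH. *)
Definition in_ker_DH (R : realType) (M : manifold3 R) (C : contact M)
    (E : bundle M)
    (K : forall x : M, {vspace fib (LamH C E) x})
    (K' : forall x : M, {vspace fib (LamH C (sub_bundle K)) x})
    (K'' : forall x : M, {vspace fib (LamH C (sub_bundle K')) x})
    (nE : partial_connection C E)
    (nK : partial_connection C (sub_bundle K))
    (nK' : partial_connection C (sub_bundle K'))
    (L : section (hom_bundle E (LamH C (sub_bundle K))))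
    (Mh : section (hom_bundle (sum_bundle E (sub_bundle K))
                              (LamH C (sub_bundle K'))))
    (W : set M)
    (sigma : section E) (mu : section (sub_bundle K))
    (rho : section (sub_bundle K')) : Prop :=
  [/\ smooth_sec W sigma, smooth_sec W mu, smooth_sec W rho &
      let: (d1, d2, d3) := DH nE nK nK' L Mh sigma mu rho in
      forall x, W x -> [/\ d1 x = 0, d2 x = 0 & d3 x \in K'' x]].

Definition in_ker_DH' (R : realType) (M : manifold3 R) (C : contact M)
    (E : bundle M)
    (K : forall x : M, {vspace fib (LamH C E) x})
    (K' : forall x : M, {vspace fib (LamH C (sub_bundle K)) x})
    (K'' : forall x : M, {vspace fib (LamH C (sub_bundle K')) x})
    (K''' : forall x : M, {vspace fib (LamH C (sub_bundle K'')) x})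
    (nE : partial_connection C E)
    (nK : partial_connection C (sub_bundle K))
    (nK' : partial_connection C (sub_bundle K'))
    (nK'' : partial_connection C (sub_bundle K''))
    (L : section (hom_bundle E (LamH C (sub_bundle K))))
    (Mh : section (hom_bundle (sum_bundle E (sub_bundle K))
                              (LamH C (sub_bundle K'))))
    (N : section (hom_bundle (sum_bundle (sum_bundle E (sub_bundle K))
                                         (sub_bundle K'))
                             (LamH C (sub_bundle K''))))
    (W : set M)
    (sigma : section E) (mu : section (sub_bundle K))
    (rho : section (sub_bundle K')) (tau : section (sub_bundle K'')) : Prop :=
  [/\ smooth_sec W sigma, smooth_sec W mu, smooth_sec W rho,
      smooth_sec W tau &
      let: (d1, d2, d3, d4) :=
        DH' nE nK nK' nK'' L Mh N sigma mu rho tau in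
      forall x, W x ->
        [/\ d1 x = 0, d2 x = 0, d3 x = 0 & d4 x \in K''' x]].

(* Main.v *)
Require Import Defs.
From HB Require Import structures.
From mathcomp Require Import all_boot all_order all_algebra.
From mathcomp Require Import all_classical all_reals all_analysis.
From mathcomp Require Import ring lra.

Set Implicit Arguments.
Unset Strict Implicit.
Unset Printing Implicit Defensive.

Import Order.TTheory GRing.Theory Num.Theory.
Import numFieldNormedType.Exports.

Local Open Scope classical_set_scope.
Local Open Scope ring_scope.

(* Identify T in Lambda_H tensor K'' with a 4-tensor T_abcd valued in E. It
   belongs to K''' exactly when the pairings of its first three indices with the
   Lie polynomials [h_j, [h_0, h_1]] of a frame of H vanish: on a two-dimensional
   space these pairings are the only obstruction to lying in S_perp^3, and the
   last three indices already satisfy the condition because K'' does.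

   Put tau := nabla rho + M(sigma, mu), a section of K'' on solutions. Every
   contact derivative of mu, rho or sigma can be replaced by the next field plus
   a tensorial term, so X_a X_b X_c of a component of mu is the corresponding
   component of nabla_0 tau up to a tensorial term, for any connection nabla_0 on
   K''. By the contact condition, X_0, X_1 and [X_0, X_1] span the tangent
   bundle, so [X_j, [X_0, X_1]] is a combination of them and contributes only
   tensorial terms. Hence the obstructions of nabla_0 tau are tensorial in
   (sigma, mu, rho, tau). Since K''' has constant rank, the obstruction map has
   a smooth generalised inverse; subtracting its value corrects nabla_0 by the
   tau-part and defines N by the rest. The local choices are averaged by a
   partition of unity, the conditions on (nabla, N) being affine. *)

(** * Differentiability from continuous partial derivatives *)

(** The bracket equation is operator algebra: expanding [[X_j, [X_0, X_1]]] gives the triple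
    products [j01 - j10 - 01j + 10j], and [bracket3] is this pattern of indices. It is applied to
    components of [mu] because the system then leaves room for exactly three derivatives, which lead
    from [mu] through [rho] and [tau] to [nabla tau], about which no equation is known. The index
    carried by [mu] itself becomes the fourth one, so only the first three are bracketed. No
    solution with prescribed values at a point is ever produced. The functionals extracted from the
    identity agree with the obstructions along solutions, over any open set, and the correction uses
    nothing more. Two encodings shape the remaining work. Smoothness is existence and continuity of
    iterated partial derivatives, so total differentiability, symmetry of second derivatives and the
    chain rule have to be derived from it. A bundle carries its smooth sections as a bare predicate,
    so local frames and the sheaf property are established for every bundle of the tower before
    anything is computed in it. *)

Section Lines.
Variable R : realType.
Variable V : normedModType R.
Implicit Types (f : V -> R^o) (z v : V).

Lemma is_derive_line f z v (t : R) :
  derivable f (z + t *: v) v ->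
  is_derive t 1 (fun u : R => f (z + u *: v) : R^o) ('D_v f (z + t *: v)).
Proof.
move=> df.
have E : (fun h : R => h^-1 *: (((fun u : R => f (z + u *: v) : R^o) \o shift t)
           (h *: (1 : R)) - f (z + t *: v)))
    = (fun h : R => h^-1 *: ((f \o shift (z + t *: v)) (h *: v) - f (z + t *: v))).
  apply: funext => h /=; congr (_ *: (f _ - _)).
  by rewrite [_ *: (1 : R)]mulr1 scalerDl addrCA.
by split; rewrite /derivable /derive E.
Qed.

(** The mean value theorem on the segment from [z] to [z + s *: v], with the two signs of [s]
    treated apart. In the applications [c] is the derivative at a base point, so that [e] measures
    the oscillation of the derivative. *)
Lemma mvt_line f z v (s c e : R) :
  (forall t : R, `|t| <= `|s| ->
     derivable f (z + t *: v) v /\ `|'D_v f (z + t *: v) - c| <= e) ->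
  `|f (z + s *: v) - f z - s * c| <= e * `|s|.
Proof.
move=> H.
pose g := fun u : R => f (z + u *: v) : R^o.
have dg (t : R) : `|t| <= `|s| -> is_derive t 1 g ('D_v f (z + t *: v)).
  by move=> /H[] df _; exact: is_derive_line.
have [t [ts Et]] : exists t : R, `|t| <= `|s| /\ g s - g 0 = 'D_v f (z + t *: v) * s.
  have cont (a b : R) : (forall t, t \in `[a, b] -> `|t| <= `|s|) ->
      {within `[a, b], continuous g}.
    move=> ab; apply: derivable_within_continuous => t tab.
    by have [] := dg t (ab t tab).
  have [s0|s0] := leP 0 s.
    have B t : t \in `[0, s] -> `|t| <= `|s|.
      by rewrite in_itv /= => /andP[? ?]; rewrite !ger0_norm.
    have [|t tI ->] := @MVT_segment R g (fun t => 'D_v f (z + t *: v)) 0 s s0 _ (cont _ _ B).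
      by move=> t /subset_itv_oo_cc tI; apply: dg; apply: B.
    by exists t; rewrite subr0; split => //; exact: B.
  have B t : t \in `[s, 0] -> `|t| <= `|s|.
    rewrite in_itv /= => /andP[? ?]; rewrite !ler0_norm ?lerN2 //.
    exact: ltW.
  have [|t tI E] := @MVT_segment R g (fun t => 'D_v f (z + t *: v)) s 0 (ltW s0) _ (cont _ _ B).
    by move=> t /subset_itv_oo_cc tI; apply: dg; apply: B.
  exists t; split; first exact: B.
  by rewrite -opprB E sub0r mulrN opprK.
move: Et; rewrite {1 2}/g scale0r addr0 => ->.
rewrite mulrC -mulrBr normrM mulrC ler_wpM2r //.
by have [] := H t ts.
Qed.

Lemma nbhs_ballC (y : V) (P : set V) :
  nbhs y P -> exists2 d : R, 0 < d & forall h : V, `|h| < d -> P (y + h).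
Proof.
move=> /nbhs_ballP[d /= d0 H]; exists d => // h hd; apply: H.
by rewrite -ball_normE /= opprD addNKr normrN.
Qed.

(** The second difference is the increment along [a] of [F z = f (z + s *: b) - f z]. One mean value
    estimate along [a] reduces it to an increment of ['D_a f] along [b], and a second one reaches
    ['D_b ('D_a f)]. *)
Lemma mixed_difference f (U : set V) (y a b : V) :
  `|a| <= 1 -> `|b| <= 1 ->
  open U -> U y -> (forall z, U z -> derivable f z a) ->
  (forall z, U z -> derivable ('D_a f) z b) ->
  {for y, continuous ('D_b ('D_a f))} ->
  forall e : R, 0 < e -> exists2 d : R, 0 < d & forall s : R, `|s| < d ->
    `|f (y + s *: b + s *: a) - f (y + s *: a) - f (y + s *: b) + f y
      - s ^+ 2 * 'D_b ('D_a f) y| <= e * s ^+ 2.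
Proof.
move=> na nb oU Uy df dd cc e e0.
set G := 'D_b _ in cc *.
have [d d0 Hd] : exists2 d : R, 0 < d & forall h : V, `|h| < d ->
    U (y + h) /\ `|G (y + h) - G y| <= e.
  apply: (@nbhs_ballC y (fun z => U z /\ `|G z - G y| <= e)).
  apply: filterI; first exact: open_nbhs_nbhs.
  have /cvgrPdist_lt/(_ e e0) cc' := cc.
  apply: filterS cc' => z H; rewrite distrC; exact: ltW.
(* Every point met is [y + t *: a + u *: b] with [t] and [u] bounded by [s]; as [a] and [b] have
   norm at most 1, half of the radius is enough. *)
exists (d / 2); first by rewrite divr_gt0.
move=> s sd.
pose F z := f (z + s *: b) - f z : R^o.
have nrm (t u : R) : `|t| <= `|s| -> `|u| <= `|s| -> `|t *: a + u *: b| < d.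
  move=> ts us; apply: (le_lt_trans (ler_normD _ _)); rewrite !normrZ.
  have : `|t| * `|a| <= `|s| by rewrite -[leRHS]mulr1; apply: ler_pM.
  have : `|u| * `|b| <= `|s| by rewrite -[leRHS]mulr1; apply: ler_pM.
  lra.
have := @mvt_line F y a s (s * G y) (e * `|s|).
rewrite /F -[e * `|s| * `|s|]mulrA -normrM -expr2 ger0_norm ?sqr_ge0 // [s * (s * _)]mulrA -expr2.
move=> H; move: (H); set X := (X in `|X| <= _); move=> H1.
have -> : f (y + s *: b + s *: a) - f (y + s *: a) - f (y + s *: b) + f y
    - s ^+ 2 * G y = X.
  by rewrite /X [y + _ + _]addrAC; lra.
apply: H1 => t ts.
have Ua : U (y + t *: a).
  by have [] := Hd (t *: a + 0 *: b) (nrm t 0 ts ltac:(by rewrite normr0));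
     rewrite scale0r addr0.
have Uab : U (y + t *: a + s *: b).
  by have [] := Hd (t *: a + s *: b) (nrm t s ts (lexx _)); rewrite addrA.
have D2' : is_derive (y + t *: a) a (fun z => f (z + s *: b) : R^o)
   ('D_a f (y + t *: a + s *: b)).
  have E : (fun h : R => h^-1 *: (((fun z => f (z + s *: b) : R^o) \o shift (y + t *: a))
         (h *: a) - f (y + t *: a + s *: b)))
   = (fun h : R => h^-1 *: ((f \o shift (y + t *: a + s *: b)) (h *: a)
         - f (y + t *: a + s *: b))).
    by apply: funext => h /=; congr (_ *: (f _ - _)); rewrite !addrA.
  by split; rewrite /derivable /derive E //; apply: df.
have [D3 D3E] := D2'.
have D4 := df _ Ua.
split; first exact: (derivableB D3 D4).
have -> : 'D_a (fun z => f (z + s *: b) - f z) (y + t *: a) =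
    'D_a f (y + t *: a + s *: b) - 'D_a f (y + t *: a).
  by rewrite -D3E; exact: deriveB.
apply: (@mvt_line ('D_a f) (y + t *: a) b s (G y) e) => u us; rewrite -addrA.
have [Uu Gu] := Hd (t *: a + u *: b) (nrm t u ts us).
split; first exact: dd.
exact: Gu.
Qed.

End Lines.

Lemma sum3 (A : nmodType) (F : 'I_3 -> A) : \sum_k F k = F 0 + F 1 + F (2%:R).
Proof.
rewrite !big_ord_recl big_ord0 addr0 addrA.
by congr (F _ + F _ + F _); apply/val_inj.
Qed.

Lemma triple_lt (R : realFieldType) (x d : R) : x < d / 3 -> x + x + x < d.
Proof. by move=> ?; lra. Qed.

Lemma three_steps (R : realFieldType) (A B C F a b c e n : R) :
  `|C - F - a| <= e / 3 * n -> `|B - C - b| <= e / 3 * n ->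
  `|A - B - c| <= e / 3 * n -> `|A - (F + (a + b + c))| <= e * n.
Proof.
move=> h1 h2 h3.
have -> : A - (F + (a + b + c)) = (C - F - a) + (B - C - b) + (A - B - c) by ring.
apply: (le_trans (ler_normD _ _)).
have := ler_normD (C - F - a) (B - C - b); lra.
Qed.

Section Partials.
Variable R : realType.
Local Notation V3 := 'rV[R]_3.
Implicit Types (f g : V3 -> R^o) (U : set V3).
Local Notation e_ k := (delta_mx 0 k : V3).

Lemma norm_coord_le n (h : 'rV[R]_n) k : `|h 0 k| <= `|h|.
Proof. by rewrite [leRHS]/Num.Def.normr/= mx_normrE; apply: (le_bigmax _ (fun i => `|h i.1 i.2|) (0, k)). Qed.

Lemma norm_delta_le n (k : 'I_n) : `|delta_mx 0 k : 'rV[R]_n| <= 1.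
Proof.
rewrite /Num.Def.normr/= mx_normrE; apply: bigmax_le => // -[i j] _ /=.
by rewrite mxE; case: (_ && _); rewrite ?normr1 ?normr0.
Qed.

(* The increment along h is split into three steps parallel to the axes; the
   mean value theorem applies to each of them. *)
Lemma partials_differentiable f (U : set V3) (y : V3) :
  open U -> U y -> (forall k z, U z -> derivable f z (e_ k)) ->
  (forall k, {for y, continuous ('D_(e_ k) f)}) ->
  differentiable f y.
Proof.
move=> oU Uy df cf.
pose D (v : V3) : R^o := \sum_k v 0 k * 'D_(e_ k) f y.
have linD : linear D.
  move=> a u v; rewrite /D scaler_sumr -big_split /=; apply: eq_bigr => k _.
  by rewrite !mxE mulrDl /GRing.scale /= mulrA.
pose DL := HB.pack_for {linear V3 -> R^o} D (GRing.isLinear.Build _ _ _ _ D linD).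
have cD : continuous D.
  have -> : D = \sum_(k < 3) (fun v : V3 => v 0 k * 'D_(e_ k) f y : R^o).
    by apply: funext => v; rewrite fct_sumE.
  move=> v; apply: differentiable_continuous.
  apply: (@differentiable_sum _ _ _ 3 (fun k (v : V3) => v 0 k * 'D_(e_ k) f y : R^o)) => k.
  apply: differentiableM; first exact: differentiable_coord.
  exact: differentiable_cst.
have oD : f \o shift y = cst (f y) + (DL : V3 -> (R^o : normedModType R)) +o_ (0 : V3) (id : V3 -> V3).
  apply/eqaddoP => e e0; have e30 : 0 < e / 3 by rewrite divr_gt0.
  have [d d0 Hd] : exists2 d : R, 0 < d & forall h : V3, `|h| < d -> forall k,
      derivable f (y + h) (e_ k) /\ `|'D_(e_ k) f (y + h) - 'D_(e_ k) f y| <= e / 3.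
    apply: (@nbhs_ballC R V3 y (fun z => forall k, derivable f z (e_ k) /\
        `|'D_(e_ k) f z - 'D_(e_ k) f y| <= e / 3)).
    apply: (@filter_forall V3 'I_3 (fun k z => derivable f z (e_ k) /\
        `|'D_(e_ k) f z - 'D_(e_ k) f y| <= e / 3) (nbhs y)) => k.
    apply: filterI.
      by apply: filterS (open_nbhs_nbhs (conj oU Uy)) => z; apply: df.
    have /cvgrPdist_lt/(_ _ e30) cf' := cf k.
    apply: filterS cf' => z H; rewrite distrC; exact: ltW.
  have d30 : 0 < d / 3 by rewrite divr_gt0.
  apply: (@filterS _ (nbhs (0 : V3)) _ (ball (0 : V3) (d / 3))); last exact: nbhsx_ballx.
  move=> h; rewrite -ball_normE /= sub0r normrN => hd.
  (* The base point of an axis step is displaced by at most twice the norm of [h] and the step adds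
     once more, hence the radius [d / 3]. *)
  have hd3 : `|h| + `|h| + `|h| < d by apply: triple_lt.
  have step (z : V3) (k : 'I_3) : `|z| <= `|h| + `|h| ->
      `|f (y + z + h 0 k *: e_ k) - f (y + z) - h 0 k * 'D_(e_ k) f y| <= e / 3 * `|h|.
    move=> zh; apply: (@le_trans _ _ (e / 3 * `|h 0 k|)); last first.
      by rewrite ler_wpM2l ?norm_coord_le // ltW.
    apply: mvt_line => t th; rewrite -addrA; apply: Hd.
    apply: le_lt_trans hd3; apply: (le_trans (ler_normD _ _)); apply: lerD zh _.
    rewrite normrZ; apply: le_trans (norm_coord_le h k); rewrite -[leRHS]mulr1.
    by apply: ler_pM => //; exact: norm_delta_le.
  have nk k : `|h 0 k *: e_ k| <= `|h|.
    rewrite normrZ; apply: le_trans (norm_coord_le h k).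
    by rewrite -[leRHS]mulr1; apply: ler_pM => //; exact: norm_delta_le.
  have Eh : h = h 0 0 *: e_ 0 + h 0 1 *: e_ 1 + h 0 (2%:R) *: e_ (2%:R).
    by rewrite {1}(row_sum_delta h) sum3.
  have s1 := @step 0 0; have s2 := @step (h 0 0 *: e_ 0) 1.
  have s3 := @step (h 0 0 *: e_ 0 + h 0 1 *: e_ 1) (2%:R).
  have {}s1 := s1 ltac:(by rewrite normr0 addr_ge0).
  have hh : `|h| <= `|h| + `|h| by rewrite lerDl.
  have {}s2 := s2 (le_trans (nk 0) hh).
  have {}s3 := s3 (le_trans (ler_normD _ _) (lerD (nk 0) (nk 1))).
  have ED : D h = h 0 0 * 'D_(e_ 0) f y + h 0 1 * 'D_(e_ 1) f y + h 0 (2%:R) * 'D_(e_ (2%:R)) f y.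
    by rewrite /D sum3.
  rewrite addr0 in s1; rewrite -[y + _ + _]addrA in s2.
  rewrite -[y + _ + _]addrA -Eh in s3.
  have -> : (f \o shift y - (cst (f y) + D)) h = f (y + h) - (f y + D h).
    by rewrite [y + h]addrC.
  rewrite ED; exact: three_steps s1 s2 s3.
have dD : 'd f y = D :> (V3 -> R^o) by exact: (@diff_unique _ _ _ f DL y cD oD).
by apply/diff_locallyP; rewrite dD; split.
Qed.

Lemma second_difference_bound (A B C D P Q s e : R) :
  `|A - B - C + D - s ^+ 2 * P| <= e * s ^+ 2 ->
  `|A - C - B + D - s ^+ 2 * Q| <= e * s ^+ 2 ->
  `|P - Q| * s ^+ 2 <= e * 2 * s ^+ 2.
Proof.
move=> h1 h2.
have -> : `|P - Q| * s ^+ 2 = `|(P - Q) * s ^+ 2|.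
  by rewrite normrM (ger0_norm (sqr_ge0 s)).
have -> : (P - Q) * s ^+ 2 =
  (A - C - B + D - s ^+ 2 * Q) - (A - B - C + D - s ^+ 2 * P) by ring.
apply: (le_trans (ler_normB _ _)); lra.
Qed.

Lemma half_lt (x : R) : 0 < x -> x / 4 * 2 < x.
Proof. by move=> ?; lra. Qed.

(** The second difference is symmetric in the two directions, so both mixed derivatives approximate
    the same number. If they differed by [X], the tolerance of a quarter of its norm on either side
    would bound that norm by half of itself. *)
Lemma schwarz f (U : set V3) (y : V3) (j k : 'I_3) :
  open U -> U y -> (forall i z, U z -> derivable f z (e_ i)) ->
  (forall i l z, U z -> derivable ('D_(e_ i) f) z (e_ l)) ->
  (forall i l, {for y, continuous ('D_(e_ l) ('D_(e_ i) f))}) ->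
  'D_(e_ k) ('D_(e_ j) f) y = 'D_(e_ j) ('D_(e_ k) f) y.
Proof.
move=> oU Uy df dd cc.
apply/eqP; rewrite -subr_eq0; apply/negPn/negP => ne.
set X := _ - _ in ne; have e0 : 0 < `|X| / 4 by rewrite divr_gt0 ?normr_gt0.
have [d1 d10 M1] := mixed_difference (norm_delta_le _) (norm_delta_le _) oU Uy (df j) (dd j k) (cc j k) e0.
have [d2 d20 M2] := mixed_difference (norm_delta_le _) (norm_delta_le _) oU Uy (df k) (dd k j) (cc k j) e0.
pose s := Num.min d1 d2 / 2.
have m0 : 0 < Num.min d1 d2 by rewrite lt_min d10.
have s0 : 0 < s by rewrite divr_gt0.
have sm : s < Num.min d1 d2 by rewrite /s; lra.
move: (sm); rewrite lt_min => /andP[sd1 sd2].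
have {}M1 := M1 s ltac:(by rewrite gtr0_norm).
have {}M2 := M2 s ltac:(by rewrite gtr0_norm).
have : `|X| * s ^+ 2 <= `|X| / 4 * 2 * s ^+ 2.
  move: M1 M2; rewrite [y + s *: e_ j + _]addrAC.
  set A := f _; set B := f _; set C' := f _; set D := f y => h1 h2.
  exact: second_difference_bound h1 h2.
rewrite ler_pM2r ?exprn_gt0 // leNgt => /negP; apply.
have := e0; rewrite pmulr_lgt0 // => X0; exact: half_lt.
Qed.

End Partials.

(** * Smooth functions of three variables *)

Section ScalarDerivatives.
Variables (R : realType) (V : normedModType R).
Implicit Types (f g : V -> R^o) (x v : V) (a b : R).

Lemma is_derive_add f g x v a b : is_derive x v f a -> is_derive x v g b ->
  is_derive x v (fun y => f y + g y : R^o) (a + b).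
Proof. by move=> *; exact: is_deriveD. Qed.

Lemma is_derive_mul f g x v a b : is_derive x v f a -> is_derive x v g b ->
  is_derive x v (fun y => (f y : R) * (g y : R) : R^o) (f x * b + g x * a).
Proof. by move=> *; exact: is_deriveM. Qed.

Lemma is_derive_inv f x v a : f x != 0 -> is_derive x v f a ->
  is_derive x v (fun y => (f y : R)^-1 : R^o) (- (f x) ^- 2 * a).
Proof.
move=> f0 [df <-]; split; first exact: derivableV.
exact: deriveV.
Qed.

(** A derivative along [v] only sees the line [t *: v + x], where the chain rule in one variable
    applies; differentiability of [f] as a whole is not assumed. *)
Lemma is_derive_comp1 (h : R -> R^o) f x v a b : is_derive (f x : R) 1 h a ->
  is_derive x v f b -> is_derive x v (fun y => h (f y) : R^o) (a * b).
Proof.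
move=> dh [df dfE].
have E (k : V -> R^o) : (fun t : R => t^-1 *: ((k \o shift x) (t *: v) - k x)) =
    (fun t : R => t^-1 *: (((fun t : R => k (t *: v + x) : R^o) \o shift 0) (t *: (1 : R)) - k (0 *: v + x))).
  by apply: funext => t /=; rewrite scale0r add0r addr0 [t *: (1 : R)]mulr1.
have dg : is_derive (0 : R) 1 (fun t : R => f (t *: v + x) : R^o) b.
  by split; rewrite -?dfE /derivable /derive -E.
have dh' : is_derive ((fun t : R => f (t *: v + x)) 0 : R) 1 h a.
  by rewrite scale0r add0r.
have [H1 H2] := @is_derive1_comp _ h (fun t : R => f (t *: v + x)) 0 a b dh' dg.
by split; [move: H1|move: H2]; rewrite /derivable /derive (E (fun y => h (f y))).
Qed.

End ScalarDerivatives.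

(** * A smooth function on the line that vanishes exactly on the non-positive half-line *)

Section FlatFunction.
Variable R : realType.

(* The derivatives of exp(-1/t) extended by zero to t <= 0 are combinations of
   these functions. *)
Definition flat (m : nat) (t : R) : R^o :=
  if 0 < t then t^-1 ^+ m * expR (- t^-1) else 0.

Lemma flat_pos m t : 0 < t -> 0 < flat m t.
Proof. by move=> t0; rewrite /flat t0 mulr_gt0 ?expR_gt0 // exprn_gt0 ?invr_gt0. Qed.

Lemma flat_npos m t : t <= 0 -> flat m t = 0.
Proof. by rewrite /flat leNgt => /negbTE ->. Qed.

Lemma flat_ge0 m t : 0 <= flat m t.
Proof. by have [t0|t0] := leP t 0; [rewrite flat_npos | rewrite ltW ?flat_pos]. Qed.

Lemma flat_mulr m t : flat m.+1 t * t = flat m t.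
Proof.
rewrite /flat; case: ifP => t0; last by rewrite mul0r.
by rewrite exprSr mulrAC mulfVK ?gt_eqF.
Qed.

(** The constant is that of the exponential series: [expR s] dominates [s ^+ m.+1] divided by
    (m+1)!, here with [s = t^-1]. *)
Lemma flat_bound m t : `|flat m t| <= m.+1`!%:R * `|t|.
Proof.
have [t0|t0] := leP t 0.
  by rewrite flat_npos // normr0 mulr_ge0.
rewrite ger0_norm ?flat_ge0 // gtr0_norm //.
rewrite /flat t0 expRN -ler_pdivlMr ?expR_gt0 // ?invr_gt0 ?expR_gt0 // invrK.
have s0 : 0 < t^-1 by rewrite invr_gt0.
have h := @expR_ge1Dxn R t^-1 m (ltW s0).
have f0 : 0 < m.+1`!%:R :> R by rewrite ltr0n fact_gt0.
rewrite -mulrA [t * _]mulrC mulrA -ler_pdivrMr // -exprSr mulrC.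
rewrite -ler_pdivrMr //; apply: le_trans h.
by rewrite lerDr.
Qed.

Lemma flat_continuous0 m : {for 0, continuous (flat m)}.
Proof.
apply/cvgrPdist_lt => e e0; apply/nbhs_ballP.
have c0 : 0 < m.+1`!%:R :> R by rewrite ltr0n fact_gt0.
exists (e / m.+1`!%:R); first by rewrite /= divr_gt0.
move=> t /=; rewrite sub0r normrN => te.
rewrite (flat_npos m (lexx _)) sub0r normrN; apply: le_lt_trans (flat_bound m t) _.
by rewrite mulrC -ltr_pdivlMr.
Qed.

Lemma is_derive_flat m (t : R) :
  is_derive t 1 (flat m) (flat m.+2 t - m%:R * flat m.+1 t).
Proof.
have [t0|t0|->] := ltgtP t 0; last first.
- rewrite !flat_npos // mulr0 subr0; apply/is_derive1_caratheodory.
  (* At the origin the difference quotient of [flat m] is [flat m.+1], which is continuous there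
     with value 0; this is differentiability in the form of Carathéodory. *)
  exists (flat m.+1); split; last by rewrite flat_npos.
    by move=> z; rewrite (flat_npos m (lexx 0)) subr0 [z - 0]subr0 flat_mulr.
  exact: flat_continuous0.
- have E : \forall s \near t, s^-1 ^+ m * expR (- s^-1) = flat m s :> R^o.
    near=> s; rewrite /flat ifT //; near: s.
    by apply: lt_nbhsr.
  apply: near_eq_is_derive E _.
  have tn0 : t != 0 by rewrite gt_eqF.
  have dV : is_derive t 1 (fun s : R => s^-1 : R^o) (- t ^- 2).
    by have := @is_deriveV R id t 1 1 tn0 (is_derive_id _ _); rewrite [_ *: _]mulr1.
  have d1 := @is_deriveX R R^o (fun s : R => s^-1) m t 1 _ dV.
  have d2 := @is_derive1_comp R expR (fun s : R => - s^-1) t _ _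
     (is_derive_expR (- t^-1)) (is_deriveN dV).
  have := is_derive_mul d1 d2.
  set c := (X in is_derive _ _ _ X -> _) => H.
  have {}H : is_derive t 1 (fun s : R => s^-1 ^+ m * expR (- s^-1) : R^o) c.
    have <- // : (fun y : R => ((fun s : R => s^-1) ^+ m) y * (expR \o (fun s : R => - s^-1)) y) =
      (fun s : R => s^-1 ^+ m * expR (- s^-1) : R^o).
    by apply: funext => s; rewrite exprfctE.
  apply: is_derive_eq H _.
  rewrite /c {c d1} /flat t0 /= exprfctE /= [_ *: _]mulrC; case: m => [|m]; last first.
      rewrite -!exprVn [m.+1.-1]/= !exprS expr0 mulr1.
    set u := t^-1; set v := expR _; set w := u ^+ m; ring.
  rewrite -!exprVn !exprS expr0 !mulr1; set u := t^-1; set v := expR _; ring.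
- rewrite !flat_npos ?ltW // mulr0 subr0.
  apply: near_eq_is_derive (is_derive_cst (0 : R^o) t 1).
  near=> s; rewrite flat_npos // ltW //; near: s.
  by apply: lt_nbhsl.
Unshelve. all: by end_near. Qed.

End FlatFunction.

(** * Functions with continuous partial derivatives up to a given order *)

Section Regularity.
Variables (R : realType) (V : normedModType R) (e : 'I_3 -> V).
Implicit Types (f g : V -> R^o) (U : set V).

(** Regularity of finite order, recursive in the order, is what products, inverses and compositions
    can be proved by induction on; smoothness itself offers no such measure. *)
Fixpoint Ck (n : nat) (U : set V) (f : V -> R^o) : Prop :=
  (forall y, U y -> {for y, continuous f}) /\
  if n is m.+1 then
    forall k, (forall y, U y -> derivable f y (e k)) /\ Ck m U ('D_(e k) f)
  else True.

Lemma Ck_continuous n U f y : Ck n U f -> U y -> {for y, continuous f}.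
Proof. by case: n => [|n] [cf _]; apply: cf. Qed.

Lemma Ck_pred n U f : Ck n.+1 U f -> Ck n U f.
Proof.
elim: n f => [|n IH] f [cf df]; split => // k.
by have [d c] := df k; split => //; exact: IH.
Qed.

Lemma near_eqfun U f g y : open U -> U y -> (forall y, U y -> f y = g y) ->
  \forall z \near y, f z = g z.
Proof. by move=> oU Uy fg; apply: filterS (open_nbhs_nbhs (conj oU Uy)) => z /fg. Qed.

Lemma continuous_congr U f g y : open U -> U y -> (forall y, U y -> f y = g y) ->
  {for y, continuous f} -> {for y, continuous g}.
Proof.
move=> oU Uy fg cf; have {}cf : f z @[z --> y] --> g y by rewrite -fg.
apply: cvg_trans cf; apply: near_eq_cvg.
by apply: filterS (near_eqfun oU Uy fg) => z ->.
Qed.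

Lemma Ck_congr n U f g : open U -> (forall y, U y -> f y = g y) ->
  Ck n U f -> Ck n U g.
Proof.
move=> oU; elim: n f g => [|n IH] f g fg [cf df]; split => //.
- by move=> y Uy; apply: continuous_congr fg _ => //; exact: cf.
- by move=> y Uy; apply: continuous_congr fg _ => //; exact: cf.
move=> k; have [d c] := df k; split.
  by move=> y Uy; apply: near_eq_derivable (near_eqfun oU Uy fg) _; exact: d.
apply: IH c => y Uy; apply: near_eq_derive; exact: near_eqfun oU Uy fg.
Qed.

(** The induction step of all closure properties: a formula [g] for the partial derivatives on [U]
    replaces them, because on an open set regularity depends only on the values taken there. *)
Lemma Ck_step n U f (g : 'I_3 -> V -> R^o) : open U ->
  (forall y, U y -> {for y, continuous f}) ->
  (forall k y, U y -> is_derive y (e k) f (g k y)) ->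
  (forall k, Ck n U (g k)) -> Ck n.+1 U f.
Proof.
move=> oU cf df cg; split=> // k; split; first by move=> y /(df k) [].
by apply: Ck_congr (cg k) => // y /(df k) [_ ->].
Qed.

Lemma Ck_is_derive n U f k y : Ck n.+1 U f -> U y ->
  is_derive y (e k) f ('D_(e k) f y).
Proof. by move=> [_ df] Uy; have [d _] := df k; exact: DeriveDef (d _ Uy) _. Qed.

Lemma Ck_derive n U f k : Ck n.+1 U f -> Ck n U ('D_(e k) f).
Proof. by move=> [_ /(_ k)[]]. Qed.

Lemma Ck_cst n U (c : R) : open U -> Ck n U (fun _ => c : R^o).
Proof.
move=> oU; elim: n c => [|n IH] c; first by split => // y _; exact: cvg_cst.
apply: (@Ck_step n U _ (fun _ _ => 0)) => //.
- by move=> y _; exact: cvg_cst.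
Qed.

Lemma Ck_add n U f g : open U -> Ck n U f -> Ck n U g ->
  Ck n U (fun y => f y + g y : R^o).
Proof.
move=> oU; elim: n f g => [|n IH] f g cf cg.
  by split => // y Uy; apply: cvgD; [exact: Ck_continuous cf Uy|exact: Ck_continuous cg Uy].
apply: (@Ck_step n U _ (fun k y => 'D_(e k) f y + 'D_(e k) g y)) => //.
- by move=> y Uy; apply: cvgD; [exact: Ck_continuous cf Uy|exact: Ck_continuous cg Uy].
- by move=> k y Uy; apply: is_derive_add; [exact: Ck_is_derive cf Uy|exact: Ck_is_derive cg Uy].
- by move=> k; apply: IH; apply: Ck_derive.
Qed.

Lemma Ck_mul n U f g : open U -> Ck n U f -> Ck n U g ->
  Ck n U (fun y => (f y : R) * (g y : R) : R^o).
Proof.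
move=> oU; elim: n f g => [|n IH] f g cf cg.
  by split => // y Uy; apply: cvgM; [exact: Ck_continuous cf Uy|exact: Ck_continuous cg Uy].
apply: (@Ck_step n U _ (fun k y => (f y : R) * ('D_(e k) g y : R)
                                   + (g y : R) * ('D_(e k) f y : R) : R^o)) => //.
- by move=> y Uy; apply: cvgM; [exact: Ck_continuous cf Uy|exact: Ck_continuous cg Uy].
- by move=> k y Uy; apply: is_derive_mul; [exact: Ck_is_derive cf Uy|exact: Ck_is_derive cg Uy].
- by move=> k; apply: Ck_add => //; apply: IH; by [exact: Ck_derive | exact: Ck_pred].
Qed.

(** The derivative of the inverse contains the inverse again, but only to the lower order supplied
    by the induction hypothesis. *)
Lemma Ck_inv n U f : open U -> (forall y, U y -> f y != 0) -> Ck n U f ->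
  Ck n U (fun y => (f y : R)^-1 : R^o).
Proof.
move=> oU f0; elim: n => [|n IH] cf.
  by split => // y Uy; apply: cvgV; [exact: f0 | exact: Ck_continuous cf Uy].
apply: (@Ck_step n U _ (fun k y => (- (f y) ^- 2 : R) * ('D_(e k) f y : R) : R^o)) => //.
- by move=> y Uy; apply: cvgV; [exact: f0 | exact: Ck_continuous cf Uy].
- move=> k y Uy; apply: is_derive_inv; first exact: f0.
  exact: Ck_is_derive cf Uy.
- move=> k; apply: Ck_mul => //; last exact: Ck_derive.
  have cV := IH (Ck_pred cf).
  apply: (@Ck_congr n U (fun y => (- 1 : R) * (((f y)^-1 : R) * ((f y)^-1 : R)) : R^o)) => //.
    by move=> y _; rewrite mulN1r -expr2 exprVn.
  by apply: Ck_mul => //; [exact: Ck_cst | exact: Ck_mul].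
Qed.

(** The induction on the order keeps [m] general, since differentiating [flat m] produces
    [flat m.+1] and [flat m.+2]. *)
Lemma Ck_comp_flat n U f m : open U -> Ck n U f ->
  Ck n U (fun y => flat m (f y) : R^o).
Proof.
move=> oU.
have cont f' m' y : {for y, continuous f'} ->
    {for y, continuous (fun y => flat m' (f' y) : R^o)}.
  move=> cf; apply: (@continuous_comp _ _ _ f' (flat m')) => //.
  apply: differentiable_continuous; apply/derivable1_diffP.
  by have [] := is_derive_flat m' (f' y).
elim: n m => [|n IH] m cf.
  by split => // y Uy; apply: cont; exact: Ck_continuous cf Uy.
apply: (@Ck_step n U _ (fun k y =>
   ((flat m.+2 (f y) - m%:R * flat m.+1 (f y)) : R) * ('D_(e k) f y : R) : R^o)) => //.
- by move=> y Uy; apply: cont; exact: Ck_continuous cf Uy.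
- move=> k y Uy; apply: is_derive_comp1; first exact: is_derive_flat.
  exact: Ck_is_derive cf Uy.
- move=> k; apply: Ck_mul => //; last exact: Ck_derive.
  have cf' := Ck_pred cf.
  apply: (@Ck_congr n U (fun y => flat m.+2 (f y) +
      ((- m%:R : R) * (flat m.+1 (f y) : R) : R^o) : R^o)) => //.
    by move=> y _; rewrite mulNr.
  apply: Ck_add => //; first exact: IH.
  by apply: Ck_mul => //; [exact: Ck_cst | exact: IH].
Qed.

End Regularity.

Lemma is_derive_chain (R : realType) (V W Z : normedModType R) (f : W -> Z)
    (F : V -> W) y v :
  differentiable F y -> differentiable f (F y) ->
  is_derive y v (f \o F) ('D_('D_v F y) f (F y)).
Proof.
move=> dF df; have dc := differentiable_comp dF df.
split; first exact: diff_derivable.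
by rewrite (deriveE _ dc) (deriveE _ df) (deriveE _ dF) diff_comp.
Qed.

Section SmoothOn.
Variable R : realType.
Local Notation V3 := 'rV[R]_3.
Local Notation e_ k := (delta_mx 0 k : V3).
Implicit Types (f g : V3 -> R^o) (U : set V3).

Local Notation CkV := (@Ck R V3 (fun k => delta_mx 0 k)).

(** Both directions treat all [iter_partial l f] at once: prepending an index to [l] is one more
    derivative, which trades one order of [Ck] for one letter of [l]. *)
Lemma smooth_onP U f : smooth_on U f <-> forall n, CkV n U f.
Proof.
split=> [sf n|cf l].
  suff H l : CkV n U (iter_partial l f) by exact: (H [::]).
  elim: n l => [|n IH] l; first by split => // y /(sf l) [].
  split; first by move=> y /(sf l) [].
  move=> k; split; first by move=> y /(sf l) [_].
  exact: (IH (k :: l)).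
have {}cf n : CkV n U (iter_partial l f).
  elim: l n => [|k l IH] n //=.
  by have [_ /(_ k)[]] := IH n.+1.
move=> y Uy; split; first exact: Ck_continuous (cf 0%N) Uy.
by move=> k; have [_ /(_ k)[+ _]] := cf 1%N; apply.
Qed.

Lemma smooth_on_sub U U' f : U' `<=` U -> smooth_on U f -> smooth_on U' f.
Proof. by move=> sU sf l y /sU; exact: sf. Qed.

Lemma smooth_on_congr U f g : open U -> (forall y, U y -> f y = g y) ->
  smooth_on U f -> smooth_on U g.
Proof. by move=> oU fg /smooth_onP sf; apply/smooth_onP => n; exact: Ck_congr (sf n). Qed.

Lemma smooth_on_cst U (c : R) : open U -> smooth_on U (fun _ => c : R^o).
Proof. by move=> oU; apply/smooth_onP => n; exact: Ck_cst. Qed.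

Lemma smooth_on_add U f g : open U -> smooth_on U f -> smooth_on U g ->
  smooth_on U (fun y => f y + g y : R^o).
Proof. by move=> oU /smooth_onP sf /smooth_onP sg; apply/smooth_onP => n; exact: Ck_add. Qed.

Lemma smooth_on_mul U f g : open U -> smooth_on U f -> smooth_on U g ->
  smooth_on U (fun y => (f y : R) * (g y : R) : R^o).
Proof. by move=> oU /smooth_onP sf /smooth_onP sg; apply/smooth_onP => n; exact: Ck_mul. Qed.

Lemma smooth_on_inv U f : open U -> (forall y, U y -> f y != 0) ->
  smooth_on U f -> smooth_on U (fun y => (f y : R)^-1 : R^o).
Proof. by move=> oU f0 /smooth_onP sf; apply/smooth_onP => n; exact: Ck_inv. Qed.

Lemma smooth_on_flat U f m : open U -> smooth_on U f ->
  smooth_on U (fun y => flat m (f y) : R^o).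
Proof. by move=> oU /smooth_onP sf; apply/smooth_onP => n; exact: Ck_comp_flat. Qed.

Lemma smooth_on_partial U f k : smooth_on U f -> smooth_on U ('D_(e_ k) f).
Proof. by move=> /smooth_onP sf; apply/smooth_onP => n; exact: Ck_derive (sf n.+1). Qed.

Lemma smooth_on_derivable U f y k : smooth_on U f -> U y -> derivable f y (e_ k).
Proof. by move=> sf Uy; have [_] := sf [::] y Uy; apply. Qed.

Lemma smooth_on_continuous U f y : smooth_on U f -> U y -> {for y, continuous f}.
Proof. by move=> sf Uy; have [] := sf [::] y Uy. Qed.

Lemma derive_coord (F : V3 -> V3) y v k : differentiable F y ->
  ('D_v F y) 0 k = 'D_v (fun z => F z 0 k : R^o) y.
Proof.
by move=> dF; rewrite derive_mx; [rewrite mxE | exact: diff_derivable].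
Qed.

Lemma smooth_on_differentiable U f y : open U -> U y -> smooth_on U f ->
  differentiable f y.
Proof.
move=> oU Uy sf; apply: (partials_differentiable oU Uy).
  by move=> k z; exact: smooth_on_derivable sf.
move=> k; exact: smooth_on_continuous (smooth_on_partial k sf) Uy.
Qed.

Lemma derive_partials f y v : differentiable f y ->
  'D_v f y = \sum_k v 0 k * 'D_(e_ k) f y :> R.
Proof.
move=> df; rewrite deriveE // [v in LHS]row_sum_delta linear_sum.
by apply: eq_bigr => k _; rewrite linearZ deriveE.
Qed.

Lemma smooth_on_schwarz U f y j k : open U -> U y -> smooth_on U f ->
  'D_(e_ k) ('D_(e_ j) f) y = 'D_(e_ j) ('D_(e_ k) f) y.
Proof.
move=> oU Uy sf; apply: (schwarz _ _ oU Uy).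
- by move=> i z; exact: smooth_on_derivable.
- by move=> i l z; apply: smooth_on_derivable; exact: smooth_on_partial.
- move=> i l; apply: smooth_on_continuous Uy.
  by apply: smooth_on_partial; exact: smooth_on_partial.
Qed.

Lemma differentiable_coords (F : V3 -> V3) y :
  (forall k, differentiable (fun z => F z 0 k : R^o) y) -> differentiable F y.
Proof.
move=> dF; have -> : F = \sum_(k < 3) (fun z => F z 0 k *: e_ k).
  by apply: funext => z; rewrite fct_sumE -row_sum_delta.
apply: (@differentiable_sum _ _ _ 3 (fun k z => F z 0 k *: e_ k)) => k.
exact: (@differentiableZl _ _ _ (fun z => F z 0 k : R^o)).
Qed.

(** By the chain rule the partial derivatives of [f \o F] are sums of products of derivatives of [F]
    with functions ['D_j f \o F], to which the induction hypothesis applies because [f] is kept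
    general. *)
Lemma smooth_on_comp U U' f (F : V3 -> V3) : open U -> open U' ->
  (forall y, U y -> U' (F y)) -> smooth_on U' f ->
  (forall k, smooth_on U (fun y => F y 0 k : R^o)) -> smooth_on U (f \o F).
Proof.
move=> oU oU' UF sf sF.
have dF y : U y -> differentiable F y.
  move=> Uy; apply: differentiable_coords => k.
  exact: smooth_on_differentiable Uy (sF k).
have cont g y : smooth_on U' g -> U y -> {for y, continuous (g \o F)}.
  move=> sg Uy; apply: continuous_comp.
    exact: differentiable_continuous (dF _ Uy).
  by apply: smooth_on_continuous sg _; exact: UF.
apply/smooth_onP => n; elim: n f sf => [|n IH] f sf.
  by split => // y; exact: cont.
apply: (@Ck_step _ _ _ n U _ (fun k y => \sum_j
  (('D_(e_ k) (fun z => F z 0 j : R^o) y : R) * ('D_(e_ j) f (F y) : R)) : R^o)) => //.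
- by move=> y; exact: cont.
- move=> k y Uy; have dfF : differentiable f (F y).
    by apply: smooth_on_differentiable sf => //; exact: UF.
  have [d1 d2] := is_derive_chain (e_ k) (dF _ Uy) dfF.
  split => //; rewrite d2 derive_partials //.
  by apply: eq_bigr => j _; rewrite derive_coord //; exact: dF.
- move=> k; apply: (@Ck_congr _ _ _ n U (fun y =>
   ((('D_(e_ k) (fun z => F z 0 0 : R^o) y : R) * ('D_(e_ 0) f (F y) : R) : R^o) +
   (('D_(e_ k) (fun z => F z 0 1 : R^o) y : R) * ('D_(e_ 1) f (F y) : R) : R^o) : R^o) +
   (('D_(e_ k) (fun z => F z 0 (2%:R) : R^o) y : R) * ('D_(e_ (2%:R)) f (F y) : R) : R^o) : R^o)) => //.
    by move=> y _; rewrite sum3.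
  have H j : CkV n U (fun y => ('D_(e_ k) (fun z => F z 0 j : R^o) y : R) * ('D_(e_ j) f (F y) : R) : R^o).
    apply: Ck_mul => //; last exact: (IH _ (smooth_on_partial j sf)).
    exact: ((smooth_onP _ _).1 (smooth_on_partial k (sF j)) n).
  by apply: Ck_add => //; apply: Ck_add.
Qed.

Lemma smooth_on_opp U f : open U -> smooth_on U f -> smooth_on U (fun y => - f y : R^o).
Proof.
move=> oU sf; have := smooth_on_mul oU (smooth_on_cst (-1) oU) sf.
by apply: smooth_on_congr => // y _; rewrite mulN1r.
Qed.

End SmoothOn.

(** * Smooth functions and tangent vectors on a 3-manifold *)

Section SmoothFun.
Variables (R : realType) (M : manifold3 R).
Local Notation V3 := 'rV[R]_3.
Local Notation e_ k := (delta_mx 0 k : V3).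
Implicit Types (W U : set M) (f g : M -> R^o) (i j : atlas M).

(** Inside the open image of the chart this set is the preimage of [W] under [cinv i], which is
    continuous there. *)
Lemma open_chart_image W i : open W -> open (cmap i @` (W `&` cdom i)).
Proof.
move=> oW; rewrite openE => y [x [Wx dx] <-].
have iy : (cmap i @` cdom i) (cmap i x) by exists x.
have n1 := open_nbhs_nbhs (conj (@cimage_open R M i) iy).
have n2 : nbhs (cmap i x) (cinv i @^-1` W).
  apply: (cinv_continuous iy); rewrite cmapK //.
  exact: open_nbhs_nbhs.
apply: filterS2 n1 n2 => z [x' dx' <-]; rewrite /preimage /= cmapK // => Wx'.
by exists x'.
Qed.

Lemma open_cdomI W i : open W -> open (W `&` cdom i).
Proof. by move=> oW; apply: openI => //; exact: cdom_open. Qed.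

Lemma smooth_fun_sub W U f : U `<=` W -> smooth_fun W f -> smooth_fun U f.
Proof.
move=> UW sf i; apply: smooth_on_sub (sf i) => y [x [Ux dx] <-].
by exists x => //; split => //; exact: UW.
Qed.

Lemma smooth_fun_glue W f :
  (forall x, W x -> exists U, [/\ open U, U x & smooth_fun (W `&` U) f]) ->
  smooth_fun W f.
Proof.
move=> H i l y [x [Wx dx] <-]; have [U [oU Ux sf]] := H x Wx.
by apply: (sf i l); exists x.
Qed.

Lemma smooth_fun_congr W f g : open W -> (forall x, W x -> f x = g x) ->
  smooth_fun W f -> smooth_fun W g.
Proof.
move=> oW fg sf i; apply: smooth_on_congr (sf i); first exact: open_chart_image.
by move=> y [x [Wx dx] <-] /=; rewrite cmapK // fg.
Qed.

Lemma smooth_fun_cst W (c : R) : open W -> smooth_fun W (fun _ => c : R^o).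
Proof. by move=> oW i; apply: smooth_on_cst; exact: open_chart_image. Qed.

Lemma smooth_fun_add W f g : open W -> smooth_fun W f -> smooth_fun W g ->
  smooth_fun W (fun y => f y + g y : R^o).
Proof.
move=> oW sf sg i; have oi := open_chart_image (i := i) oW.
exact: smooth_on_add oi (sf i) (sg i).
Qed.

Lemma smooth_fun_mul W f g : open W -> smooth_fun W f -> smooth_fun W g ->
  smooth_fun W (fun y => (f y : R) * (g y : R) : R^o).
Proof.
move=> oW sf sg i; have oi := open_chart_image (i := i) oW.
exact: smooth_on_mul oi (sf i) (sg i).
Qed.

Lemma smooth_fun_opp W f : open W -> smooth_fun W f ->
  smooth_fun W (fun y => - f y : R^o).
Proof.
move=> oW sf i; have oi := open_chart_image (i := i) oW.
exact: smooth_on_opp oi (sf i).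
Qed.

Lemma smooth_fun_inv W f : open W -> (forall x, W x -> f x != 0) ->
  smooth_fun W f -> smooth_fun W (fun y => (f y : R)^-1 : R^o).
Proof.
move=> oW f0 sf i; have oi := open_chart_image (i := i) oW.
apply: smooth_on_inv oi _ (sf i) => y [x [Wx dx] <-] /=.
by rewrite cmapK // f0.
Qed.

Lemma smooth_fun_flat W f m : open W -> smooth_fun W f ->
  smooth_fun W (fun y => flat m (f y) : R^o).
Proof.
move=> oW sf i; have oi := open_chart_image (i := i) oW.
exact: smooth_on_flat oi (sf i).
Qed.

Lemma smooth_fun_sum W (I : Type) (r : seq I) (P : pred I) (F : I -> M -> R^o) :
  open W -> (forall a, P a -> smooth_fun W (F a)) ->
  smooth_fun W (fun x => \sum_(a <- r | P a) F a x : R^o).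
Proof.
move=> oW sF; elim: r => [|a r IH].
  apply: smooth_fun_congr (smooth_fun_cst 0 oW) => // x _.
  by rewrite big_nil.
case Pa: (P a).
  apply: smooth_fun_congr (smooth_fun_add oW (sF a Pa) IH) => // x _.
  by rewrite big_cons Pa.
by apply: smooth_fun_congr IH => // x _; rewrite big_cons Pa.
Qed.

Lemma smooth_fun_prod W (I : Type) (r : seq I) (P : pred I) (F : I -> M -> R^o) :
  open W -> (forall a, P a -> smooth_fun W (F a)) ->
  smooth_fun W (fun x => \prod_(a <- r | P a) (F a x : R) : R^o).
Proof.
move=> oW sF; elim: r => [|a r IH].
  apply: smooth_fun_congr (smooth_fun_cst 1 oW) => // x _.
  by rewrite big_nil.
case Pa: (P a).
  apply: smooth_fun_congr (smooth_fun_mul oW (sF a Pa) IH) => // x _.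
  by rewrite big_cons Pa.
by apply: smooth_fun_congr IH => // x _; rewrite big_cons Pa.
Qed.

Lemma smooth_fun_continuous W f x : open W -> W x -> smooth_fun W f ->
  {for x, continuous f}.
Proof.
move=> oW Wx sf; pose c := chart_at x; have dx := chart_at_dom x.
have cf : {for cmap c x, continuous (f \o cinv c)}.
  by apply: smooth_on_continuous (sf c) _; exists x.
have cc : {for x, continuous ((f \o cinv c) \o cmap c)}.
  by apply: continuous_comp => //; exact: cmap_continuous.
have cc' : (f \o cinv c \o cmap c) z @[z --> x] --> f x.
  by move: cc; rewrite /prop_for /continuous_at /= cmapK.
apply: cvg_trans cc'; apply: near_eq_cvg.
apply: filterS (open_nbhs_nbhs (conj (@cdom_open R M c) dx)) => z dz /=.
by rewrite cmapK.
Qed.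

Lemma smooth_fun_neq0 W f x : open W -> W x -> smooth_fun W f -> f x != 0 ->
  exists U, [/\ open U, U x, U `<=` W & forall y, U y -> f y != 0].
Proof.
move=> oW Wx sf f0; have cf := smooth_fun_continuous oW Wx sf.
have n1 : nbhs x (fun y => f y != 0).
  have /cvgrPdist_lt/(_ `|f x|) := cf; rewrite normr_gt0 => /(_ f0) cf'.
  apply: filterS cf' => y; apply: contraTneq => ->.
  by rewrite subr0 ltxx.
have n2 : nbhs x ((fun y => f y != 0) `&` W) by apply: filterI n1 _; exact: open_nbhs_nbhs.
move: n2; rewrite nbhsE => -[U [oU Ux] sU]; exists U; split => // y /sU [] //.
Qed.

Lemma chart_imageE W i x : W x -> cdom i x -> (cmap i @` (W `&` cdom i)) (cmap i x).
Proof. by move=> *; exists x. Qed.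

(** In any other chart [f] is its representation in the chart [i] composed with a transition map. *)
Lemma smooth_fun_chart W i f : open W -> W `<=` cdom i ->
  smooth_on (cmap i @` (W `&` cdom i)) (f \o cinv i) -> smooth_fun W f.
Proof.
move=> oW Wi sf j; have oj := open_chart_image (i := j) oW; have oi := open_chart_image (i := i) oW.
have H : smooth_on (cmap j @` (W `&` cdom j)) ((f \o cinv i) \o (cmap i \o cinv j)).
  apply: smooth_on_comp oj oi _ sf _.
    move=> y [x [Wx dx] <-] /=; rewrite cmapK //.
    by apply: chart_imageE => //; exact: Wi.
  move=> k; apply: smooth_on_sub (@transition_smooth R M j i k) => y [x [Wx dx] <-].
  by exists x => //; split => //; exact: Wi.
apply: smooth_on_congr H => // y [x [Wx dx] <-] /=.
by rewrite cmapK // cmapK //; exact: Wi.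
Qed.

Lemma smooth_fun_coord i k : smooth_fun (cdom i) (fun x => cmap i x 0 k : R^o).
Proof.
move=> j; apply: smooth_on_sub (@transition_smooth R M j i k).
by move=> y [x [dx dx'] <-]; exists x.
Qed.

Definition pd i k f : M -> R^o := fun x => 'D_(e_ k) (f \o cinv i) (cmap i x).

Lemma smooth_fun_pd W i k f : open W -> W `<=` cdom i -> smooth_fun W f ->
  smooth_fun W (pd i k f).
Proof.
move=> oW Wi sf; apply: (@smooth_fun_chart W i) => //.
have oi := open_chart_image (i := i) oW.
apply: smooth_on_congr (smooth_on_partial k (sf i)) => //.
by move=> y [x [Wx dx] <-] /=; rewrite /pd cmapK.
Qed.

Lemma pd_congr W i k f g x : open W -> W x -> cdom i x ->
  (forall x, W x -> f x = g x) -> pd i k f x = pd i k g x.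
Proof.
move=> oW Wx dx fg; apply: near_eq_derive.
have oi := open_chart_image (i := i) oW.
apply: (near_eqfun oi (chart_imageE Wx dx)) => y [z [Wz dz] <-] /=.
by rewrite cmapK // fg.
Qed.

Lemma is_derive_pd W i k f x : open W -> W x -> cdom i x -> smooth_fun W f ->
  is_derive (cmap i x) (e_ k) (f \o cinv i) (pd i k f x).
Proof.
move=> oW Wx dx sf; apply: DeriveDef => //.
exact: smooth_on_derivable (sf i) (chart_imageE Wx dx).
Qed.

Lemma pd_add W i k f g x : open W -> W x -> cdom i x -> smooth_fun W f ->
  smooth_fun W g -> pd i k (fun x => f x + g x : R^o) x = pd i k f x + pd i k g x.
Proof.
move=> oW Wx dx sf sg.
by have [] := is_derive_add (is_derive_pd k oW Wx dx sf) (is_derive_pd k oW Wx dx sg).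
Qed.

Lemma pd_mul W i k f g x : open W -> W x -> cdom i x -> smooth_fun W f ->
  smooth_fun W g -> pd i k (fun x => (f x : R) * (g x : R) : R^o) x =
    (f x : R) * pd i k g x + (g x : R) * pd i k f x.
Proof.
move=> oW Wx dx sf sg.
have [_] := is_derive_mul (is_derive_pd k oW Wx dx sf) (is_derive_pd k oW Wx dx sg).
by rewrite /= cmapK.
Qed.

Lemma pd_cst i k (c : R) x : pd i k (fun _ => c : R^o) x = 0.
Proof. exact: derive_cst. Qed.

Lemma pd_schwarz W i k l f x : open W -> W x -> cdom i x -> smooth_fun W f ->
  pd i k (pd i l f) x = pd i l (pd i k f) x.
Proof.
move=> oW Wx dx sf; have oi := open_chart_image (i := i) oW.
have ix := chart_imageE Wx dx.
have E a b : pd i a (pd i b f) x = 'D_(e_ a) ('D_(e_ b) (f \o cinv i)) (cmap i x).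
  apply: near_eq_derive; apply: (near_eqfun oi ix) => y [z [Wz dz] <-] /=.
  by rewrite /pd cmapK.
by rewrite !E; exact: smooth_on_schwarz oi ix (sf i).
Qed.

End SmoothFun.

(** * Tangent vectors in charts and derivatives of functions along them *)

Section Tangent.
Variables (R : realType) (M : manifold3 R).
Local Notation V3 := 'rV[R]_3.
Local Notation e_ k := (delta_mx 0 k : V3).
Implicit Types (W U : set M) (f g : M -> R^o) (i j : atlas M) (x : M) (v : V3).

Lemma transition_differentiable i j x : cdom i x -> cdom j x ->
  differentiable (cmap j \o cinv i) (cmap i x).
Proof.
move=> di dj; apply: differentiable_coords => k.
apply: smooth_on_differentiable (@transition_smooth R M i j k).
  by rewrite setIC; apply: open_chart_image; exact: cdom_open.
by exists x.
Qed.

Lemma chart_function_differentiable W i f x : open W -> W x -> cdom i x ->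
  smooth_fun W f -> differentiable (f \o cinv i) (cmap i x).
Proof.
move=> oW Wx di sf; apply: smooth_on_differentiable (sf i).
  exact: open_chart_image.
exact: chart_imageE.
Qed.

Lemma near_chart W i x (P : V3 -> Prop) : open W -> W x -> cdom i x ->
  (forall z, W z -> cdom i z -> P (cmap i z)) -> \forall y \near cmap i x, P y.
Proof.
move=> oW Wx di H; have oi := open_chart_image (i := i) oW.
apply: filterS (open_nbhs_nbhs (conj oi (chart_imageE Wx di))).
by move=> y [z [Wz dz] <-]; exact: H.
Qed.

(** The chain rule for a factorisation through the chart [j] that is valid only near the point. The
    target [Z] is general so that [f] may be a chart map; this case shows that the two conversions
    of tangent components are mutually inverse. *)
Lemma chart_change_chain (Z : normedModType R) (f : M -> Z) i j x v :
  cdom i x -> cdom j x -> differentiable (f \o cinv j) (cmap j x) ->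
  'D_v (f \o cinv i) (cmap i x) =
  'D_('D_v (cmap j \o cinv i) (cmap i x)) (f \o cinv j) (cmap j x).
Proof.
move=> di dj df; have dF := transition_differentiable di dj.
have E : (cmap j \o cinv i) (cmap i x) = cmap j x by rewrite /= cmapK.
rewrite -E in df *; have [_ <-] := is_derive_chain v dF df.
apply: near_eq_derive; apply: (near_chart (@cdom_open R M j) dj di) => z dz dz'.
by rewrite /= cmapK // cmapK.
Qed.

Lemma derive_chart_id i x v : cdom i x ->
  'D_v (cmap i \o cinv i) (cmap i x) = v.
Proof.
move=> di; rewrite -[RHS](@derive_id _ _ (cmap i x)); apply: near_eq_derive.
by apply: (near_chart (@cdom_open R M i) di di) => z dz _; rewrite /= cmapK.
Qed.

Lemma tangent_to_chartK i x v : cdom i x ->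
  tangent_of_chart i x (tangent_to_chart i x v) = v.
Proof.
move=> di; have dc := chart_at_dom x.
rewrite /tangent_of_chart /tangent_to_chart -chart_change_chain //.
  exact: derive_chart_id.
exact: transition_differentiable.
Qed.

Lemma tangent_of_chartK i x v : cdom i x ->
  tangent_to_chart i x (tangent_of_chart i x v) = v.
Proof.
move=> di; have dc := chart_at_dom x.
rewrite /tangent_of_chart /tangent_to_chart -chart_change_chain //.
  exact: derive_chart_id.
exact: transition_differentiable.
Qed.

Lemma tangent_to_chart_linear i x : cdom i x -> linear (tangent_to_chart i x).
Proof.
move=> di a u v; have df := transition_differentiable (chart_at_dom x) di.
by rewrite /tangent_to_chart !(deriveE _ df) linearP.
Qed.

Lemma tangent_of_chart_linear i x : cdom i x -> linear (tangent_of_chart i x).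
Proof.
move=> di a u v; have df := transition_differentiable di (chart_at_dom x).
by rewrite /tangent_of_chart !(deriveE _ df) linearP.
Qed.

Lemma tangent_of_chart_coord i j x k l : cdom i x -> cdom j x ->
  tangent_to_chart j x (tangent_of_chart i x (e_ k)) 0 l =
  pd i k (fun x => cmap j x 0 l : R^o) x.
Proof.
move=> di dj; rewrite /tangent_of_chart /tangent_to_chart -chart_change_chain //; last first.
- exact: transition_differentiable (chart_at_dom x) dj.
- exact: chart_at_dom.
by rewrite derive_coord //; exact: transition_differentiable.
Qed.

(** The derivative along a tangent vector given by its components in the preferred chart at [x]; on
    vectors of H it is [dH]. *)
Definition dir f x v : R := 'D_v (f \o cinv (chart_at x)) (cmap (chart_at x) x).

(** The preferred chart may jump with [x], so smooth dependence on [x] becomes visible only in one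
    fixed chart [i]. *)
Lemma dirE W f i x v : open W -> W x -> cdom i x -> smooth_fun W f ->
  dir f x v = \sum_k tangent_to_chart i x v 0 k * pd i k f x.
Proof.
move=> oW Wx di sf; have df := chart_function_differentiable oW Wx di sf.
rewrite /dir (chart_change_chain v (chart_at_dom x) di df).
by rewrite derive_partials.
Qed.

Lemma dir_congr W f g x v : open W -> W x -> (forall x, W x -> f x = g x) ->
  dir f x v = dir g x v.
Proof.
move=> oW Wx fg; apply: near_eq_derive.
by apply: (near_chart oW Wx (chart_at_dom x)) => z Wz dz; rewrite /= cmapK // fg.
Qed.

Lemma dir_derive W f x v : open W -> W x -> smooth_fun W f ->
  is_derive (cmap (chart_at x) x) v (f \o cinv (chart_at x)) (dir f x v).
Proof.
move=> oW Wx sf; apply: DeriveDef => //; apply: diff_derivable.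
exact: chart_function_differentiable oW Wx (chart_at_dom x) sf.
Qed.

Lemma dir_add W f g x v : open W -> W x -> smooth_fun W f -> smooth_fun W g ->
  dir (fun y => f y + g y : R^o) x v = dir f x v + dir g x v.
Proof.
move=> oW Wx sf sg.
by have [_] := is_derive_add (dir_derive v oW Wx sf) (dir_derive v oW Wx sg).
Qed.

Lemma dir_mul W f g x v : open W -> W x -> smooth_fun W f -> smooth_fun W g ->
  dir (fun y => (f y : R) * (g y : R) : R^o) x v =
  f x * dir g x v + g x * dir f x v.
Proof.
move=> oW Wx sf sg.
have [_] := is_derive_mul (dir_derive v oW Wx sf) (dir_derive v oW Wx sg).
by rewrite /= cmapK //; exact: chart_at_dom.
Qed.

Lemma dir_cst (c : R) x v : dir (fun _ => c : R^o) x v = 0.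
Proof. exact: derive_cst. Qed.

Lemma dir_opp W f x v : open W -> W x -> smooth_fun W f ->
  dir (fun y => - f y : R^o) x v = - dir f x v.
Proof.
move=> oW Wx sf.
rewrite (@dir_congr W _ (fun y => (-1 : R) * (f y : R) : R^o)) //; last first.
  by move=> y _; rewrite mulN1r.
rewrite (dir_mul _ oW Wx (smooth_fun_cst (-1) oW) sf).
by rewrite dir_cst mulr0 addr0 mulN1r.
Qed.

Lemma dir_sum W (I : Type) (r : seq I) (F : I -> M -> R^o) x v :
  open W -> W x -> (forall a, smooth_fun W (F a)) ->
  dir (fun y => \sum_(a <- r) F a y : R^o) x v = \sum_(a <- r) dir (F a) x v.
Proof.
move=> oW Wx sF; elim: r => [|a r IH].
  rewrite big_nil -[RHS](dir_cst 0 x v); apply: dir_congr Wx _ => // y _.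
  by rewrite big_nil.
rewrite big_cons -IH -(dir_add _ oW Wx (sF a)); last exact: smooth_fun_sum.
by apply: dir_congr Wx _ => // y _; rewrite big_cons.
Qed.

Lemma dir_linear W f x : open W -> W x -> smooth_fun W f ->
  linear (dir f x : V3 -> R^o).
Proof.
move=> oW Wx sf a u v.
have df := chart_function_differentiable oW Wx (chart_at_dom x) sf.
by rewrite /dir !(deriveE _ df) linearP.
Qed.

Definition smooth_field W (X : M -> V3) := @smooth_sec R M (tangent_bundle M) W X.

Lemma smooth_dir W f (X : M -> V3) : open W -> smooth_fun W f ->
  smooth_field W X -> smooth_fun W (fun x => dir f x (X x) : R^o).
Proof.
move=> oW sf sX; apply: smooth_fun_glue => x Wx; exists (cdom (chart_at x)).
pose i := chart_at x; have oWi := open_cdomI i oW.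
have sfi : smooth_fun (W `&` cdom i) f by apply: smooth_fun_sub sf; exact: subIsetl.
split; [exact: cdom_open | exact: chart_at_dom |].
have sG : smooth_fun (W `&` cdom i)
    (fun y => \sum_k (tangent_to_chart i y (X y) 0 k : R) * (pd i k f y : R) : R^o).
  apply: (smooth_fun_sum _ oWi) => k _.
  apply: (smooth_fun_mul oWi (sX i k)).
  by apply: (smooth_fun_pd _ oWi _ sfi); exact: subIsetr.
apply: (smooth_fun_congr oWi _ sG) => y [Wy dy].
by rewrite (dirE (X y) oWi (conj Wy dy) dy sfi).
Qed.

End Tangent.

(** * Bundles with local frames *)

Section Unbundled.
Variables (K : pzRingType) (A B : lmodType K) (f : A -> B).
Hypothesis lf : linear f.

Lemma lin0 : f 0 = 0.
Proof. by have := lf (-1) 0 0; rewrite scaler0 add0r scaleN1r addNr. Qed.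

Lemma linZ a u : f (a *: u) = a *: f u.
Proof. by have := lf a u 0; rewrite lin0 !addr0. Qed.

Lemma linD u v : f (u + v) = f u + f v.
Proof. by have := lf 1 u v; rewrite !scale1r. Qed.

Lemma linN u : f (- u) = - f u.
Proof. by have := linZ (-1) u; rewrite !scaleN1r. Qed.

Lemma linB u v : f (u - v) = f u - f v.
Proof. by rewrite linD linN. Qed.

Lemma lin_sum (I : Type) (r : seq I) (F : I -> A) :
  f (\sum_(i <- r) F i) = \sum_(i <- r) f (F i).
Proof. by elim/big_rec2: _ => [|i y x _ <-]; rewrite ?lin0 // linD. Qed.

End Unbundled.

Lemma linfunE (K : fieldType) (aT rT : vectType K) (f : aT -> rT) :
  linear f -> linfun f =1 f.
Proof.
move=> lf; pose fL := HB.pack_for {linear aT -> rT} f (GRing.isLinear.Build _ _ _ _ f lf).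
exact: (lfunE fL).
Qed.

Section Frames.
Variables (R : realType) (M : manifold3 R).
Implicit Types (W U : set M) (V : bundle M) (x : M).

(** The record [bundle] imposes no law on [smooth_sec]. This and [sec_glue] are the two sheaf
    properties that the arguments rely on. *)
Definition sec_restrict V := forall W U (s : section V), open W -> open U ->
  U `<=` W -> smooth_sec W s -> smooth_sec U s.

Definition sec_glue V := forall W (s : section V), open W ->
  (forall x, W x -> exists U, [/\ open U, U x & smooth_sec (W `&` U) s]) ->
  smooth_sec W s.

(** A local frame [e] with its dual coframe [c]; the last clause says that [smooth_sec] is
    smoothness of coordinates. The index is an arbitrary finite type so that bundles of
    homomorphisms can be framed by pairs. *)
Definition frame V U (I : finType) (e : I -> section V)
    (c : I -> forall x, fib V x -> R^o) :=
  [/\ forall x i, U x -> linear (c i x),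
      forall x v, U x -> v = \sum_i c i x v *: e i x,
      forall x i j, U x -> c i x (e j x) = (i == j)%:R &
      forall W (s : section V), open W -> W `<=` U ->
        smooth_sec W s <-> forall i, smooth_fun W (fun x => c i x (s x))].

Definition framed V U := exists (I : finType) (e : I -> section V) c, frame U e c.

Definition vbundle V :=
  [/\ sec_restrict V, sec_glue V &
      forall p : M, exists U, [/\ open U, U p & framed V U]].

Lemma framed_sub V U U' : U' `<=` U -> framed V U -> framed V U'.
Proof.
move=> sU [I [e [c [f1 f2 f3 f4]]]]; exists I, e, c; split.
- by move=> x i /sU; exact: f1.
- by move=> x v /sU; exact: f2.
- by move=> x i j /sU; exact: f3.
- by move=> W s oW WU; apply: f4 => //; exact: subset_trans sU.
Qed.

Lemma frame_smooth V U (I : finType) (e : I -> section V) c i W : frame U e c ->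
  open W -> W `<=` U -> smooth_sec W (e i).
Proof.
move=> [f1 f2 f3 f4] oW WU; apply/f4 => // j.
apply: smooth_fun_congr oW _ (smooth_fun_cst (j == i)%:R oW) => x Wx.
by rewrite f3 //; exact: WU.
Qed.

Lemma coframe_sum V U (I : finType) (e : I -> section V) c : frame U e c ->
  forall x i (a : I -> R), U x -> c i x (\sum_j a j *: e j x) = a i.
Proof.
move=> [f1 f2 f3 f4] x i a Ux.
rewrite (lin_sum (f1 x i Ux)) (bigD1 i) //= big1 ?addr0.
  by rewrite (linZ (f1 x i Ux)) f3 // eqxx /GRing.scale /= mulr1.
move=> j ji; rewrite (linZ (f1 x i Ux)) f3 // eq_sym (negbTE ji).
by rewrite /GRing.scale /= mulr0.
Qed.

Lemma coframe_inj V U (I : finType) (e : I -> section V) c : frame U e c ->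
  forall x (v w : fib V x), U x -> (forall i, c i x v = c i x w) -> v = w.
Proof.
move=> [f1 f2 f3 f4] x v w Ux H.
by rewrite (f2 x v Ux) (f2 x w Ux); apply: eq_bigr => i _; rewrite H.
Qed.

Section Vbundle.
Variable V : bundle M.
Hypothesis vV : vbundle V.

Lemma vb_local W (s : section V) : open W ->
  (forall (U : set M) (I : finType) (e : I -> section V) c, open U -> U `<=` W -> frame U e c ->
     forall i, smooth_fun U (fun x => c i x (s x))) -> smooth_sec W s.
Proof.
move=> oW H; have [rV gV fV] := vV; apply: gV => // p Wp.
have [U [oU Up frU]] := fV p; exists U; split=> //.
have oWU : open (W `&` U) by exact: openI.
have [I [e [c fe]]] := framed_sub (@subIsetr _ W U) frU.
have [f1 f2 f3 f4] := fe; apply/f4 => // i.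
by apply: H fe i => //; exact: subIsetl.
Qed.

Lemma vb_coord W (s : section V) : open W -> smooth_sec W s ->
  forall (U : set M) (I : finType) (e : I -> section V) c, open U -> U `<=` W -> frame U e c ->
     forall i, smooth_fun U (fun x => c i x (s x)).
Proof.
move=> oW ss U I e c oU UW [f1 f2 f3 f4]; apply/f4 => //.
by have [rV _ _] := vV; exact: rV ss.
Qed.

Lemma vb_congr W (s t : section V) : open W -> eq_on W s t ->
  smooth_sec W s -> smooth_sec W t.
Proof.
move=> oW st ss; apply: vb_local => // U I e c oU UW fe i.
apply: smooth_fun_congr (vb_coord oW ss oU UW fe i) => // x Ux.
by rewrite st //; exact: UW.
Qed.

Lemma vb_comb W (f : M -> R^o) (s t : section V) : open W -> smooth_fun W f ->
  smooth_sec W s -> smooth_sec W t ->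
  smooth_sec W ((fun x => f x *: s x + t x) : section V).
Proof.
move=> oW sf ss st; apply: vb_local => // U I e c oU UW fe i.
have [f1 f2 f3 f4] := fe; have sfU := smooth_fun_sub UW sf.
have ssU := vb_coord oW ss oU UW fe i; have stU := vb_coord oW st oU UW fe i.
apply: smooth_fun_congr (smooth_fun_add oU (smooth_fun_mul oU sfU ssU) stU) => // x Ux.
by rewrite f1.
Qed.

Lemma vb_zero W : open W -> smooth_sec W ((fun x => 0) : section V).
Proof.
move=> oW; apply: vb_local => // U I e c oU UW fe i.
have [f1 f2 f3 f4] := fe; apply: smooth_fun_congr (smooth_fun_cst 0 oU) => // x Ux.
by rewrite (lin0 (f1 x i Ux)).
Qed.

Lemma vb_add W (s t : section V) : open W ->
  smooth_sec W s -> smooth_sec W t ->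
  smooth_sec W ((fun x => s x + t x) : section V).
Proof.
move=> oW ss st; apply: vb_congr (vb_comb oW (smooth_fun_cst 1 oW) ss st) => // x _.
by rewrite scale1r.
Qed.

Lemma vb_scale W (f : M -> R^o) (s : section V) : open W -> smooth_fun W f ->
  smooth_sec W s -> smooth_sec W ((fun x => f x *: s x) : section V).
Proof.
move=> oW sf ss; apply: vb_congr (vb_comb oW sf ss (vb_zero oW)) => // x _.
by rewrite addr0.
Qed.

Lemma vb_sum W (I : Type) (r : seq I) (s : I -> section V) : open W ->
  (forall i, smooth_sec W (s i)) ->
  smooth_sec W ((fun x => \sum_(i <- r) s i x) : section V).
Proof.
move=> oW ss; elim: r => [|a r IH].
  by apply: vb_congr (vb_zero oW) => // x _; rewrite big_nil.
by apply: vb_congr (vb_add oW (ss a) IH) => // x _; rewrite big_cons.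
Qed.

End Vbundle.

(** The frame consists of the elementary homomorphisms [c i] tensor [d j], and the coordinates of
    [T] are those of its values on the frame of [A]. Testing [T] on the frame sections gives smooth
    coordinates; expanding an arbitrary section in that frame gives the converse. *)
Lemma vbundle_hom A B : vbundle A -> vbundle B -> vbundle (hom_bundle A B).
Proof.
move=> vA vB; have [rA gA fA] := vA; have [rB gB fB] := vB; split.
- move=> W U T oW oU UW sT W' s oW' W'U ss; apply: sT => //.
  exact: subset_trans UW.
- move=> W T oW H W' s oW' W'W ss; apply: gB => // p W'p.
  have [U [oU Up sT]] := H p (W'W p W'p); exists U; split => //.
  have oWU := openI oW' oU.
  apply: sT => //; first exact: setSI.
  by apply: rA ss => //; exact: subIsetl.
move=> p; have [U [oU Up frU]] := fA p; have [U' [oU' Up' frU']] := fB p.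
exists (U `&` U'); split => //; first exact: openI.
have [I [e [c fe]]] := framed_sub (@subIsetl _ U U') frU.
have [J [d [b fd]]] := framed_sub (@subIsetr _ U U') frU'.
have [f1 f2 f3 f4] := fe; have [g1 g2 g3 g4] := fd.
have lE (i : I) (j : J) x : (U `&` U') x -> linear (fun v => c i x v *: d j x).
  by move=> Ux k u v; rewrite f1 // scalerDl scalerA.
exists (I * J)%type, (fun ij x => linfun (fun v => c ij.1 x v *: d ij.2 x)),
  (fun ij x T => b ij.2 x ((T : 'Hom(fib A x, fib B x)) (e ij.1 x))); split.
- by move=> x [i j] Ux k S T /=; rewrite add_lfunE scale_lfunE g1.
- move=> x T Ux; apply/lfunP => v; rewrite sum_lfunE /=.
  rewrite [in LHS](f2 x v Ux) linear_sum /=.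
  rewrite -(pair_bigA _ (fun i j =>
     (b j x ((T : 'Hom(fib A x, fib B x)) (e i x)) *:
        (linfun (fun v => c i x v *: d j x) : 'Hom(fib A x, fib B x))) v)) /=.
  apply: eq_bigr => i _; rewrite linearZ /=
    [in LHS](g2 x ((T : 'Hom(fib A x, fib B x)) (e i x)) Ux) scaler_sumr.
  apply: eq_bigr => j _; rewrite scale_lfunE linfunE; last exact: lE.
  by rewrite !scalerA mulrC.
- move=> x [i j] [i' j'] Ux /=; rewrite linfunE; last exact: lE.
  rewrite f3 // eq_sym; case: (eqVneq i i') => [->|ii'] /=.
    rewrite scale1r g3 // xpair_eqE eqxx //.
  rewrite scale0r xpair_eqE (negbTE ii') /=.
  by rewrite (lin0 (g1 x j Ux)).
- move=> W T oW WU; split => [sT [i j] /=|sT W' s oW' W'W ss].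
    have se : smooth_sec W (e i) by exact: frame_smooth fe oW WU.
    by have /g4 := sT W (e i) oW (@subset_refl _ W) se; apply.
  have W'U := subset_trans W'W WU; apply/g4 => // j.
  have sc i : smooth_fun W' (fun x => c i x (s x)) by have /f4 := ss; apply.
  apply: (@smooth_fun_congr _ _ _ (fun x => \sum_i (c i x (s x) : R) *
     (b j x ((T x : 'Hom(fib A x, fib B x)) (e i x)) : R) : R^o)) => //.
    move=> x Wx; rewrite [in RHS](f2 x (s x) (W'U _ Wx)) linear_sum.
    rewrite (lin_sum (g1 x j (W'U _ Wx))); apply: eq_bigr => i _.
    by rewrite linearZ (linZ (g1 x j (W'U _ Wx))).
  apply: (smooth_fun_sum _ oW') => i _; apply: (smooth_fun_mul oW' (sc i)).
  by apply: smooth_fun_sub W'W _; exact: (sT (i, j)).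
Qed.

End Frames.

(** * Smooth matrix-valued functions and their inverses *)

Section SmoothMatrices.
Variables (R : realType) (M : manifold3 R).
Implicit Types (W U : set M).

Definition smooth_mx m n W (A : M -> 'M[R]_(m, n)) :=
  forall i j, smooth_fun W (fun x => A x i j : R^o).

Lemma smooth_mx_sub m n W U (A : M -> 'M[R]_(m, n)) : U `<=` W ->
  smooth_mx W A -> smooth_mx U A.
Proof. by move=> UW sA i j; apply: smooth_fun_sub (sA i j). Qed.

Lemma smooth_mx_cst m n W (A : 'M[R]_(m, n)) : open W -> smooth_mx W (fun=> A).
Proof. by move=> oW i j; exact: smooth_fun_cst. Qed.

Lemma smooth_mx_mul m n p W (A : M -> 'M[R]_(m, n)) (B : M -> 'M[R]_(n, p)) :
  open W -> smooth_mx W A -> smooth_mx W B -> smooth_mx W (fun x => A x *m B x).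
Proof.
move=> oW sA sB i j.
apply: (@smooth_fun_congr _ _ _ (fun x => \sum_k (A x i k : R) * (B x k j : R) : R^o)) => //.
  by move=> x _; rewrite mxE.
by apply: (smooth_fun_sum _ oW) => k _; exact: smooth_fun_mul oW (sA i k) (sB k j).
Qed.

Lemma smooth_det n W (A : M -> 'M[R]_n) : open W -> smooth_mx W A ->
  smooth_fun W (fun x => \det (A x) : R^o).
Proof.
move=> oW sA; rewrite /determinant; apply: (smooth_fun_sum _ oW) => s _.
apply: (smooth_fun_mul oW (smooth_fun_cst _ oW)).
by apply: (smooth_fun_prod _ oW) => i _; exact: sA.
Qed.

(** By the cofactor formula the entries of the inverse are polynomials in the entries of [A] divided
    by the determinant. *)
Lemma smooth_mx_inv n W (A : M -> 'M[R]_n) : open W -> smooth_mx W A ->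
  (forall x, W x -> \det (A x) != 0) -> smooth_mx W (fun x => invmx (A x)).
Proof.
move=> oW sA dA i j; have sd := smooth_det oW sA.
have sadj : smooth_fun W (fun x => cofactor (A x) j i : R^o).
  apply: (smooth_fun_mul oW (smooth_fun_cst _ oW)); apply: (smooth_det oW) => k l.
  by apply: (smooth_fun_congr oW _ (sA (lift j k) (lift i l))) => x _; rewrite !mxE.
apply: (smooth_fun_congr oW _ (smooth_fun_mul oW (smooth_fun_inv oW dA sd) sadj)).
by move=> x Wx; rewrite /invmx unitmxE unitfE dA // !mxE.
Qed.

Lemma det_neq0_nbhs n W p (A : M -> 'M[R]_n) : open W -> W p -> smooth_mx W A ->
  \det (A p) != 0 ->
  exists U, [/\ open U, U p, U `<=` W & forall x, U x -> \det (A x) != 0].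
Proof. by move=> oW Wp sA dA; exact: smooth_fun_neq0 oW Wp (smooth_det oW sA) dA. Qed.

Lemma mulmx_invmx n (A : 'M[R]_n) : \det A != 0 -> A *m invmx A = 1%:M.
Proof. by move=> dA; rewrite mulmxV // unitmxE unitfE. Qed.

End SmoothMatrices.

Lemma basis_expansion (K : fieldType) (vT : vectType K) (Z : {vspace vT}) n (z : 'I_n -> vT) :
  basis_of Z [seq z j | j <- enum 'I_n] ->
  [/\ forall j, z j \in Z,
      forall w, w \in Z -> exists a : 'rV[K]_n, w = \sum_j a 0 j *: z j &
      forall a : 'rV[K]_n, \sum_j a 0 j *: z j = 0 -> a = 0].
Proof.
move=> /andP[/eqP spZ frZ].
have sz : size [seq z j | j <- enum 'I_n] == n by rewrite size_map size_enum_ord.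
pose X := Tuple sz.
have nX (j : 'I_n) : X`_j = z j.
  by rewrite /= (nth_map j) ?size_enum_ord // nth_ord_enum.
split.
- by move=> j; rewrite -spZ memv_span //; apply/mapP; exists j; rewrite ?mem_enum.
- move=> w; rewrite -spZ => wZ; exists (\row_j coord X j w).
  rewrite {1}(coord_span (X := X) wZ); apply: eq_bigr => j _.
  by rewrite mxE nX.
- move=> a; under eq_bigr => j _ do rewrite -nX.
  have /(@freeP _ _ _ X) fX := frZ.
  by move=> /fX H; apply/rowP => j; rewrite mxE H.
Qed.

(** * Local frames of subbundles and a smooth inverse of the obstruction map *)

Section Subbundles.
Variables (R : realType) (M : manifold3 R).
Implicit Types (W U : set M) (V : bundle M) (x : M).

Definition coord_row V (I : finType) (c : I -> forall x, fib V x -> R^o) x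
    (v : fib V x) : 'rV[R]_#|I| := \row_i c (enum_val i) x v.
Arguments coord_row {V I} c x v.

Lemma coord_row_sum V U (I : finType) (e : I -> section V) c x (v : fib V x) :
  frame U e c -> U x -> v = \sum_i coord_row c x v 0 i *: e (enum_val i) x.
Proof.
move=> [f1 f2 f3 f4] Ux; rewrite {1}(f2 x v Ux) (big_enum_val (fun i => c i x v *: e i x)) /=.
by apply: eq_bigr => i _; rewrite mxE.
Qed.

Lemma coord_row_linear V U (I : finType) (e : I -> section V) c x :
  frame U e c -> U x -> linear (coord_row c x).
Proof.
by move=> [f1 f2 f3 f4] Ux a u v; apply/rowP => i; rewrite !mxE f1.
Qed.

Lemma coord_row_inj V U (I : finType) (e : I -> section V) c x (v w : fib V x) :
  frame U e c -> U x -> coord_row c x v = coord_row c x w -> v = w.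
Proof.
move=> fe Ux H; apply: (coframe_inj fe Ux) => i.
by have /rowP/(_ (enum_rank i)) := H; rewrite !mxE enum_rankK.
Qed.

Lemma coord_row_smooth V U (I : finType) (e : I -> section V) c W (s : section V) :
  frame U e c -> open W -> W `<=` U -> smooth_sec W s ->
  smooth_mx W (fun x => coord_row c x (s x)).
Proof.
move=> [f1 f2 f3 f4] oW WU ss i j.
have sc : smooth_fun W (fun x => c (enum_val j) x (s x)) by have /f4 := ss; apply.
by apply: (smooth_fun_congr oW _ sc) => x _; rewrite mxE.
Qed.

Lemma coord_row_comb V U (I : finType) (e : I -> section V) c x n (z : 'I_n -> fib V x)
    (a : 'rV[R]_n) : frame U e c -> U x ->
  coord_row c x (\sum_j a 0 j *: z j) =
    a *m \matrix_(j, i) (coord_row c x (z j)) 0 i.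
Proof.
move=> fe Ux; have lc := coord_row_linear fe Ux.
rewrite (lin_sum lc); apply/rowP => i; rewrite summxE mxE.
by apply: eq_bigr => j _; rewrite (linZ lc) !mxE.
Qed.

Lemma coord_row_free V U (I : finType) (e : I -> section V) c x n (z : 'I_n -> fib V x)
    (Z : {vspace fib V x}) : frame U e c -> U x ->
  basis_of Z [seq z j | j <- enum 'I_n] ->
  row_free (\matrix_(j, i) (coord_row c x (z j)) 0 i).
Proof.
move=> fe Ux /basis_expansion[_ _ z0]; rewrite -kermx_eq0; apply/rowV0P => a.
move/sub_kermxP; rewrite -(coord_row_comb z a fe Ux) => H; apply: z0.
by apply: (coord_row_inj fe Ux); rewrite H (lin0 (coord_row_linear fe Ux)).
Qed.

(** A subbundle comes with a smooth pointwise basis, and the point is that coordinates in this basis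
    are smooth. The matrix [Z] of the basis in a frame of [V] has a right inverse [B] at [p], and
    [Z x *m B] stays invertible nearby. *)
Lemma vbundle_sub V (K : forall x, {vspace fib V x}) :
  vbundle V -> is_subbundle K -> vbundle (sub_bundle K).
Proof.
move=> vV hK; have [rV gV fV] := vV; split.
- by move=> W U s oW oU UW; apply: (rV W U (fun x => val (s x))).
- by move=> W s oW H; apply: (gV W (fun x => val (s x))).
move=> p; have [U [oU Up frU]] := fV p; have [U' [n [z [oU' U'p sz bz]]]] := hK p.
have [I [e [c fe]]] := framed_sub (@subIsetl _ U U') frU.
set O := U `&` U' in fe; have oO : open O by exact: openI.
have Op : O p by [].
pose Z x := \matrix_(j, i) (coord_row c x (z j x)) 0 i.
have sz' j : smooth_sec O (z j) by apply: rV (sz j) => //; exact: subIsetr.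
have sZ : smooth_mx O Z.
  move=> j i; have := coord_row_smooth fe oO (@subset_refl _ O) (sz' j).
  by move=> /(_ 0 i) H; apply: (smooth_fun_congr oO _ H) => x _; rewrite /Z mxE.
have /row_freeP[B ZB] := coord_row_free fe Op (bz p U'p).
have sA : smooth_mx O (fun x => Z x *m B).
  by apply: smooth_mx_mul => //; exact: smooth_mx_cst.
have [] := det_neq0_nbhs oO Op sA; first by rewrite ZB det1 oner_neq0.
move=> N [oN Np NO dA]; exists N; split => //.
have NU' x : N x -> U' x by move=> /NO[].
have sI := smooth_mx_inv oN (smooth_mx_sub NO sA) dA.
(* A vector with coefficients [a] in the basis [z] has coordinate row [a *m Z x] in [V]; multiplying
   by [B] and by the inverse of [Z x *m B] recovers [a]. *)
pose d j x (w : fib (sub_bundle K) x) : R^o :=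
  (coord_row c x (vsval w) *m B *m invmx (Z x *m B)) 0 j.
have dE x (a : 'rV[R]_n) (w : fib (sub_bundle K) x) j : N x ->
    vsval w = \sum_j a 0 j *: z j x -> d j x w = a 0 j.
  move=> Nx wE; rewrite /d wE (coord_row_comb _ _ fe (NO _ Nx)) -/(Z x).
  by rewrite -(mulmxA a) -mulmxA mulmx_invmx ?mulmx1 //; exact: dA.
have vz j x : N x -> vsval (vsproj (K x) (z j x)) = z j x.
  by move=> Nx; have [zK _ _] := basis_expansion (bz x (NU' x Nx)); rewrite vsprojK.
have dsum x (w : fib (sub_bundle K) x) : N x ->
    vsval w = \sum_j d j x w *: z j x.
  move=> Nx; have [_ /(_ _ (subvsP w))[a wa] _] := basis_expansion (bz x (NU' x Nx)).
  by rewrite [LHS]wa; apply: eq_bigr => j _; rewrite (dE x a).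
exists 'I_n, (fun j x => vsproj (K x) (z j x)), d; split.
- move=> x j Nx a u v; rewrite /d linearP (coord_row_linear fe (NO _ Nx)).
  by rewrite !mulmxDl -!scalemxAl !mxE.
- move=> x w Nx; apply: val_inj; rewrite /= linear_sum /= [LHS]dsum //.
  by apply: eq_bigr => j _; rewrite vz.
- move=> x j l Nx; rewrite (dE x (delta_mx 0 l)) //; first by rewrite mxE eqxx.
  rewrite vz // (bigD1 l) //= mxE !eqxx scale1r big1 ?addr0 // => k kl.
  by rewrite mxE (negbTE kl) andbF scale0r.
- move=> W s oW WN; have WO := subset_trans WN NO; split => [ss j|sd].
    have sc := coord_row_smooth fe oW WO ss.
    have s1 : smooth_mx W (fun x => coord_row c x (vsval (s x)) *m B *m invmx (Z x *m B)).
      apply: (smooth_mx_mul oW); last exact: smooth_mx_sub WN sI.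
      by apply: (smooth_mx_mul oW) => //; exact: smooth_mx_cst.
    exact: s1.
  have s2 : smooth_sec W ((fun x => \sum_j d j x (s x) *: z j x) : section V).
    apply: (vb_sum vV _ oW) => j; apply: (vb_scale vV oW (sd j)).
    exact: rV oO oW WO (sz' j).
  by apply: (vb_congr vV oW _ s2) => x Wx; rewrite -dsum //; exact: WN.
Qed.

Lemma vbundle_vector (E : vector_bundle M) : vbundle E.
Proof.
split.
- move=> W U s oW oU UW ss i k; apply: smooth_fun_sub (ss i k).
  exact: setSI.
- move=> W s oW H i k; apply: smooth_fun_glue => x [Wx ix].
  have [U [oU Ux ss]] := H x Wx; exists U; split => //.
  by apply: smooth_fun_sub (ss i k) => y [[]].
move=> p; have [i ip] := tdom_cover E p.
exists (tdom i); split; [exact: tdom_open | exact: ip |].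
pose e (k : 'I_(trank i)) x := tnth (tframe i x) k.
pose c (k : 'I_(trank i)) x (v : fib E x) : R^o := coord (tframe i x) k v.
have ce x v : tdom i x -> v = \sum_k c k x v *: e k x.
  move=> ix; have := coord_basis (tframe_basis ix) (memvf v) => {1}->.
  by apply: eq_bigr => k _; rewrite /e (tnth_nth 0).
exists 'I_(trank i), e, c; split.
- by move=> x k _ a u v; rewrite /c linearP.
- exact: ce.
- move=> x k l ix; rewrite /c /e (tnth_nth 0).
  by rewrite (coord_free _ _ (basis_free (tframe_basis ix))) eq_sym.
- move=> W s oW Wi; split=> [ss k|sc j k].
    by apply: smooth_fun_sub (ss i k) => x Wx; split => //; exact: Wi.
  have oWj : open (W `&` tdom j) by apply: openI => //; exact: tdom_open.
  apply: (@smooth_fun_congr _ _ _ (fun x => \sum_l (c l x (s x) : R) *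
     (coord (tframe j x) k (tnth (tframe i x) l) : R) : R^o)) => //.
    move=> x [Wx jx]; rewrite [in RHS](ce x (s x) (Wi _ Wx)) linear_sum.
    by apply: eq_bigr => l _; rewrite linearZ.
  apply: (smooth_fun_sum _ oWj) => l _; apply: (smooth_fun_mul oWj).
    by apply: smooth_fun_sub (sc l); exact: subIsetl.
  apply: smooth_fun_sub (tframe_smooth k l) => x [Wx jx]; split => //.
  exact: Wi.
Qed.

(** Near [p] the coordinate fields of the preferred chart at [p] form the frame; passing to another
    chart multiplies components by the Jacobian of the transition map, whose entries are smooth. *)
Lemma vbundle_tangent : vbundle (tangent_bundle M).
Proof.
split.
- move=> W U s oW oU UW ss i k; apply: smooth_fun_sub (ss i k).
  exact: setSI.
- move=> W s oW H i k; apply: smooth_fun_glue => x [Wx ix].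
  have [U [oU Ux ss]] := H x Wx; exists U; split => //.
  by apply: smooth_fun_sub (ss i k) => y [[]].
move=> p; pose i := chart_at p; exists (cdom i).
split; [exact: cdom_open | exact: chart_at_dom |].
pose e (k : 'I_3) x : 'rV[R]_3 := tangent_of_chart i x (delta_mx 0 k).
pose c (k : 'I_3) x (v : 'rV[R]_3) : R^o := tangent_to_chart i x v 0 k.
have ce x v : cdom i x -> v = \sum_k c k x v *: e k x.
  move=> ix; have lt := tangent_of_chart_linear ix.
  rewrite -[LHS](tangent_to_chartK v ix) {1}(row_sum_delta (tangent_to_chart i x v)).
  by rewrite (lin_sum lt); apply: eq_bigr => k _; rewrite (linZ lt).
exists 'I_3, e, c; split.
- by move=> x k ix a u v; rewrite /c (tangent_to_chart_linear ix) !mxE.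
- exact: ce.
- by move=> x k l ix; rewrite /c /e tangent_of_chartK // mxE eqxx.
- move=> W s oW Wi; split=> [ss k|sc j l].
    by apply: smooth_fun_sub (ss i k) => x Wx; split => //; exact: Wi.
  have oWj := open_cdomI j oW.
  apply: (@smooth_fun_congr _ _ _ (fun x => \sum_k (c k x (s x) : R) *
     (pd i k (fun x => cmap j x 0 l : R^o) x : R) : R^o)) => //.
    move=> x [Wx jx]; have ix := Wi _ Wx; have lt := tangent_to_chart_linear jx.
    rewrite [in RHS](ce x (s x) ix) (lin_sum lt) summxE.
    apply: eq_bigr => k _; rewrite (linZ lt) mxE -tangent_of_chart_coord //.
  apply: (smooth_fun_sum _ oWj) => k _; apply: (smooth_fun_mul oWj).
    by apply: smooth_fun_sub (sc k); exact: subIsetl.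
  apply: (smooth_fun_pd _ oWj); first by move=> x [Wx _]; exact: Wi.
  apply: smooth_fun_sub (@smooth_fun_coord _ _ j l); exact: subIsetr.
Qed.

(* Near p the inverse is B (C Rm B)^-1 C, where the rows of C span a complement
   of Z at p and C Rm B = 1 at p; it stays one because Z has locally constant
   rank. *)
Lemma generalized_inverse V (J : finType) (r : J -> forall x, fib V x -> R^o)
    (Z : forall x, {vspace fib V x}) (U : set M) (p : M) :
  vbundle V -> is_subbundle Z -> open U -> U p -> framed V U ->
  (forall j x, U x -> linear (r j x)) ->
  (forall j W (s : section V), open W -> W `<=` U -> smooth_sec W s ->
     smooth_fun W (fun x => r j x (s x))) ->
  (forall x v, U x -> v \in Z x <-> forall j, r j x v = 0) ->
  exists O (g : J -> section V), [/\ open O, O p, O `<=` U,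
    forall j, smooth_sec O (g j) &
    forall x v, O x -> v - \sum_j r j x v *: g j x \in Z x].
Proof.
move=> vV hZ oU Up frU lr sr rZ; have [rV gV fV] := vV.
have [U' [n [z [oU' U'p sz bz]]]] := hZ p.
have [I [e [c fe]]] := framed_sub (@subIsetl _ U U') frU.
set O := U `&` U' in fe; have oO : open O by exact: openI.
have OU : O `<=` U by exact: subIsetl.
have Op : O p by [].
pose Zm x := \matrix_(j, i) (coord_row c x (z j x)) 0 i.
pose Rm x : 'M[R]_(#|I|, #|J|) := \matrix_(i, j) r (enum_val j) x (e (enum_val i) x).
have sz' j : smooth_sec O (z j) by apply: rV (sz j) => //; exact: subIsetr.
have sZ : smooth_mx O Zm.
  move=> j i; have := coord_row_smooth fe oO (@subset_refl _ O) (sz' j).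
  by move=> /(_ 0 i) H; apply: (smooth_fun_congr oO _ H) => x _; rewrite /Zm mxE.
have se i : smooth_sec O (e i) by exact: frame_smooth fe oO (@subset_refl _ O).
have sR : smooth_mx O Rm.
  move=> i j; have H := sr (enum_val j) O _ oO OU (se (enum_val i)).
  by apply: (smooth_fun_congr oO _ H) => x _; rewrite /Rm mxE.
have rE x v j : O x -> r j x v = (coord_row c x v *m Rm x) 0 (enum_rank j).
  move=> Ox; have lrj := lr j x (OU _ Ox); rewrite {1}(coord_row_sum v fe Ox) (lin_sum lrj) mxE.
  by apply: eq_bigr => i _; rewrite (linZ lrj); congr (_ * _); rewrite /Rm mxE enum_rankK.
have r0 x v : O x -> (forall j, r j x v = 0) <-> coord_row c x v *m Rm x = 0.
  move=> Ox; split=> [H|H j]; last by rewrite rE // H mxE.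
  by apply/rowP => j; rewrite -[j]enum_valK -rE // H [RHS]mxE.
have ZR x : O x -> Zm x *m Rm x = 0.
  move=> Ox; apply/row_matrixP => j; rewrite row_mul row0.
  have -> : row j (Zm x) = coord_row c x (z j x) by apply/rowP => i; rewrite !mxE.
  apply/(r0 x _ Ox)/(rZ x _ (OU _ Ox)).
  by have [zZ _ _] := basis_expansion (bz x Ox.2).
have fZ := coord_row_free fe Op (bz p U'p); rewrite -/(Zm p) in fZ.
have kerZ (a : 'rV_#|I|) : a *m Rm p = 0 -> (a <= Zm p)%MS.
  move=> aR; pose v := \sum_i a 0 i *: e (enum_val i) p.
  have vE : coord_row c p v = a.
    apply/rowP => i; rewrite mxE /v.
    have -> : \sum_i0 a 0 i0 *: e (enum_val i0) p = \sum_k a 0 (enum_rank k) *: e k p.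
      rewrite (big_enum_val (fun k => a 0 (enum_rank k) *: e k p)) /=.
      by apply: eq_bigr => k _; rewrite enum_valK.
    by rewrite (coframe_sum fe) // enum_valK.
  have vZ : v \in Z p by apply/(rZ p v Up)/(r0 p v Op); rewrite vE.
  have [_ /(_ v vZ)[b vb] _] := basis_expansion (bz p U'p).
  by apply/submxP; exists b; rewrite -vE vb (coord_row_comb _ _ fe Op).
pose C := row_base (Zm p)^C%MS.
(* The kernel of [Rm p] is the row space of [Zm p], which meets the complement spanned by the rows
   of [C] only in zero. *)
have fC : row_free (C *m Rm p).
  rewrite -kermx_eq0; apply/rowV0P => a /sub_kermxP; rewrite mulmxA => aC.
  have h1 := kerZ _ aC.
  have h2 : (a *m C <= (Zm p)^C)%MS.
    by apply: submx_trans (submxMl _ _) _; rewrite /C eq_row_base.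
  have : (a *m C <= Zm p :&: (Zm p)^C)%MS by rewrite sub_capmx h1.
  rewrite capmx_compl submx0 => /eqP aC0.
  have := row_base_free (Zm p)^C%MS; rewrite -kermx_eq0 => /eqP kC.
  by apply/eqP; rewrite -submx0 -kC; apply/sub_kermxP.
have /row_freeP[B CRB] := fC.
have fullZC : row_full (col_mx (Zm p) C).
  rewrite -sub1mx; apply: submx_trans (_ : (1%:M <= Zm p + (Zm p)^C)%MS) _.
    by rewrite sub1mx addsmx_compl_full.
  rewrite -(addsmxE (Zm p) C); apply: addsmxS; first exact: submx_refl.
  by rewrite /C eq_row_base.
(* [D] witnesses that the rows of [Zm p] and [C] span the whole space. Invertibility of
   [D *m col_mx (Zm x) C], an open condition, carries this over to nearby [x]. *)
have /row_fullP[D DZC] := fullZC.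
have sC W : open W -> smooth_mx W (fun=> C) by move=> oW; exact: smooth_mx_cst.
have sA : smooth_mx O (fun x => C *m Rm x *m B).
  by apply: (smooth_mx_mul oO (smooth_mx_mul oO (sC _ oO) sR)); exact: smooth_mx_cst.
have sT : smooth_mx O (fun x => D *m col_mx (Zm x) C).
  apply: (smooth_mx_mul oO); first exact: smooth_mx_cst.
  move=> i j; case: (splitP i) => k ik.
    apply: (smooth_fun_congr oO _ (sZ k j)) => x _.
    have -> : i = lshift _ k by apply/val_inj.
    by rewrite col_mxEu.
  apply: (smooth_fun_congr oO _ (smooth_fun_cst (C k j) oO)) => x _.
  have -> : i = rshift _ k by apply/val_inj.
  by rewrite col_mxEd.
have [] := det_neq0_nbhs oO Op sA; first by rewrite CRB det1 oner_neq0.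
move=> N1 [oN1 N1p N1O dA].
have [] := det_neq0_nbhs oO Op sT; first by rewrite DZC det1 oner_neq0.
move=> N2 [oN2 N2p N2O dT].
pose N := N1 `&` N2; have oN : open N by exact: openI.
have NO : N `<=` O by move=> x [/N1O].
have NN1 : N `<=` N1 by exact: subIsetl.
have sI := smooth_mx_inv oN1 (smooth_mx_sub N1O sA) dA.
pose G x := B *m invmx (C *m Rm x *m B) *m C.
have sG : smooth_mx N G.
  apply: (smooth_mx_mul oN) (sC _ oN); apply: (smooth_mx_mul oN); first exact: smooth_mx_cst.
  exact: smooth_mx_sub NN1 sI.
exists N, (fun j x => \sum_i G x (enum_rank j) i *: e (enum_val i) x).
split => //; first exact: subset_trans NO OU.
  move=> j; apply: (vb_sum vV _ oN) => i; apply: (vb_scale vV oN (sG _ _)).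
  exact: rV oO oN NO (se _).
move=> x v Nx; have Ox := NO _ Nx; have Ux := OU _ Ox; have lc := coord_row_linear fe Ox.
apply/(rZ x _ Ux)/(r0 x _ Ox).
have -> : coord_row c x (v - \sum_j r j x v *: \sum_i G x (enum_rank j) i *: e (enum_val i) x)
    = coord_row c x v - coord_row c x v *m Rm x *m G x.
  rewrite (linB lc); congr (_ - _).
  have -> : \sum_j r j x v *: \sum_i G x (enum_rank j) i *: e (enum_val i) x =
      \sum_i (coord_row c x v *m Rm x *m G x) 0 i *: e (enum_val i) x.
    under eq_bigr => j _ do rewrite scaler_sumr.
    rewrite exchange_big /=; apply: eq_bigr => i _.
    under eq_bigr => j _ do rewrite scalerA.
    rewrite -scaler_suml [X in _ = X *: _]mxE; congr (_ *: _).
    rewrite (big_enum_val (fun j => r j x v * G x (enum_rank j) i)) /=.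
    by apply: eq_bigr => j _; rewrite rE // enum_valK.
  set a := _ *m _ *m _; apply/rowP => i; rewrite mxE.
  have -> : \sum_i0 a 0 i0 *: e (enum_val i0) x = \sum_k a 0 (enum_rank k) *: e k x.
    rewrite (big_enum_val (fun k => a 0 (enum_rank k) *: e k x)) /=.
    by apply: eq_bigr => k _; rewrite enum_valK.
  by rewrite (coframe_sum fe) // enum_valK.
set a := coord_row c x v.
(* Split the coordinate row into a part in [Zm x], which [Rm x] kills, and a part in [C], on which
   [G x] inverts [Rm x] up to the kernel of [Rm x]. *)
have [b ->] : exists b, a = b *m col_mx (Zm x) C.
  exists (a *m invmx (D *m col_mx (Zm x) C) *m D).
  by rewrite -!mulmxA mulVmx ?mulmx1 // unitmxE unitfE; exact: dT Nx.2.
rewrite -[b]hsubmxK mul_row_col; set b1 := lsubmx b; set b2 := rsubmx b.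
have aR : (b1 *m Zm x + b2 *m C) *m Rm x = b2 *m C *m Rm x.
  by rewrite mulmxDl -(mulmxA b1) ZR // mulmx0 add0r.
have AI := mulmx_invmx (dA _ Nx.1).
have bA : b2 *m C *m Rm x *m G x *m Rm x = b2 *m C *m Rm x.
  transitivity (b2 *m (C *m Rm x *m B *m invmx (C *m Rm x *m B)) *m C *m Rm x).
    by rewrite /G !mulmxA.
  by rewrite AI mulmx1.
by rewrite mulmxBl aR bA subrr.
Qed.

End Subbundles.

(** * Bracket equations of the second prolongation *)

Section LeviIdentities.
Variable R : realFieldType.

Lemma levi_cancel (p qa qb qc lab lac lbc lba lca lcb : R) :
  lba = - lab -> lca = - lac -> lcb = - lbc ->
  p + qa * lbc + qb * lac + qc * lab - (p + qa * lcb + qc * lab + qb * lac)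
  - (p + qb * lca + qc * lba + qa * lbc) + (p + qc * lba + qb * lca + qa * lcb) = 0.
Proof. by move=> -> -> ->; ring. Qed.

Lemma levi_sym23 (sabc sacb qa qb qc lab lac lbc : R) :
  sabc - sacb = 2 * (qa * lbc) ->
  sabc - qa * lbc - qb * lac - qc * lab = sacb - qa * - lbc - qc * lab - qb * lac.
Proof. by move=> /eqP; rewrite subr_eq => /eqP ->; ring. Qed.

Lemma levi_sym12 (scab scba sabc sbac qa qb qc lab lac lbc : R) :
  scab - scba = 2 * (qc * lab) -> scab - scba - sabc + sbac = 0 ->
  sabc - qa * lbc - qb * lac - qc * lab = sbac - qb * lac - qa * lbc - qc * - lab.
Proof.
move=> -> /eqP; rewrite addr_eq0 => /eqP/(congr1 -%R); rewrite opprK opprB => <-.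
by ring.
Qed.

Lemma levi_split (s u v w : R) : s = s - u - v - w + u + v + w.
Proof. by ring. Qed.

End LeviIdentities.

Section Tensors.
Variables (R : realType) (M : manifold3 R) (C : contact M) (x : M).
Local Notation H := (Hfib C x).

Definition multilinear3 (W : lmodType R) (s : H -> H -> H -> W) :=
  [/\ forall b c, linear (fun a => s a b c), forall a c, linear (fun b => s a b c)
    & forall a b, linear (fun c => s a b c)].

(* Pairing a 3-tensor with the Lie polynomial [a, [b, c]]. *)
Definition bracket3 (W : zmodType) (s : H -> H -> H -> W) a b c : W :=
  s a b c - s a c b - s b c a + s c b a.

Definition spans2 (h1 h2 : H) := forall v, exists a b : R, v = a *: h1 + b *: h2.

Lemma levi_antisym L a b : @is_levi_form R M (distr C) x L -> L b a = - L a b.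
Proof. by move=> [W [alpha [_ _ _ ->]]]; rewrite /ext_deriv /= opprB. Qed.

(** The symmetric part cancels in pairs. Of the Levi terms, the first two summands of the bracket
    leave [2 * Q a * L b c] and the last two leave its opposite. *)
Lemma S3perp_bracket3 s a b c : @S3perp R M C x s -> bracket3 s a b c = 0.
Proof.
move=> [L [P [Q [lL symP sE]]]]; rewrite /bracket3 !sE.
have E1 : P a c b = P a b c by rewrite (symP a b c).2.
have E2 : P b c a = P a b c by rewrite (symP b c a).2 (symP a b c).1.
have E3 : P c b a = P a b c by rewrite (symP c b a).2 (symP c a b).1 E1.
rewrite E1 E2 E3; apply: levi_cancel; exact: levi_antisym.
Qed.

Lemma lin_span2 (W : lmodType R) (f : H -> W) h1 h2 : spans2 h1 h2 -> linear f ->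
  f h1 = 0 -> f h2 = 0 -> forall v, f v = 0.
Proof.
move=> sp lf f1 f2 v; have [a [b ->]] := sp v.
by rewrite (linD lf) !(linZ lf) f1 f2 !scaler0 addr0.
Qed.

(** This is where the rank of H enters the algebra: alternating forms on a plane make up a line, so
    one value decides. *)
Lemma alternating_span2 (W : lmodType R) (f : H -> H -> W) h1 h2 : spans2 h1 h2 ->
  (forall c, linear (f^~ c)) -> (forall b, linear (f b)) ->
  (forall b c, f c b = - f b c) -> f h1 h2 = 0 -> forall b c, f b c = 0.
Proof.
move=> sp l1 l2 alt f0.
have diag b : f b b = 0.
  have : (2%:R : R) *: f b b = 0 by rewrite scaler_nat mulr2n {1}alt addNr.
  by move=> /eqP; rewrite scaler_eq0 pnatr_eq0 => /eqP.
move=> b c; apply: (lin_span2 sp (l1 c)).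
  by apply: (lin_span2 sp (l2 h1)).
by apply: (lin_span2 sp (l2 h2)) => //; rewrite alt f0 oppr0.
Qed.

Lemma linear_sub (U W : lmodType R) (f g : U -> W) : linear f -> linear g ->
  linear (fun v => f v - g v).
Proof. by move=> lf lg a u v; rewrite lf lg scalerBr opprD addrACA. Qed.

Lemma linear_scale (U : lmodType R) (f : U -> R^o) (k : R) : linear f ->
  linear (fun v => k * f v : R^o).
Proof. by move=> lf a u v; rewrite lf mulrDr [k * _]mulrCA. Qed.

Lemma linear_rscale (U : lmodType R) (f : U -> R^o) (k : R) : linear f ->
  linear (fun v => f v * k : R^o).
Proof. by move=> lf a u v; rewrite lf mulrDl -mulrA. Qed.

(** On a plane the part of [s] that is skew in its last two arguments must be some [q] tensor [L].
    Removing the three Levi terms built from [q] leaves a tensor symmetric in the last pair by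
    construction, and in the first pair by the bracket equation. *)
Lemma S3perp_of_bracket3 (s : H -> H -> H -> R^o) (L : H -> H -> R^o) h1 h2 :
  spans2 h1 h2 -> @is_levi_form R M (distr C) x L ->
  (forall c, linear (L^~ c)) -> (forall b, linear (L b)) -> L h1 h2 != 0 ->
  multilinear3 s -> (forall a b c, bracket3 s a b c = 0) -> @S3perp R M C x s.
Proof.
move=> sp lL L1 L2 L12 [s1 s2 s3] s0.
(* The factor makes [s a b c - s a c b = 2 * (q a * L b c)] hold at [h1], [h2], and hence
   everywhere; the 2 appears because exchanging [b] and [c] changes the sign of [L b c]. *)
pose k := (2 * (L h1 h2 : R))^-1.
pose q a : R^o := k * (s a h1 h2 - s a h2 h1 : R).
have lq : linear q by apply: linear_scale; exact: linear_sub.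
have LA b c : L c b = - L b c by exact: levi_antisym.
have D a b c : s a b c - s a c b = 2 * (q a * L b c).
  apply/eqP; rewrite -subr_eq0; apply/eqP.
  apply: (@alternating_span2 R^o (fun b c => (s a b c - s a c b) - 2 * (q a * L b c) : R^o) h1 h2) => //.
  - move=> c'; apply: linear_sub; first exact: linear_sub.
    by apply: linear_scale; apply: linear_scale.
  - move=> b'; apply: linear_sub; first exact: linear_sub.
    by apply: linear_scale; apply: linear_scale.
  - by move=> b' c'; rewrite (LA b' c') !mulrN opprD opprK !opprB.
  - rewrite /q /k; have L12' : (L h1 h2 : R) != 0 := L12.
    move: (L h1 h2 : R) (s a h1 h2 : R) (s a h2 h1 : R) L12' => l u v l0.
    by field.
pose p a b c : R^o := s a b c - q a * L b c - q b * L a c - q c * L a b.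
have p3 a b : linear (p a b).
  apply: linear_sub; last by apply: linear_rscale.
  apply: linear_sub; last by apply: linear_scale.
  by apply: linear_sub => //; apply: linear_scale.
have p2 a c : linear (fun b => p a b c).
  apply: linear_sub; last by apply: linear_scale.
  apply: linear_sub; last by apply: linear_rscale.
  by apply: linear_sub => //; apply: linear_scale.
have p1 b c : linear (fun a => p a b c).
  apply: linear_sub; last by apply: linear_scale.
  apply: linear_sub; last by apply: linear_scale.
  by apply: linear_sub => //; apply: linear_rscale.
have lP1 a : linear (fun b => linfun (p a b) : 'Hom(H, R^o)).
  move=> t u v; apply/lfunP => c; rewrite add_lfunE scale_lfunE !linfunE //.
  exact: p2.
have lP0 : linear (fun a => linfun (fun b => linfun (p a b) : 'Hom(H, R^o)) : 'Hom(H, 'Hom(H, R^o))).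
  move=> t u v; apply/lfunP => b; rewrite add_lfunE scale_lfunE !linfunE //.
  apply/lfunP => c; rewrite add_lfunE scale_lfunE !linfunE //.
  exact: p1.
exists L,
  (linfun (fun a => linfun (fun b => linfun (p a b) : 'Hom(H, R^o)) : 'Hom(H, 'Hom(H, R^o)))),
  (linfun q).
have pE a b c :
  (linfun (fun a => linfun (fun b => linfun (p a b) : 'Hom(H, R^o)) : 'Hom(H, 'Hom(H, R^o)))) a b c = p a b c.
  by rewrite !linfunE.
have p23 a b c : p a b c = p a c b.
  have := D a b c; rewrite /p (LA b c); exact: levi_sym23.
(* The bracket equation with arguments [c a b] equates the skew part of [s] in its first two
   arguments, at [a b c], with [s c a b - s c b a], which [D] evaluates as [2 * (q c * L a b)]. *)
have p12 a b c : p a b c = p b a c.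
  have := s0 c a b; rewrite /bracket3; have := D c a b; rewrite /p (LA a b).
  exact: levi_sym12.
split=> //.
  by move=> a b c; rewrite !pE.
move=> a b c; rewrite pE !linfunE // /p.
exact: levi_split.
Qed.

Lemma bracket3_sum (W : lmodType R) n (s : 'I_n -> H -> H -> H -> R) (e : 'I_n -> W) a b c :
  bracket3 (fun a b c => \sum_i s i a b c *: e i) a b c =
  \sum_i bracket3 (s i) a b c *: e i.
Proof.
rewrite /bracket3 -!sumrB -big_split /=; apply: eq_bigr => i _.
by rewrite -!scalerBl -scalerDl.
Qed.

Section InBundle.
Variable V : bundle M.

Lemma S3perp_tensor_bracket3 (t : H -> H -> H -> fib V x) a b c :
  S3perp_tensor t -> bracket3 t a b c = 0.
Proof.
move=> [n [s [e [sS tE]]]].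
have -> : t = (fun a b c => \sum_i s i a b c *: e i).
  by apply: funext => ?; apply: funext => ?; apply: funext => ?; rewrite tE.
rewrite bracket3_sum big1 // => i _.
by rewrite S3perp_bracket3 ?scale0r.
Qed.

Lemma S4perp_bracket3 s a b c d : @S4perp R M C x s ->
  bracket3 (fun a b c => s a b c d) a b c = 0.
Proof.
move=> [_ [n [t [w [tS sE]]]]].
have -> : (fun a b c => s a b c d) = (fun a b c => \sum_i t i a b c *: (w i d : R^o)).
  by apply: funext => ?; apply: funext => ?; apply: funext => ?; rewrite sE.
rewrite (bracket3_sum (W := R^o)) big1 // => i _.
by rewrite S3perp_bracket3 ?scale0r.
Qed.

Lemma S4perp_tensor_bracket3 (t : H -> H -> H -> H -> fib V x) a b c d :
  S4perp_tensor t -> bracket3 (fun a b c => t a b c d) a b c = 0.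
Proof.
move=> [n [s [e [sS tE]]]].
have -> : (fun a b c => t a b c d) = (fun a b c => \sum_i s i a b c d *: e i).
  by apply: funext => ?; apply: funext => ?; apply: funext => ?; rewrite tE.
rewrite (bracket3_sum (fun i a b c => s i a b c d)) big1 // => i _.
by rewrite S4perp_bracket3 ?scale0r.
Qed.

End InBundle.

Lemma multilinear3_comp (W W' : lmodType R) (f : W -> W') (s : H -> H -> H -> W) :
  linear f -> multilinear3 s -> multilinear3 (fun a b c => f (s a b c)).
Proof.
move=> lf [s1 s2 s3]; split.
- by move=> b c k u v /=; rewrite s1 lf.
- by move=> a c k u v /=; rewrite s2 lf.
- by move=> a b k u v /=; rewrite s3 lf.
Qed.

Lemma bracket3_comp (W W' : lmodType R) (f : W -> W') (s : H -> H -> H -> W) a b c :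
  linear f -> bracket3 (fun a b c => f (s a b c)) a b c = f (bracket3 s a b c).
Proof. by move=> lf; rewrite /bracket3 (linD lf) !(linB lf). Qed.

Lemma linear_add (U W : lmodType R) (f g : U -> W) : linear f -> linear g ->
  linear (fun v => f v + g v).
Proof. by move=> lf lg a u v; rewrite lf lg scalerDr addrACA. Qed.

(** The bracket is linear in its first argument and alternating in the other two, so on a plane only
    two values have to be checked. *)
Lemma bracket3_span2 (W : lmodType R) (s : H -> H -> H -> W) h1 h2 :
  spans2 h1 h2 -> multilinear3 s ->
  bracket3 s h1 h1 h2 = 0 -> bracket3 s h2 h1 h2 = 0 ->
  forall a b c, bracket3 s a b c = 0.
Proof.
move=> sp [s1 s2 s3] b1 b2 a b c.
have l1 b' c' : linear (fun a => bracket3 s a b' c').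
  apply: linear_add; last exact: s3.
  by apply: linear_sub; [apply: linear_sub|]; [exact: s1|exact: s1|exact: s3].
have l2 a' c' : linear (fun b => bracket3 s a' b c').
  apply: linear_add; last exact: s2.
  by apply: linear_sub; [apply: linear_sub|]; [exact: s2|exact: s3|exact: s1].
have l3 a' b' : linear (fun c => bracket3 s a' b' c).
  apply: linear_add; last exact: s1.
  by apply: linear_sub; [apply: linear_sub|]; [exact: s3|exact: s2|exact: s2].
apply: (@alternating_span2 _ (fun b c => bracket3 s a b c) h1 h2) => //.
  move=> b' c'; rewrite /bracket3 !opprD !opprK.
  by rewrite [- _ + s a c' b']addrC; exact: addrAC.
exact: (lin_span2 sp (l1 h1 h2)).
Qed.

Section Prolongation.
Variables (E : bundle M)
  (K : forall x : M, {vspace fib (LamH C E) x})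
  (K' : forall x : M, {vspace fib (LamH C (sub_bundle K)) x})
  (K'' : forall x : M, {vspace fib (LamH C (sub_bundle K')) x})
  (K''' : forall x : M, {vspace fib (LamH C (sub_bundle K'')) x}).
Hypotheses (hK'' : is_K2 K'') (hK''' : is_K3 K''').

Lemma ev_linear (V : bundle M) (T : fib (LamH C V) x) : linear (ev T).
Proof. by move=> k u v; rewrite /ev linearP. Qed.

Lemma ev_linear_l (V : bundle M) (a : H) :
  linear (fun T : fib (LamH C V) x => ev T a).
Proof. by move=> k S T; rewrite /ev add_lfunE scale_lfunE. Qed.

Lemma full_ev3_linear (a b c : H) :
  linear (fun T : fib (LamH C (sub_bundle K')) x => full_ev3 T a b c).
Proof. by move=> k S T; rewrite /full_ev3 !(ev_linear_l, linearP). Qed.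

Lemma full_ev3_multilinear (T : fib (LamH C (sub_bundle K')) x) :
  multilinear3 (full_ev3 T).
Proof.
split.
- by move=> b c k u v; rewrite /full_ev3 ev_linear linearP !(ev_linear_l, linearP).
- by move=> a c k u v; rewrite /full_ev3 ev_linear linearP ev_linear_l.
- by move=> a b k u v; rewrite /full_ev3 ev_linear.
Qed.

Lemma full_ev4_multilinear (T : fib (LamH C (sub_bundle K'')) x) d :
  multilinear3 (fun a b c => full_ev4 T a b c d).
Proof.
have H3 a := full_ev3_multilinear (vsval (ev T a)).
split.
- move=> b c k u v; rewrite /full_ev4 ev_linear linearP.
  exact: full_ev3_linear.
- by move=> a c k u v; have [s1 s2 s3] := H3 a; exact: s1.
- by move=> a b k u v; have [s1 s2 s3] := H3 a; exact: s2.
Qed.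

Lemma K2_bracket3 T a b c : T \in K'' x -> bracket3 (full_ev3 T) a b c = 0.
Proof. by move=> /hK'' /S3perp_tensor_bracket3. Qed.

Lemma K3_bracket3 T a b c d : T \in K''' x ->
  bracket3 (fun a b c => full_ev4 T a b c d) a b c = 0.
Proof. by move=> /hK''' /S4perp_tensor_bracket3. Qed.

(** Expanding in a basis of the fibre of [E] reduces the claim to scalar 4-tensors, where the two
    halves of [S4perp] come from different sources: the last three indices are controlled by the
    values of [T] lying in [K''], the first three by the assumed bracket equations. *)
Lemma in_K3 T (L : H -> H -> R^o) h1 h2 :
  spans2 h1 h2 -> @is_levi_form R M (distr C) x L ->
  (forall c, linear (L^~ c)) -> (forall b, linear (L b)) -> L h1 h2 != 0 ->
  (forall d, bracket3 (fun a b c => full_ev4 T a b c d) h1 h1 h2 = 0) ->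
  (forall d, bracket3 (fun a b c => full_ev4 T a b c d) h2 h1 h2 = 0) ->
  T \in K''' x.
Proof.
move=> sp lL L1 L2 L12 T1 T2; apply/hK'''.
have T0 a b c d : bracket3 (fun a b c => full_ev4 T a b c d) a b c = 0.
  exact: (bracket3_span2 sp (full_ev4_multilinear T d)).
pose X := vbasis (fullv : {vspace fib E x}); pose Y := vbasis (fullv : {vspace H}).
have lX i : linear (coord X i : fib E x -> R^o) by move=> k u v; rewrite linearP.
have lY i : linear (coord Y i : H -> R^o) by move=> k u v; rewrite linearP.
have YE v : v = \sum_j coord Y j v *: Y`_j by exact: coord_vbasis (memvf v).
exists _, (fun i a b c d => coord X i (full_ev4 T a b c d)), (fun i => X`_i).
split; last by move=> a b c d; exact: coord_vbasis (memvf _).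
move=> i; split.
  (* Expansion of the first argument in the basis [Y] of H; each coefficient tensor comes from an
     element of [K'']. *)
  exists _, (fun j => linfun (coord Y j : H -> R^o)),
    (fun j b c d => coord X i (full_ev4 T Y`_j b c d)); split.
    move=> j; apply: (S3perp_of_bracket3 sp lL L1 L2 L12).
      exact: (multilinear3_comp (lX i) (full_ev3_multilinear (vsval (ev T Y`_j)))).
    move=> a b c.
    rewrite (@bracket3_comp _ R^o (coord X i) (fun b c d => full_ev4 T Y`_j b c d)) //.
    by rewrite /full_ev4 K2_bracket3 ?linear0 //; exact: subvsP.
  move=> a b c d; under eq_bigr => j _ do rewrite linfunE //.
  have [s1 _ _] := full_ev4_multilinear T d.
  rewrite [in LHS](YE a) (lin_sum (s1 b c)) linear_sum; apply: eq_bigr => j _.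
  by rewrite (linZ (s1 b c)) linearZ.
(* Expansion of the last argument; here the brackets vanish by [T0]. *)
exists _, (fun j a b c => coord X i (full_ev4 T a b c Y`_j)),
  (fun j => linfun (coord Y j : H -> R^o)); split.
  move=> j; apply: (S3perp_of_bracket3 sp lL L1 L2 L12).
    exact: (multilinear3_comp (lX i) (full_ev4_multilinear T Y`_j)).
  move=> a b c.
  by rewrite (@bracket3_comp _ R^o (coord X i) (fun a b c => full_ev4 T a b c Y`_j)) // T0 linear0.
move=> a b c d; under eq_bigr => j _ do rewrite linfunE //.
have [_ _ s3] := full_ev3_multilinear (vsval (ev T a)).
rewrite [in LHS](YE d) /full_ev4 (lin_sum (s3 b c)) linear_sum; apply: eq_bigr => j _.
rewrite (linZ (s3 b c)); apply: etrans (linZ (lX i) _ _) _; exact: mulrC.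
Qed.

End Prolongation.

End Tensors.

(** * Commutators of contact vector fields *)

Section CrossProduct.
Variable R : realFieldType.
Implicit Types u v w : 'rV[R]_3.

Definition crossv u v : 'rV[R]_3 := \row_k
  if k == 0 then u 0 1 * v 0 (2%:R) - u 0 (2%:R) * v 0 1
  else if k == 1 then u 0 (2%:R) * v 0 0 - u 0 0 * v 0 (2%:R)
  else u 0 0 * v 0 1 - u 0 1 * v 0 0.

Definition dotv u v : R := \sum_k u 0 k * v 0 k.

Lemma dotv_crossl u v : dotv (crossv u v) u = 0.
Proof. by rewrite /dotv sum3 !mxE /=; ring. Qed.

Lemma dotv_crossr u v : dotv (crossv u v) v = 0.
Proof. by rewrite /dotv sum3 !mxE /=; ring. Qed.

Lemma dotv_linear u : linear (dotv u : 'rV[R]_3 -> R^o).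
Proof.
move=> a v w; rewrite /dotv scaler_sumr -big_split /=; apply: eq_bigr => k _.
by rewrite !mxE mulrDr /GRing.scale /= mulrCA.
Qed.

Lemma row_comb3 u v w (a b d t : R) k : (a *: u + b *: v + d *: w) 0 k * t =
  a * (u 0 k * t) + b * (v 0 k * t) + d * (w 0 k * t).
Proof. by rewrite !mxE; ring. Qed.

Lemma dotv0 u : dotv u 0 = 0.
Proof. by rewrite /dotv big1 // => k _; rewrite mxE mulr0. Qed.

Lemma dotv_cross_comb u v w (a b d : R) :
  dotv (crossv u v) (a *: u + b *: v + d *: w) = d * dotv (crossv u v) w.
Proof. by rewrite /dotv !sum3 !mxE /=; ring. Qed.

Lemma dotv_cross_span u v (a b : R) : dotv (crossv u v) (a *: u + b *: v) = 0.
Proof. by rewrite /dotv !sum3 !mxE /=; ring. Qed.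

Lemma dotv_delta u k : dotv u (delta_mx 0 k) = u 0 k.
Proof.
rewrite /dotv (bigD1 k) //= big1 => [|l lk]; first by rewrite mxE !eqxx mulr1 addr0.
by rewrite mxE (negbTE lk) andbF mulr0.
Qed.

Lemma row3P u v : u 0 0 = v 0 0 -> u 0 1 = v 0 1 -> u 0 (2%:R) = v 0 (2%:R) -> u = v.
Proof.
move=> h0 h1 h2; apply/rowP => -[[|[|[|//]]] k].
- by move: h0; congr (u 0 _ = v 0 _); apply/val_inj.
- by move: h1; congr (u 0 _ = v 0 _); apply/val_inj.
- by move: h2; congr (u 0 _ = v 0 _); apply/val_inj.
Qed.

Lemma crossv_eq0 u v : crossv u v = 0 -> forall k, u 0 k *: v = v 0 k *: u.
Proof.
move=> uv k.
have := congr1 (fun w : 'rV[R]_3 => w 0 0) uv; rewrite !mxE /= => h0.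
have := congr1 (fun w : 'rV[R]_3 => w 0 1) uv; rewrite !mxE /= => h1.
have := congr1 (fun w : 'rV[R]_3 => w 0 (2%:R)) uv; rewrite !mxE /= => h2.
have k3 : [\/ k = 0, k = 1 | k = 2%:R].
  by case: k => [[|[|[|//]]] k]; [constructor 1|constructor 2|constructor 3]; apply/val_inj.
by case: k3 => ->; apply: row3P; rewrite !mxE; lra.
Qed.

End CrossProduct.

Section ChartFields.
Variables (R : realType) (M : manifold3 R) (i : atlas M).
Local Notation V3 := 'rV[R]_3.
Implicit Types (W U : set M) (A B : M -> V3) (f : M -> R^o).

Definition smooth_comps U A := forall k, smooth_fun U (fun x => A x 0 k : R^o).

Definition field_deriv A f : M -> R^o := fun x => \sum_k (A x 0 k : R) * pd i k f x.

Definition field_bracket A B : M -> V3 := fun x =>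
  \row_k (field_deriv A (fun y => B y 0 k : R^o) x - field_deriv B (fun y => A y 0 k : R^o) x).

Lemma field_deriv_smooth W A f : open W -> W `<=` cdom i -> smooth_comps W A ->
  smooth_fun W f -> smooth_fun W (field_deriv A f).
Proof.
move=> oW Wi sA sf; apply: (smooth_fun_sum _ oW) => k _.
exact: smooth_fun_mul oW (sA k) (smooth_fun_pd k oW Wi sf).
Qed.

Lemma field_bracket_smooth W A B : open W -> W `<=` cdom i -> smooth_comps W A ->
  smooth_comps W B -> smooth_comps W (field_bracket A B).
Proof.
move=> oW Wi sA sB k.
have s1 := field_deriv_smooth oW Wi sA (sB k).
have s2 := smooth_fun_opp oW (field_deriv_smooth oW Wi sB (sA k)).
by apply: (smooth_fun_congr oW _ (smooth_fun_add oW s1 s2)) => x _; rewrite mxE.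
Qed.

Lemma pd_sum W k (I : Type) (r : seq I) (F : I -> M -> R^o) x : open W -> W x ->
  cdom i x -> (forall a, smooth_fun W (F a)) ->
  pd i k (fun y => \sum_(a <- r) F a y : R^o) x = \sum_(a <- r) pd i k (F a) x.
Proof.
move=> oW Wx ix sF; elim: r => [|a r IH].
  rewrite big_nil -[RHS](pd_cst i k 0 x); apply: pd_congr oW Wx ix _ => y _.
  by rewrite big_nil.
rewrite big_cons -IH -(pd_add k oW Wx ix (sF a)); last exact: smooth_fun_sum.
by apply: pd_congr oW Wx ix _ => y _; rewrite big_cons.
Qed.

(** Each iterated derivative has a first-order and a second-order part; the second-order parts agree
    by symmetry of second partial derivatives. *)
Lemma field_bracketE W A B f x : open W -> W `<=` cdom i -> smooth_comps W A ->
  smooth_comps W B -> smooth_fun W f -> W x ->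
  field_deriv A (field_deriv B f) x - field_deriv B (field_deriv A f) x =
  field_deriv (field_bracket A B) f x.
Proof.
move=> oW Wi sA sB sf Wx; have ix := Wi _ Wx.
have H (P Q : M -> V3) : smooth_comps W Q -> field_deriv P (field_deriv Q f) x =
   (\sum_k field_deriv P (fun y => Q y 0 k : R^o) x * pd i k f x) +
   \sum_j \sum_k (P x 0 j * Q x 0 k) * pd i j (pd i k f) x.
  move=> sQ; rewrite /field_deriv.
  under [X in _ = X + _]eq_bigr => k _ do rewrite mulr_suml.
  rewrite exchange_big -big_split /=; apply: eq_bigr => j _.
  rewrite (pd_sum j (index_enum 'I_3) oW Wx ix); last first.
    by move=> k; exact: smooth_fun_mul oW (sQ k) (smooth_fun_pd k oW Wi sf).
  rewrite mulr_sumr -big_split /=; apply: eq_bigr => k _.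
  rewrite (pd_mul j oW Wx ix (sQ k) (smooth_fun_pd k oW Wi sf)).
  by move: (pd i j _ x : R) (pd i k f x : R) (pd i j (pd i k f) x : R) (P x 0 j) (Q x 0 k) => *; ring.
rewrite (H A B sB) (H B A sA).
have -> : \sum_j \sum_k (A x 0 j * B x 0 k) * pd i j (pd i k f) x =
    \sum_j \sum_k (B x 0 j * A x 0 k) * pd i j (pd i k f) x.
  rewrite exchange_big; apply: eq_bigr => j _; apply: eq_bigr => k _.
  by rewrite (pd_schwarz k j oW Wx ix sf) [A x 0 k * _]mulrC.
rewrite opprD addrACA subrr addr0 -sumrB; apply: eq_bigr => k _.
by rewrite mxE mulrBl.
Qed.

(** The identity [A . B = 0] is differentiated along [P]. With [A] a conormal, this moves
    derivatives from the form to the fields, as in the formula that relates the Levi form to the Lie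
    bracket. *)
Lemma field_deriv_dot W A B x : open W -> W `<=` cdom i -> smooth_comps W A ->
  smooth_comps W B -> W x -> (forall y, W y -> dotv (A y) (B y) = 0) ->
  forall P : M -> V3, \sum_k B x 0 k * field_deriv P (fun y => A y 0 k : R^o) x =
    - \sum_k A x 0 k * field_deriv P (fun y => B y 0 k : R^o) x.
Proof.
move=> oW Wi sA sB Wx AB P; have ix := Wi _ Wx; apply/eqP; rewrite -addr_eq0.
rewrite -big_split /=; apply/eqP.
transitivity (field_deriv P (fun y => \sum_k (A y 0 k : R) * (B y 0 k : R) : R^o) x).
  under eq_bigr => k _ do rewrite /field_deriv !mulr_sumr -big_split /=.
  rewrite exchange_big; apply: eq_bigr => j _ /=.
  rewrite (pd_sum j (index_enum 'I_3) oW Wx ix); last first.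
    by move=> k; exact: smooth_fun_mul oW (sA k) (sB k).
  rewrite mulr_sumr; apply: eq_bigr => k _.
  rewrite (pd_mul j oW Wx ix (sA k) (sB k)).
  by move: (pd i j _ x : R) (pd i j _ x : R) (P x 0 j) (A x 0 k) (B x 0 k) => *; ring.
rewrite /field_deriv big1 // => j _.
by rewrite (@pd_congr _ _ W i j _ (fun _ => 0 : R^o) x oW Wx ix AB) pd_cst mulr0.
Qed.

End ChartFields.

Lemma linear_bigsum (K : pzRingType) (U W : lmodType K) n (F : 'I_n -> U -> W) :
  (forall k, linear (F k)) -> linear (fun v => \sum_k F k v).
Proof.
move=> lF a u v; rewrite scaler_sumr -big_split /=.
by apply: eq_bigr => k _; rewrite lF.
Qed.

(** * Frames of the contact distribution, their Levi form and their commutators *)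

Section ContactFrame.
Variables (R : realType) (M : manifold3 R) (C : contact M).
Local Notation V3 := 'rV[R]_3.
Local Notation HB := (sub_bundle (distr C)).
Implicit Types (W U : set M) (f : M -> R^o).

Definition Hderiv (X : section HB) f : M -> R^o := fun x => dir f x (vsval (X x)).

(** The commutator [[X1, X2]] acting on functions, kept as a difference of iterated contact
    derivatives because only contact derivatives can be evaluated on solutions. *)
Definition Treeb (X1 X2 : section HB) f : M -> R^o :=
  fun x => Hderiv X1 (Hderiv X2 f) x - Hderiv X2 (Hderiv X1 f) x.

Lemma Hderiv_smooth W (X : section HB) f : open W -> smooth_sec W X ->
  smooth_fun W f -> smooth_fun W (Hderiv X f).
Proof. by move=> oW sX sf; exact: (@smooth_dir R M W f (fun x => vsval (X x)) oW sf sX). Qed.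

Lemma Hderiv_congr W (X : section HB) f g x : open W -> W x ->
  (forall y, W y -> f y = g y) -> Hderiv X f x = Hderiv X g x.
Proof. by move=> oW Wx fg; exact: dir_congr oW Wx fg. Qed.

(** A Levi form is specified as a bare function of two vectors, so bilinearity is carried along with
    the non-zero value. *)
Definition levi_nondegenerate x (h1 h2 : Hfib C x) :=
  exists L : Hfib C x -> Hfib C x -> R^o,
    [/\ @is_levi_form R M (distr C) x L, forall c, linear (L^~ c),
        forall b, linear (L b) & L h1 h2 != 0].

Lemma distr_frame (p : M) : exists U (z : 'I_2 -> section (tangent_bundle M)),
  [/\ open U, U p, U `<=` cdom (chart_at p), forall a, smooth_sec U (z a) &
      forall x, U x -> basis_of (distr C x) [seq z a x | a <- enum 'I_2]].
Proof.
have [U [n [z [oU Up sz bz]]]] := distr_subbundle C p.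
have n2 : n = 2%N.
  by have := size_basis (bz p Up); rewrite card_ord distr_rank.
subst n; exists (U `&` cdom (chart_at p)), z; split.
- exact: open_cdomI.
- by split => //; exact: chart_at_dom.
- exact: subIsetr.
- move=> a; have [rT _ _] := vbundle_tangent M.
  exact: rT oU (open_cdomI _ oU) (@subIsetl _ _ _) (sz a).
- by move=> x [/bz].
Qed.

Section At.
Variables (p : M) (U : set M) (z : 'I_2 -> section (tangent_bundle M)).
Let c := chart_at p.
Hypotheses (oU : open U) (Up : U p) (Uc : U `<=` cdom c)
  (sz : forall a, smooth_sec U (z a))
  (bz : forall x, U x -> basis_of (distr C x) [seq z a x | a <- enum 'I_2]).

Definition frame_comps a : M -> V3 := fun x => tangent_to_chart c x (z a x).
(** Coefficients in the chart of a one-form annihilating H: the cross product of two spanning fields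
    is orthogonal to both. *)
Definition normal_comps : M -> V3 := fun x => crossv (frame_comps 0 x) (frame_comps 1 x).
Definition Hfield a : section HB := fun x => vsproj (distr C x) (z a x).

Lemma frame_comps_smooth a : smooth_comps U (frame_comps a).
Proof. by move=> k; apply: (smooth_fun_sub _ (@sz a c k)) => x Ux; split => //; exact: Uc. Qed.

Lemma normal_comps_smooth : smooth_comps U normal_comps.
Proof.
have H (a b : 'I_2) (k l : 'I_3) : smooth_fun U (fun x =>
    (frame_comps a x 0 k : R) * (frame_comps b x 0 l : R) : R^o).
  exact: smooth_fun_mul oU (frame_comps_smooth a k) (frame_comps_smooth b l).
have HS (a b a' b' : 'I_2) (k l k' l' : 'I_3) : smooth_fun U (fun x =>
   (frame_comps a x 0 k * frame_comps b x 0 l - frame_comps a' x 0 k' * frame_comps b' x 0 l') : R^o).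
  exact: smooth_fun_add oU (H a b k l) (smooth_fun_opp oU (H a' b' k' l')).
move=> k; case k0 : (k == 0).
  by apply: (smooth_fun_congr oU _ (HS 0 1 0 1 1 (2%:R) (2%:R) 1)) => x _; rewrite mxE k0.
case k1 : (k == 1).
  by apply: (smooth_fun_congr oU _ (HS 0 1 0 1 (2%:R) 0 0 (2%:R))) => x _; rewrite mxE k0 k1.
by apply: (smooth_fun_congr oU _ (HS 0 1 0 1 0 1 1 0)) => x _; rewrite mxE k0 k1.
Qed.

Lemma val_Hfield a x : U x -> vsval (Hfield a x) = z a x.
Proof. by move=> Ux; have [zH _ _] := basis_expansion (bz Ux); rewrite vsprojK. Qed.

Lemma Hfield_smooth a W : open W -> W `<=` U -> smooth_sec W (Hfield a).
Proof.
move=> oW WU; have [rT _ _] := vbundle_tangent M.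
have sW : smooth_sec W (z a) by exact: rT oU oW WU (sz a).
rewrite /=; apply: (vb_congr (vbundle_tangent M) oW _ sW) => x Wx.
by rewrite val_Hfield //; exact: WU.
Qed.

Lemma sum2 (A : nmodType) (F : 'I_2 -> A) : \sum_a F a = F 0 + F 1.
Proof.
by rewrite !big_ord_recl big_ord0 addr0; congr (F _ + F _); apply/val_inj.
Qed.

Lemma Hfield_spans x : U x -> spans2 (Hfield 0 x) (Hfield 1 x).
Proof.
move=> Ux v; have [_ /(_ _ (subvsP v))[a va] _] := basis_expansion (bz Ux).
exists (a 0 0), (a 0 1); apply: val_inj.
change (vsval v = vsval (a 0 0 *: Hfield 0 x + a 0 1 *: Hfield 1 x)).
by rewrite linearD !linearZ /= !val_Hfield // va sum2.
Qed.

Lemma frame_comps_free x (a b : R) : U x ->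
  a *: frame_comps 0 x + b *: frame_comps 1 x = 0 -> a = 0 /\ b = 0.
Proof.
move=> Ux; have cx := Uc Ux; have [_ _ fz] := basis_expansion (bz Ux).
have lt := tangent_to_chart_linear cx.
rewrite -!(linZ lt) -(linD lt) => H.
have : \sum_j (\row_j (if j == 0 then a else b)) 0 j *: z j x = 0.
  rewrite sum2 !mxE /= -(tangent_to_chartK (_ + _) cx) H.
  exact: lin0 (tangent_of_chart_linear cx).
move=> /fz /rowP E; split.
  by have := E 0; rewrite !mxE.
by have := E 1; rewrite !mxE.
Qed.

Lemma normal_comps_neq0 x : U x -> normal_comps x != 0.
Proof.
move=> Ux; apply/eqP => /crossv_eq0 H.
have A0 k : frame_comps 0 x 0 k = 0.
  have : (- frame_comps 1 x 0 k) *: frame_comps 0 x + frame_comps 0 x 0 k *: frame_comps 1 x = 0.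
    by rewrite H scaleNr addNr.
  by move=> /(frame_comps_free Ux)[].
have := @frame_comps_free x 1 0 Ux; rewrite scale0r addr0 scale1r => -[].
  by apply/rowP => k; rewrite A0 mxE.
by move=> /eqP; rewrite oner_eq0.
Qed.

Definition normal_form : section (hom_bundle (tangent_bundle M) (trivial_line M)) :=
  fun x => linfun (fun v : V3 => dotv (normal_comps x) (tangent_to_chart c x v) : R^o).

Lemma normal_formE x v : U x ->
  (normal_form x : 'Hom('rV[R]_3, R^o)) v = dotv (normal_comps x) (tangent_to_chart c x v).
Proof.
move=> Ux; have lt := tangent_to_chart_linear (Uc Ux).
by rewrite linfunE // => a u w; rewrite lt dotv_linear.
Qed.

Lemma normal_form_annihilating : annihilating_form (distr C) U normal_form.
Proof.
split.
- move=> W s oW WU ss.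
  apply: (@smooth_fun_congr _ _ _ (fun x => \sum_k (normal_comps x 0 k : R) *
     (tangent_to_chart c x (s x) 0 k : R) : R^o)) => //.
    by move=> x Wx; rewrite normal_formE //; exact: WU.
  apply: (smooth_fun_sum _ oW) => k _; apply: (smooth_fun_mul oW).
    exact: smooth_fun_sub WU (normal_comps_smooth k).
  by apply: smooth_fun_sub (ss c k) => x Wx; split => //; apply/Uc/WU.
- move=> x Ux; apply/eqP => H; have /eqP[] := normal_comps_neq0 Ux.
  apply/rowP => k; rewrite [RHS]mxE.
  have := congr1 (fun T : 'Hom('rV[R]_3, R^o) => T (tangent_of_chart c x (delta_mx 0 k))) H.
  by rewrite /= normal_formE // tangent_of_chartK ?dotv_delta ?zero_lfunE //; exact: Uc.
- move=> x v Ux vH; rewrite normal_formE //.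
  have [_ /(_ _ vH)[a ->] _] := basis_expansion (bz Ux).
  have lt := tangent_to_chart_linear (Uc Ux).
  rewrite sum2 (linD lt) !(linZ lt) -/(frame_comps 0 x) -/(frame_comps 1 x).
  exact: dotv_cross_span.
Qed.

(** The exterior derivative of [normal_form] at [p], in the preferred chart there: vectors are
    extended with constant components, so only the coefficients of the form are differentiated. *)
Definition normal_levi (u v : Hfib C p) : R^o :=
  \sum_k (vsval v) 0 k * dir (fun x => normal_comps x 0 k : R^o) p (vsval u) -
  \sum_k (vsval u) 0 k * dir (fun x => normal_comps x 0 k : R^o) p (vsval v).

Lemma normal_levi_form : @is_levi_form R M (distr C) p normal_levi.
Proof.
exists U, normal_form; split=> //; first exact: normal_form_annihilating.
have H (u v : V3) : 'D_u (fun y => (normal_form (cinv c y) : 'Hom('rV[R]_3, R^o))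
      (tangent_of_chart c (cinv c y) v)) (cmap c p) =
    \sum_k v 0 k * dir (fun x => normal_comps x 0 k : R^o) p u.
  transitivity (dir (fun x => \sum_k (v 0 k : R) * (normal_comps x 0 k : R) : R^o) p u).
    apply: near_eq_derive; apply: (near_chart oU Up (chart_at_dom p)) => x Ux cx.
    rewrite /= cmapK // normal_formE // tangent_of_chartK // /dotv.
    by apply: eq_bigr => k _; rewrite mulrC.
  rewrite (dir_sum _ _ oU Up) => [|k]; last first.
    exact: smooth_fun_mul oU (smooth_fun_cst _ oU) (normal_comps_smooth k).
  apply: eq_bigr => k _.
  rewrite (dir_mul _ oU Up (smooth_fun_cst _ oU) (normal_comps_smooth k)).
  by rewrite dir_cst mulr0 addr0.
by apply: funext => u; apply: funext => v; rewrite /ext_deriv /= !H.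
Qed.

Lemma normal_levi_diag u : normal_levi u u = 0.
Proof. exact: subrr. Qed.

Lemma dir_normal_linear k :
  linear (fun v : Hfib C p => dir (fun x => normal_comps x 0 k : R^o) p (vsval v) : R^o).
Proof.
move=> a v w; rewrite linearP.
exact: (dir_linear oU Up (normal_comps_smooth k)).
Qed.

Lemma vsval_coord_linear k : linear (fun v : Hfib C p => vsval v 0 k : R^o).
Proof. by move=> a v w; rewrite linearP !mxE. Qed.

Lemma normal_levi_linear u : linear (normal_levi u).
Proof.
apply: linear_sub; apply: linear_bigsum => k.
  exact: linear_rscale (vsval_coord_linear k).
exact: linear_scale (dir_normal_linear k).
Qed.

Lemma normal_levi_linear_l u : linear (normal_levi^~ u).
Proof.
apply: linear_sub; apply: linear_bigsum => k.
  exact: linear_scale (dir_normal_linear k).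
exact: linear_rscale (vsval_coord_linear k).
Qed.

(** Otherwise the first frame field, which always pairs to zero with itself, would pair to zero with
    all of H, and the contact condition would make it vanish. *)
Lemma normal_levi_neq0 : normal_levi (Hfield 0 p) (Hfield 1 p) != 0.
Proof.
apply/eqP => L0.
have L00 := normal_levi_diag (Hfield 0 p).
have := @distr_contact R M C p normal_levi normal_levi_form (Hfield 0 p)
  (lin_span2 (Hfield_spans Up) (normal_levi_linear _) L00 L0).
move=> /(congr1 vsval); rewrite val_Hfield // linear0 => z0.
have := @frame_comps_free p 1 0 Up; rewrite scale0r addr0 scale1r => -[].
  by rewrite /frame_comps z0 (lin0 (tangent_to_chart_linear (Uc Up))).
by move=> /eqP; rewrite oner_eq0.
Qed.

End At.

(* The Levi form being non-degenerate, X_0, X_1 and [X_0, X_1] frame the tangent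
   bundle near p, so [X_j, [X_0, X_1]] is a combination of them. *)
Lemma contact_commutator (p : M) : exists U (X : 'I_2 -> section HB)
    (a b d : 'I_2 -> M -> R^o),
  [/\ open U, U p, forall j, smooth_sec U (X j),
      forall x, U x -> basis_of (distr C x) [seq vsval (X j x) | j <- enum 'I_2] &
      (forall j, [/\ smooth_fun U (a j), smooth_fun U (b j) & smooth_fun U (d j)]) /\
      forall j W f x, open W -> W `<=` U -> smooth_fun W f -> W x ->
        Hderiv (X j) (Treeb (X 0) (X 1) f) x - Treeb (X 0) (X 1) (Hderiv (X j) f) x =
        a j x * Hderiv (X 0) f x + b j x * Hderiv (X 1) f x + d j x * Treeb (X 0) (X 1) f x].
Proof.
have [U [z [oU Up Uc sz bz]]] := distr_frame p.
pose c := chart_at p; pose X := Hfield z; pose A := frame_comps p z.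
have sA j : smooth_comps U (A j) by exact: frame_comps_smooth.
pose T := field_bracket c (A 0) (A 1).
have sT : smooth_comps U T by exact: field_bracket_smooth.
have XE j W f x : open W -> W `<=` U -> smooth_fun W f -> W x ->
    Hderiv (X j) f x = field_deriv c (A j) f x.
  move=> oW WU sf Wx; rewrite /Hderiv (val_Hfield bz) //; last exact: WU.
  by rewrite (dirE _ oW Wx (Uc _ (WU _ Wx)) sf).
have sub W (B : M -> V3) : W `<=` U -> smooth_comps U B -> smooth_comps W B.
  by move=> WU sB k; exact: smooth_fun_sub WU (sB k).
have Ws W : W `<=` U -> W `<=` cdom c by move=> WU x /WU /Uc.
have sXs j W : open W -> W `<=` U -> smooth_sec W (X j).
  by move=> oW WU; exact: (Hfield_smooth oU sz bz).
have sX j W f : open W -> W `<=` U -> smooth_fun W f -> smooth_fun W (Hderiv (X j) f).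
  by move=> oW WU sf; apply: (Hderiv_smooth oW (sXs j W oW WU) sf).
have TE W f x : open W -> W `<=` U -> smooth_fun W f -> W x ->
    Treeb (X 0) (X 1) f x = field_deriv c T f x.
  move=> oW WU sf Wx; rewrite /Treeb.
  rewrite (XE 0 W _ x oW WU (sX 1 W f oW WU sf) Wx).
  rewrite (XE 1 W _ x oW WU (sX 0 W f oW WU sf) Wx).
  rewrite -(field_bracketE oW (Ws _ WU) (sub _ _ WU (sA 0)) (sub _ _ WU (sA 1)) sf Wx).
  by congr (_ - _); apply: eq_bigr => k _; congr (_ * _);
     apply: (pd_congr _ oW Wx (Ws _ WU _ Wx)) => y Wy; exact: (XE _ W f y oW WU sf Wy).
pose B x : 'M[R]_3 := \matrix_l (if l == 0 then A 0 x else if l == 1 then A 1 x else T x).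
have B0 x : row 0 (B x) = A 0 x by rewrite rowK.
have B1 x : row 1 (B x) = A 1 x by rewrite rowK.
have B2 x : row (2%:R) (B x) = T x by rewrite rowK.
have sB : smooth_mx U B.
  move=> l k; case l0 : (l == 0).
    by apply: (smooth_fun_congr oU _ (sA 0 k)) => x _; rewrite mxE l0.
  case l1 : (l == 1).
    by apply: (smooth_fun_congr oU _ (sA 1 k)) => x _; rewrite mxE l0 l1.
  by apply: (smooth_fun_congr oU _ (sT k)) => x _; rewrite [in RHS]mxE l0 l1.
(* The value of the Levi form on the frame is minus the conormal applied to the bracket [T], by
   differentiating the orthogonality of the conormal to [A 0] and [A 1]. *)
have nT : dotv (normal_comps p z p) (T p) != 0.
  have := normal_levi_neq0 oU Up Uc sz bz; apply: contra_neq => nT0.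
  have sN := normal_comps_smooth oU Uc sz.
  have zE j k : z j p 0 k = A j p 0 k.
    by rewrite /A /frame_comps /tangent_to_chart derive_chart_id //; exact: chart_at_dom.
  have dE j k : dir (fun x => normal_comps p z x 0 k : R^o) p (z j p) =
      field_deriv c (A j) (fun x => normal_comps p z x 0 k : R^o) p.
    by rewrite (dirE _ oU Up (Uc _ Up) (sN k)).
  have -> : normal_levi z (Hfield z 0 p) (Hfield z 1 p) =
     \sum_k A 1 p 0 k * field_deriv c (A 0) (fun x => normal_comps p z x 0 k : R^o) p -
     \sum_k A 0 p 0 k * field_deriv c (A 1) (fun x => normal_comps p z x 0 k : R^o) p.
    congr (_ - _); apply: eq_bigr => k _; congr (_ * _);
      rewrite (val_Hfield bz) //; by [exact: zE | exact: dE].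
  have d0 y : U y -> dotv (normal_comps p z y) (A 0 y) = 0 by move=> _; exact: dotv_crossl.
  have d1 y : U y -> dotv (normal_comps p z y) (A 1 y) = 0 by move=> _; exact: dotv_crossr.
  have D1 := field_deriv_dot oU Uc sN (sA 1) Up d1 (A 0).
  have D0 := field_deriv_dot oU Uc sN (sA 0) Up d0 (A 1).
  apply: (etrans (congr2 (fun u v : R => u - v) D1 D0)).
  apply: (@etrans _ _ (- dotv (normal_comps p z p) (T p))); last by rewrite nT0 oppr0.
  rewrite -opprD; congr (- _); rewrite -sumrB; apply: eq_bigr => k _.
  by rewrite -mulrBr; congr (_ * _); rewrite /T /field_bracket mxE.
have dB : \det (B p) != 0.
  rewrite -unitfE -unitmxE -row_free_unit -kermx_eq0; apply/rowV0P => v /sub_kermxP vB.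
  have vE : v 0 0 *: A 0 p + v 0 1 *: A 1 p + v 0 (2%:R) *: T p = 0.
    by rewrite -vB mulmx_sum_row sum3 B0 B1 B2.
  have v2 : v 0 (2%:R) = 0.
    have := dotv_cross_comb (A 0 p) (A 1 p) (T p) (v 0 0) (v 0 1) (v 0 (2%:R)).
    rewrite vE dotv0 => /esym/eqP.
    by rewrite mulf_eq0 (negbTE nT) orbF => /eqP.
  move: vE; rewrite v2 scale0r addr0 => /(frame_comps_free Uc bz Up)[v0 v1].
  by apply: row3P; rewrite ?v0 ?v1 ?v2 mxE.
have [N [oN Np NU dN]] := det_neq0_nbhs oU Up sB dB.
(* The double bracket in chart components; [co j] contains its coefficients in the tangent frame
   [A 0], [A 1], [T], smooth wherever [B] is invertible. *)
pose S j := field_bracket c (A j) T.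
pose co j x := S j x *m invmx (B x).
have sS j : smooth_comps U (S j) := field_bracket_smooth oU Uc (sA j) sT.
have sco j : smooth_mx N (co j).
  apply: (smooth_mx_mul oN); last exact: smooth_mx_inv oN (smooth_mx_sub NU sB) dN.
  by move=> i k; rewrite (ord1 i); exact: sub _ _ NU (sS j) k.
exists N, X, (fun j x => co j x 0 0), (fun j x => co j x 0 1), (fun j x => co j x 0 (2%:R)).
split; [exact: oN | exact: Np | by move=> j; exact: sXs | |].
  move=> x Nx; have <- : [seq z j x | j <- enum 'I_2] = [seq vsval (X j x) | j <- enum 'I_2].
    by apply: eq_map => j; rewrite /X (val_Hfield bz) //; exact: NU.
  exact: bz (NU _ Nx).
split; first by move=> j; split; exact: sco.
move=> j W f x oW WN sf Wx; have WU := subset_trans WN NU.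
have Wc := Ws _ WU; have cx := Wc _ Wx.
have sTf : smooth_fun W (field_deriv c T f) by exact: field_deriv_smooth (sub _ _ WU sT) sf.
have sTf' : smooth_fun W (Treeb (X 0) (X 1) f).
  by apply: (smooth_fun_congr oW _ sTf) => y Wy; rewrite (TE W).
rewrite (XE j W _ x oW WU sTf' Wx) (TE W _ x oW WU (sX j W f oW WU sf) Wx).
have -> : field_deriv c (A j) (Treeb (X 0) (X 1) f) x - field_deriv c T (Hderiv (X j) f) x
   = field_deriv c (S j) f x.
  apply: (etrans _ (field_bracketE oW Wc (sub _ _ WU (sA j)) (sub _ _ WU sT) sf Wx)).
  by congr (_ - _); apply: eq_bigr => k _; congr (_ * _);
     apply: (pd_congr _ oW Wx cx) => y Wy;
     [exact: (TE W f y oW WU sf Wy) | exact: (XE _ W f y oW WU sf Wy)].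
rewrite (XE 0 W f x oW WU sf Wx) (XE 1 W f x oW WU sf Wx) (TE W f x oW WU sf Wx).
have SE : S j x = co j x *m B x.
  by rewrite /co -mulmxA mulVmx ?mulmx1 // unitmxE unitfE; exact: dN (WN _ Wx).
rewrite /field_deriv SE !mulr_sumr -!big_split /=; apply: eq_bigr => k _.
rewrite mulmx_sum_row sum3 B0 B1 B2.
exact: row_comb3.
Qed.

Lemma contact_levi (p : M) (h1 h2 : Hfib C p) : spans2 h1 h2 -> h1 != 0 ->
  levi_nondegenerate h1 h2.
Proof.
move=> sp h10; have [U [z [oU Up Uc sz bz]]] := distr_frame p.
have lL := normal_levi_form oU Up Uc sz bz.
have l2 := normal_levi_linear oU Up Uc sz.
have l1 := normal_levi_linear_l oU Up Uc sz.
exists (normal_levi z); split => //.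
apply/eqP => L0; move/eqP: h10; apply.
apply: (@distr_contact R M C p (normal_levi z) lL h1).
exact: (lin_span2 sp (l2 h1) (normal_levi_diag _ _) L0).
Qed.

End ContactFrame.

(** * Differential consequences of the system *)

Lemma linear_finsum (K : pzRingType) (U W : lmodType K) (I : finType) (F : I -> U -> W) :
  (forall k, linear (F k)) -> linear (fun v => \sum_k F k v).
Proof.
move=> lF a u v; rewrite scaler_sumr -big_split /=.
by apply: eq_bigr => k _; rewrite lF.
Qed.

Lemma leibniz_difference (K : comRingType) (c d p q h : K) :
  c * h + p * d = c * q + d * p + c * (h - q).
Proof. by ring. Qed.

Lemma pairing_add (K : nmodType) (a b c d a' b' c' d' : K) :
  a + b + c + d + (a' + b' + c' + d') = a + a' + (b + b') + (c + c') + (d + d').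
Proof. by rewrite addrACA; congr (_ + _); rewrite addrACA; congr (_ + _); rewrite addrACA. Qed.

Section LocalConnections.
Variables (R : realType) (M : manifold3 R) (C : contact M).
Local Notation HB := (sub_bundle (distr C)).
Implicit Types (W U : set M) (V : bundle M).

Lemma vbundle_H : vbundle HB.
Proof. exact: vbundle_sub (@vbundle_tangent R M) (distr_subbundle C). Qed.

Lemma vbundle_LamH V : vbundle V -> vbundle (LamH C V).
Proof. by move=> vV; exact: vbundle_hom vbundle_H vV. Qed.

(** A smooth section over [U] of the dual bundle, encoded by its action on smooth sections. *)
Definition functional V U (phi : forall x, fib V x -> R^o) :=
  (forall x, U x -> linear (phi x)) /\
  (forall W (s : section V), open W -> W `<=` U -> smooth_sec W s ->
     smooth_fun W (fun x => phi x (s x))).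

(** The laws of [partial_connection] over open subsets of [U], stated for a bare operator: local
    operators become a [partial_connection] only after they are summed with weights. *)
Definition local_conn V U (nab : section V -> section (LamH C V)) :=
  [/\ forall W (s t : section V), open W -> W `<=` U ->
        eq_on W s t -> eq_on W (nab s) (nab t),
      forall W (s : section V), open W -> W `<=` U ->
        smooth_sec W s -> smooth_sec W (nab s),
      forall W (s t : section V), open W -> W `<=` U ->
        smooth_sec W s -> smooth_sec W t ->
        eq_on W (nab (fun x => s x + t x)) (fun x => nab s x + nab t x) &
      forall W (f : M -> R^o) (s : section V), open W -> W `<=` U ->
        smooth_fun W f -> smooth_sec W s ->
        forall (x : M) (a : Hfib C x), W x ->
        ev (nab (fun y => f y *: s y) x) a =
        f x *: ev (nab s x) a + dH f a *: s x].

Lemma partial_connection_local V (nab : partial_connection C V) U : local_conn U nab.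
Proof.
split.
- by move=> W s t oW _; exact: nabla_local.
- by move=> W s oW _; exact: nabla_smooth.
- by move=> W s t oW _; exact: nabla_add.
- by move=> W f s oW _; exact: nabla_leibniz.
Qed.

Lemma local_conn_sub V U U' nab : U' `<=` U -> @local_conn V U nab -> local_conn U' nab.
Proof.
move=> UU [c1 c2 c3 c4]; split.
- by move=> W s t oW WU; apply: c1 => //; exact: subset_trans UU.
- by move=> W s oW WU; apply: c2 => //; exact: subset_trans UU.
- by move=> W s t oW WU; apply: c3 => //; exact: subset_trans UU.
- by move=> W f s oW WU; apply: c4 => //; exact: subset_trans UU.
Qed.

Lemma functional_sub V U U' phi : U' `<=` U -> @functional V U phi -> functional U' phi.
Proof.
move=> UU [p1 p2]; split; first by move=> x /UU; exact: p1.
by move=> W s oW WU; apply: p2 => //; exact: subset_trans UU.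
Qed.

Section Combination.
Variables (V : bundle M) (vV : vbundle V) (U : set M) (nab : section V -> section (LamH C V)).
Hypothesis cn : local_conn U nab.

Lemma local_conn_sum W (I : Type) (r : seq I) (f : I -> M -> R^o) (e : I -> section V)
    x (a : Hfib C x) : open W -> W `<=` U -> W x ->
  (forall i, smooth_fun W (f i)) -> (forall i, smooth_sec W (e i)) ->
  ev (nab (fun y => \sum_(i <- r) f i y *: e i y) x) a =
  \sum_(i <- r) (f i x *: ev (nab (e i) x) a + dH (f i) a *: e i x).
Proof.
move=> oW WU Wx sf se; have [c1 c2 c3 c4] := cn.
elim: r => [|i r IH].
  have s0 := vb_zero vV oW.
  rewrite (c1 W _ (fun y => (0 : R^o) *: (0 : fib V y))) //; last first.
    by move=> y _; rewrite big_nil scaler0.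
  rewrite (c4 W (fun _ => 0) (fun y => 0)) //; last exact: smooth_fun_cst.
  by rewrite big_nil scale0r scaler0 addr0.
have sr : smooth_sec W ((fun y => \sum_(j <- r) f j y *: e j y) : section V).
  by apply: (vb_sum vV) => // j; exact: vb_scale.
have si : smooth_sec W ((fun y => f i y *: e i y) : section V) by exact: vb_scale.
rewrite (c1 W _ (fun y => f i y *: e i y + \sum_(j <- r) f j y *: e j y)) //; last first.
  by move=> y _; rewrite big_cons.
rewrite (c3 W _ _ oW WU si sr x Wx) big_cons -IH -(c4 W (f i) (e i) oW WU (sf i) (se i)) //.
exact: linD (@ev_linear_l R M C x V a) _ _.
Qed.

End Combination.
End LocalConnections.

Section Functionals.
Variables (R : realType) (M : manifold3 R) (C : contact M) (U : set M).
Hypothesis oU : open U.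
Local Notation HB := (sub_bundle (distr C)).
Implicit Types (W : set M) (V : bundle M).

Lemma functional0 V : functional U (fun x (_ : fib V x) => 0 : R^o).
Proof.
split; first by move=> x _ a u v; rewrite scaler0 addr0.
by move=> W s oW _ _; exact: smooth_fun_cst.
Qed.

Lemma functional_add V (p q : forall x, fib V x -> R^o) :
  functional U p -> functional U q -> functional U (fun x v => p x v + q x v : R^o).
Proof.
move=> [p1 p2] [q1 q2]; split; first by move=> x Ux; exact: linear_add (p1 x Ux) (q1 x Ux).
by move=> W s oW WU ss; exact: smooth_fun_add oW (p2 W s oW WU ss) (q2 W s oW WU ss).
Qed.

Lemma functional_scale V (f : M -> R^o) (p : forall x, fib V x -> R^o) :
  smooth_fun U f -> functional U p -> functional U (fun x v => (f x : R) * (p x v : R) : R^o).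
Proof.
move=> sf [p1 p2]; split; first by move=> x Ux; exact: linear_scale (p1 x Ux).
move=> W s oW WU ss.
exact: smooth_fun_mul oW (smooth_fun_sub WU sf) (p2 W s oW WU ss).
Qed.

Lemma functional_comp A V (T : forall x, fib A x -> fib V x) (p : forall x, fib V x -> R^o) :
  functional U p -> (forall x, U x -> linear (T x)) ->
  (forall W (s : section A), open W -> W `<=` U -> smooth_sec W s ->
     @smooth_sec R M V W (fun x => T x (s x))) ->
  functional U (fun x v => p x (T x v)).
Proof.
move=> [p1 p2] lT sT; split; first by move=> x Ux a u v; rewrite lT // p1.
by move=> W s oW WU ss; exact: p2 oW WU (sT W s oW WU ss).
Qed.

Variable X : section HB.
Hypothesis sX : smooth_sec U X.

Lemma smooth_H W : open W -> W `<=` U -> smooth_sec W X.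
Proof. by move=> oW WU; have [rH _ _] := vbundle_H C; exact: rH sX. Qed.

Lemma functional_ev V (p : forall x, fib V x -> R^o) : functional U p ->
  functional U (fun x (T : fib (LamH C V) x) => p x (ev T (X x))).
Proof.
move=> fp; apply: (@functional_comp (LamH C V) V (fun x T => ev T (X x))) => //.
  by move=> x _; exact: ev_linear_l.
by move=> W T oW WU sT; apply: sT => //; exact: smooth_H.
Qed.

Lemma functional_sub_val V (K : forall x, {vspace fib V x}) (p : forall x, fib V x -> R^o) :
  functional U p -> functional U (fun x (v : fib (sub_bundle K) x) => p x (vsval v)).
Proof.
by move=> fp; apply: (@functional_comp (sub_bundle K) V (fun x v => vsval v)).
Qed.

(** The functional [eta] is the covariant derivative of [phi] along [X]. It is prescribed on a frame
    by [k], and in the expansion of a general section the derivatives of the coordinates cancel by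
    the Leibniz rule. *)
Lemma conn_functional V (nab : section V -> section (LamH C V))
    (phi : forall x, fib V x -> R^o) :
  vbundle V -> framed V U -> local_conn U nab -> functional U phi ->
  exists2 eta : forall x, fib V x -> R^o, functional U eta &
    forall W (s : section V) x, open W -> W `<=` U -> smooth_sec W s -> W x ->
      Hderiv X (fun y => phi y (s y)) x = phi x (ev (nab s x) (X x)) + eta x (s x).
Proof.
move=> vV [I [e [c fe]]] cn fphi; have [f1 f2 f3 f4] := fe; have [p1 p2] := fphi.
have [c1 c2 c3 c4] := cn; have UU := @subset_refl _ U.
have se i : smooth_sec U (e i) := frame_smooth i fe oU UU.
pose k i x : R^o := Hderiv X (fun y => phi y (e i y)) x - phi x (ev (nab (e i) x) (X x)).
have sk i : smooth_fun U (k i).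
  apply: (smooth_fun_add oU (Hderiv_smooth oU sX (p2 U _ oU UU (se i)))).
  apply: (smooth_fun_opp oU); apply: (p2 U (fun x => ev (nab (e i) x) (X x)) oU UU).
  by apply: (c2 U _ oU UU (se i)).
exists (fun x v => \sum_i (c i x v : R) * (k i x : R) : R^o).
  split; first by move=> x Ux; apply: linear_finsum => i; exact: linear_rscale (f1 x i Ux).
  move=> W s oW WU ss; apply: (smooth_fun_sum _ oW) => i _.
  apply: (smooth_fun_mul oW) (smooth_fun_sub WU (sk i)).
  by have /f4 := ss; apply.
move=> W s x oW WU ss Wx; have Ux := WU _ Wx.
have sc i : smooth_fun W (fun y => c i y (s y)) by have /f4 := ss; apply.
have seW i : smooth_sec W (e i) := frame_smooth i fe oW WU.
have spe i : smooth_fun W (fun y => phi y (e i y)) := p2 W _ oW WU (seW i).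
have -> : Hderiv X (fun y => phi y (s y)) x =
    \sum_i (c i x (s x) * Hderiv X (fun y => phi y (e i y)) x +
            phi x (e i x) * dH (fun y => c i y (s y)) (X x)).
  rewrite (@Hderiv_congr _ _ _ W X _ (fun y => \sum_i (c i y (s y) : R) * (phi y (e i y) : R) : R^o)) //.
    rewrite [LHS](dir_sum _ _ oW Wx) => [|i]; last exact: smooth_fun_mul oW (sc i) (spe i).
    by apply: eq_bigr => i _; rewrite (dir_mul _ oW Wx (sc i) (spe i)).
  move=> y Wy; have Uy := WU _ Wy.
  rewrite {1}(f2 y (s y) Uy) (lin_sum (p1 y Uy)).
  by apply: eq_bigr => i _; rewrite (linZ (p1 y Uy)).
have -> : ev (nab s x) (X x) =
    \sum_i (c i x (s x) *: ev (nab (e i) x) (X x) + dH (fun y => c i y (s y)) (X x) *: e i x).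
  rewrite -(local_conn_sum vV cn _ (X x) oW WU Wx sc seW).
  have EW : eq_on W s (fun y => \sum_i c i y (s y) *: e i y).
    by move=> y Wy; rewrite {1}(f2 y (s y) (WU _ Wy)).
  by rewrite (c1 W _ _ oW WU EW x Wx).
rewrite (lin_sum (p1 x Ux)) -big_split /=; apply: eq_bigr => i _.
rewrite (linD (p1 x Ux)) !(linZ (p1 x Ux)) /k.
exact: leibniz_difference.
Qed.

End Functionals.

Section FlatConnection.
Variables (R : realType) (M : manifold3 R) (C : contact M) (V : bundle M).

Lemma dH_linear W (f : M -> R^o) x : open W -> W x -> smooth_fun W f ->
  linear (fun a : Hfib C x => dH f a : R^o).
Proof.
move=> oW Wx sf k u v; rewrite /dH linearP.
exact: (dir_linear oW Wx sf).
Qed.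

(** The connection for which the local frame is parallel: it differentiates coordinates. *)
Lemma flat_connection U : vbundle V -> open U -> framed V U ->
  exists nab : section V -> section (LamH C V), local_conn U nab.
Proof.
move=> vV oU [I [e [c fe]]]; have [f1 f2 f3 f4] := fe.
pose D (s : section V) x (a : Hfib C x) : fib V x :=
  \sum_i (dH (fun y => c i y (s y)) a : R) *: e i x.
pose nab : section V -> section (LamH C V) := fun s x => linfun (D s x).
have lD W s x : open W -> W `<=` U -> smooth_sec W s -> W x -> linear (D s x).
  move=> oW WU ss Wx; apply: linear_finsum => i k u v.
  have sc : smooth_fun W (fun y => c i y (s y)) by have /f4 := ss; apply.
  by rewrite (dH_linear oW Wx sc) scalerDl scalerA.
have nE W s x a : open W -> W `<=` U -> smooth_sec W s -> W x ->
    ev (nab s x) a = D s x a.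
  by move=> oW WU ss Wx; rewrite /ev linfunE //; exact: lD oW WU ss Wx.
exists nab; split.
(* Locality concerns arbitrary sections, for which [D s x] may fail to be linear; the two values
   agree nevertheless, being [linfun] of equal functions. *)
- move=> W s t oW WU st x Wx; congr linfun; apply: funext => a.
  apply: eq_bigr => i _; congr (_ *: _).
  by apply: (dir_congr _ oW Wx) => y Wy; rewrite st.
- move=> W s oW WU ss W' X oW' W'W sX.
  have W'U := subset_trans W'W WU.
  have ss' : smooth_sec W' s by have [rV _ _] := vV; exact: rV oW oW' W'W ss.
  have sD : smooth_sec W' ((fun x => \sum_i (Hderiv X (fun y => c i y (s y)) x) *: e i x) : section V).
    apply: (vb_sum vV _ oW') => i; apply: (vb_scale vV oW').
      by apply: (Hderiv_smooth oW' sX); have /f4 := ss'; apply.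
    exact: frame_smooth fe oW' W'U.
  apply: (vb_congr vV oW' _ sD) => x Wx; apply: esym.
  exact: (nE W' s x (X x) oW' W'U ss' Wx).
- move=> W s t oW WU ss st x Wx; apply/lfunP => a; rewrite add_lfunE.
  have sst : smooth_sec W ((fun x => s x + t x) : section V) by exact: vb_add.
  rewrite -[LHS]/(ev (nab _ x) a) -[nab s x a]/(ev (nab s x) a) -[nab t x a]/(ev (nab t x) a).
  rewrite !(nE W) // /D -big_split /=; apply: eq_bigr => i _.
  have sc : smooth_fun W (fun y => c i y (s y)) by have /f4 := ss; apply.
  have tc : smooth_fun W (fun y => c i y (t y)) by have /f4 := st; apply.
  rewrite -scalerDl; congr (_ *: _); rewrite -[RHS](dir_add _ oW Wx sc tc).
  by apply: (dir_congr _ oW Wx) => y Wy; rewrite (linD (f1 y i (WU _ Wy))).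
- move=> W f s oW WU sf ss x a Wx.
  have sfs : smooth_sec W ((fun x => f x *: s x) : section V) by exact: vb_scale.
  rewrite !(nE W) // /D {1}(f2 x (s x) (WU _ Wx)) !scaler_sumr -big_split /=.
  apply: eq_bigr => i _.
  have sc : smooth_fun W (fun y => c i y (s y)) by have /f4 := ss; apply.
  rewrite !scalerA -scalerDl; congr (_ *: _).
  rewrite [dH f a * _]mulrC -[RHS](dir_mul _ oW Wx sf sc).
  by apply: (dir_congr _ oW Wx) => y Wy; rewrite (linZ (f1 y i (WU _ Wy))).
Qed.

End FlatConnection.

(** * Contact derivatives of the fields along solutions *)

Section SolutionQuantities.
Variables (R : realType) (M : manifold3 R) (C : contact M) (E : bundle M)
  (K : forall x : M, {vspace fib (LamH C E) x})
  (K' : forall x : M, {vspace fib (LamH C (sub_bundle K)) x})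
  (K'' : forall x : M, {vspace fib (LamH C (sub_bundle K')) x})
  (nE : partial_connection C E)
  (nK : partial_connection C (sub_bundle K))
  (nK' : partial_connection C (sub_bundle K'))
  (L : section (hom_bundle E (LamH C (sub_bundle K))))
  (Mh : section (hom_bundle (sum_bundle E (sub_bundle K)) (LamH C (sub_bundle K')))).
Hypotheses (vE : vbundle E) (vK : vbundle (sub_bundle K))
  (vK' : vbundle (sub_bundle K')) (vK'' : vbundle (sub_bundle K''))
  (hL : smooth_hom L) (hM : smooth_hom Mh).
Variable U : set M.
Hypothesis oU : open U.
Hypotheses (fE : framed E U) (fK : framed (sub_bundle K) U)
  (fK' : framed (sub_bundle K') U) (fK'' : framed (sub_bundle K'') U).
Local Notation HB := (sub_bundle (distr C)).
Implicit Types (W : set M) (x : M) (X : section HB).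

Definition fields : Type :=
  section E * section (sub_bundle K) * section (sub_bundle K') * section (sub_bundle K'').
Implicit Type s : fields.

Definition Lapp x (v : fib E x) : fib (LamH C (sub_bundle K)) x :=
  (L x : 'Hom(fib E x, fib (LamH C (sub_bundle K)) x)) v.

Definition Mapp x (v : fib E x) (m : fib (sub_bundle K) x) : fib (LamH C (sub_bundle K')) x :=
  (Mh x : 'Hom(fib (sum_bundle E (sub_bundle K)) x, fib (LamH C (sub_bundle K')) x)) (v, m).

(** The vanishing of the first three rows of [DH'], with [tau] as a field of its own. The last row
    is left out, being what has to be derived. *)
Definition solution W s :=
  [/\ smooth_sec W s.1.1.1, smooth_sec W s.1.1.2, smooth_sec W s.1.2 & smooth_sec W s.2] /\
  forall x, W x ->
    [/\ nE s.1.1.1 x = vsval (s.1.1.2 x),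
        nK s.1.1.2 x = vsval (s.1.2 x) - Lapp (s.1.1.1 x) &
        nK' s.1.2 x = vsval (s.2 x) - Mapp (s.1.1.1 x) (s.1.1.2 x)].

Definition pairing (t0 : forall x, fib E x -> R^o) (t1 : forall x, fib (sub_bundle K) x -> R^o)
    (t2 : forall x, fib (sub_bundle K') x -> R^o)
    (t3 : forall x, fib (sub_bundle K'') x -> R^o) s x : R^o :=
  t0 x (s.1.1.1 x) + t1 x (s.1.1.2 x) + t2 x (s.1.2 x) + t3 x (s.2 x).

(* On solutions q is a smooth linear function of the first k + 1 fields. *)
Definition tensorial (k : nat) (q : fields -> M -> R^o) :=
  exists t0 t1 t2 t3,
    [/\ functional U t0, functional U t1, functional U t2 & functional U t3] /\
    [/\ (k < 1)%N -> forall x v, U x -> t1 x v = 0,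
        (k < 2)%N -> forall x v, U x -> t2 x v = 0,
        (k < 3)%N -> forall x v, U x -> t3 x v = 0 &
        forall W s x, open W -> W `<=` U -> solution W s -> W x ->
          q s x = pairing t0 t1 t2 t3 s x].

Lemma tensorial_congr k q q' :
  (forall W s x, open W -> W `<=` U -> solution W s -> W x -> q s x = q' s x) ->
  tensorial k q -> tensorial k q'.
Proof.
move=> qq [t0 [t1 [t2 [t3 [ft [z1 z2 z3 qE]]]]]]; exists t0, t1, t2, t3; split => //.
by split => // W s x oW WU ss Wx; rewrite -(qq W) //; exact: qE ss Wx.
Qed.

Lemma tensorial_leq k l q : (k <= l)%N -> tensorial k q -> tensorial l q.
Proof.
move=> kl [t0 [t1 [t2 [t3 [ft [z1 z2 z3 qE]]]]]]; exists t0, t1, t2, t3; split => //.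
split => // h; [apply: z1|apply: z2|apply: z3]; exact: leq_ltn_trans h.
Qed.

Lemma tensorial_add k q r : tensorial k q -> tensorial k r ->
  tensorial k (fun s x => q s x + r s x : R^o).
Proof.
move=> [t0 [t1 [t2 [t3 [[f0 f1 f2 f3] [z1 z2 z3 qE]]]]]].
move=> [u0 [u1 [u2 [u3 [[g0 g1 g2 g3] [w1 w2 w3 rE]]]]]].
exists (fun x v => t0 x v + u0 x v), (fun x v => t1 x v + u1 x v),
  (fun x v => t2 x v + u2 x v), (fun x v => t3 x v + u3 x v); split.
  by split; exact: functional_add.
split.
- by move=> h x v Ux; rewrite z1 // w1 // addr0.
- by move=> h x v Ux; rewrite z2 // w2 // addr0.
- by move=> h x v Ux; rewrite z3 // w3 // addr0.
move=> W s x oW WU ss Wx; rewrite (qE W s x) // (rE W s x) //.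
exact: pairing_add.
Qed.

Lemma tensorial_mul k (f : M -> R^o) q : smooth_fun U f -> tensorial k q ->
  tensorial k (fun s x => (f x : R) * (q s x : R) : R^o).
Proof.
move=> sf [t0 [t1 [t2 [t3 [[f0 f1 f2 f3] [z1 z2 z3 qE]]]]]].
exists (fun x v => (f x : R) * (t0 x v : R)), (fun x v => (f x : R) * (t1 x v : R)),
  (fun x v => (f x : R) * (t2 x v : R)), (fun x v => (f x : R) * (t3 x v : R)); split.
  by split; exact: functional_scale.
split.
- by move=> h x v Ux; rewrite z1 // mulr0.
- by move=> h x v Ux; rewrite z2 // mulr0.
- by move=> h x v Ux; rewrite z3 // mulr0.
move=> W s x oW WU ss Wx; rewrite (qE W s x) //.
by rewrite /pairing !mulrDr.
Qed.

Lemma tensorial_opp k q : tensorial k q -> tensorial k (fun s x => - q s x : R^o).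
Proof.
move=> tq; apply: tensorial_congr (tensorial_mul (smooth_fun_cst (-1) oU) tq).
by move=> W s x _ _ _ _; rewrite mulN1r.
Qed.

Lemma tensorial_sub k q r : tensorial k q -> tensorial k r ->
  tensorial k (fun s x => q s x - r s x : R^o).
Proof. by move=> tq tr; exact: tensorial_add tq (tensorial_opp tr). Qed.

Lemma tensorial0 t : functional U t -> tensorial 0 (fun s x => t x (s.1.1.1 x)).
Proof.
move=> ft; exists t, (fun x _ => 0), (fun x _ => 0), (fun x _ => 0); split.
  by split => //; exact: functional0.
by split => // W s x _ _ _ _; rewrite /pairing !addr0.
Qed.

Lemma tensorial1 t : functional U t -> tensorial 1 (fun s x => t x (s.1.1.2 x)).
Proof.
move=> ft; exists (fun x _ => 0), t, (fun x _ => 0), (fun x _ => 0); split.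
  by split => //; exact: functional0.
by split => // W s x _ _ _ _; rewrite /pairing !addr0 add0r.
Qed.

Lemma tensorial2 t : functional U t -> tensorial 2 (fun s x => t x (s.1.2 x)).
Proof.
move=> ft; exists (fun x _ => 0), (fun x _ => 0), t, (fun x _ => 0); split.
  by split => //; exact: functional0.
by split => // W s x _ _ _ _; rewrite /pairing !addr0 !add0r.
Qed.

Lemma tensorial3 t : functional U t -> tensorial 3 (fun s x => t x (s.2 x)).
Proof.
move=> ft; exists (fun x _ => 0), (fun x _ => 0), (fun x _ => 0), t; split.
  by split => //; exact: functional0.
by split => // W s x _ _ _ _; rewrite /pairing !add0r.
Qed.

Lemma tensorial_smooth k q W s : tensorial k q -> open W -> W `<=` U ->
  solution W s -> smooth_fun W (q s).
Proof.
move=> [t0 [t1 [t2 [t3 [[f0 f1 f2 f3] [z1 z2 z3 qE]]]]]] oW WU ss.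
have [[s0 s1 s2 s3] _] := ss.
have [[_ g0] [_ g1] [_ g2] [_ g3]] := And4 f0 f1 f2 f3.
apply: (@smooth_fun_congr _ _ _ (pairing t0 t1 t2 t3 s)) => //.
  by move=> x Wx; rewrite -(qE W).
apply: (smooth_fun_add oW _ (g3 _ _ oW WU s3)).
apply: (smooth_fun_add oW _ (g2 _ _ oW WU s2)).
exact: (smooth_fun_add oW (g0 _ _ oW WU s0) (g1 _ _ oW WU s1)).
Qed.

Lemma solution_sub W W' s : open W -> open W' -> W' `<=` W -> solution W s -> solution W' s.
Proof.
move=> oW oW' WW [[s0 s1 s2 s3] eqs]; split; last by move=> x /WW; exact: eqs.
have [[r0 _ _] [r1 _ _] [r2 _ _] [r3 _ _]] := And4 vE vK vK' vK''.
by split; [exact: r0 s0|exact: r1 s1|exact: r2 s2|exact: r3 s3].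
Qed.

Lemma functional_L t : functional U t -> functional U (fun x v => t x (Lapp v)).
Proof.
move=> ft; apply: (@functional_comp _ _ _ E (LamH C (sub_bundle K)) (fun x v => Lapp v)) => //.
  by move=> x _ a u v; rewrite /Lapp linearP.
by move=> W s oW WU ss; apply: (hL oW (@subsetT _ _) ss).
Qed.

Lemma functional_M0 t : functional U t -> functional U (fun x v => t x (Mapp v 0)).
Proof.
move=> ft; apply: (@functional_comp _ _ _ E (LamH C (sub_bundle K')) (fun x v => Mapp v 0)) => //.
  move=> x _ a u v; rewrite /Mapp -linearP; congr (_ (_, _)).
  by rewrite /= scaler0 addr0.
move=> W s oW WU ss.
apply: (@hM W (fun x => (s x, 0 : fib (sub_bundle K) x)) oW (@subsetT _ _)).
by split => //; exact: vb_zero.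
Qed.

Lemma functional_M1 t : functional U t -> functional U (fun x m => t x (Mapp 0 m)).
Proof.
move=> ft.
apply: (@functional_comp _ _ _ (sub_bundle K) (LamH C (sub_bundle K')) (fun x m => Mapp 0 m)) => //.
  move=> x _ a u v; rewrite /Mapp -linearP; congr (_ (_, _)).
  by rewrite /= scaler0 addr0.
move=> W s oW WU ss.
apply: (@hM W (fun x => (0 : fib E x, s x)) oW (@subsetT _ _)).
by split => //; exact: vb_zero.
Qed.

Lemma MappE x v m : Mapp v m = Mapp v 0 + Mapp (0 : fib E x) m.
Proof.
rewrite /Mapp -linearD; congr (_ (_, _)); first by rewrite /= addr0.
by rewrite /= add0r.
Qed.

Section AlongField.
Variable X : section HB.
Hypothesis sX : smooth_sec U X.

(** The pattern for [sigma], [mu] and [rho]: [conn_functional] turns the derivative into a covariant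
    one, and the field equation replaces that by the next field. What is left, including the terms
    in [L] and [M], is of the order already present. *)
Lemma deriv_sigma t : functional U t -> exists2 r, tensorial 0 r &
  forall W s x, open W -> W `<=` U -> solution W s -> W x ->
    Hderiv X (fun y => t y (s.1.1.1 y)) x = t x (ev (vsval (s.1.1.2 x)) (X x)) + r s x.
Proof.
move=> ft; have [eta feta etaE] := conn_functional oU sX vE fE (partial_connection_local nE U) ft.
exists (fun s x => eta x (s.1.1.1 x)); first exact: tensorial0.
move=> W s x oW WU ss Wx; have [[s0 _ _ _] /(_ x Wx)[e0 _ _]] := ss.
by rewrite (etaE W _ x oW WU s0 Wx) e0.
Qed.

Lemma deriv_mu t : functional U t -> exists2 r, tensorial 1 r &
  forall W s x, open W -> W `<=` U -> solution W s -> W x ->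
    Hderiv X (fun y => t y (s.1.1.2 y)) x = t x (ev (vsval (s.1.2 x)) (X x)) + r s x.
Proof.
move=> ft; have [eta feta etaE] := conn_functional oU sX vK fK (partial_connection_local nK U) ft.
have [t1 _] := ft.
have fLX := functional_L (functional_ev oU sX ft).
exists (fun s x => eta x (s.1.1.2 x) - t x (ev (Lapp (s.1.1.1 x)) (X x))).
  apply: tensorial_sub; first exact: tensorial1.
  exact: tensorial_leq (tensorial0 fLX).
move=> W s x oW WU ss Wx; have [[_ s1 _ _] /(_ x Wx)[_ e1 _]] := ss.
rewrite (etaE W _ x oW WU s1 Wx) e1 (linB (@ev_linear_l _ _ _ _ _ _)).
by rewrite (linB (t1 x (WU _ Wx))) -addrA [- _ + _]addrC.
Qed.

Lemma deriv_rho t : functional U t -> exists2 r, tensorial 2 r &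
  forall W s x, open W -> W `<=` U -> solution W s -> W x ->
    Hderiv X (fun y => t y (s.1.2 y)) x = t x (ev (vsval (s.2 x)) (X x)) + r s x.
Proof.
move=> ft; have [eta feta etaE] := conn_functional oU sX vK' fK' (partial_connection_local nK' U) ft.
have [t1 _] := ft; have fX := functional_ev oU sX ft.
exists (fun s x => eta x (s.1.2 x) - (t x (ev (Mapp (s.1.1.1 x) 0) (X x)) +
   t x (ev (Mapp 0 (s.1.1.2 x)) (X x)))).
  apply: tensorial_sub; first exact: tensorial2.
  apply: tensorial_add; first exact: tensorial_leq (tensorial0 (functional_M0 fX)).
  exact: tensorial_leq (tensorial1 (functional_M1 fX)).
move=> W s x oW WU ss Wx; have [[_ _ s2 _] /(_ x Wx)[_ _ e2]] := ss.
rewrite (etaE W _ x oW WU s2 Wx) e2 (linB (@ev_linear_l _ _ _ _ _ _)).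
rewrite (linB (t1 x (WU _ Wx))) MappE (linD (@ev_linear_l _ _ _ _ _ _)).
by rewrite (linD (t1 x (WU _ Wx))) -addrA [- _ + _]addrC.
Qed.

(** No equation governs [tau], so the covariant derivative stays in the formula, for an arbitrary
    auxiliary connection. *)
Lemma deriv_tau nab t : local_conn U nab -> functional U t -> exists2 r, tensorial 3 r &
  forall W s x, open W -> W `<=` U -> solution W s -> W x ->
    Hderiv X (fun y => t y (s.2 y)) x = t x (ev (nab s.2 x) (X x)) + r s x.
Proof.
move=> cn ft; have [eta feta etaE] := conn_functional oU sX vK'' fK'' cn ft.
exists (fun s x => eta x (s.2 x)); first exact: tensorial3.
move=> W s x oW WU ss Wx; have [[_ _ _ s3] _] := ss.
by rewrite (etaE W _ x oW WU s3 Wx).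
Qed.

Lemma tensorial_ev k V (KV : forall x, {vspace fib (LamH C V) x})
    (f : forall s, section (sub_bundle KV)) t :
  (forall t, functional U t -> tensorial k (fun s x => t x (f s x))) ->
  functional U t -> tensorial k (fun s x => t x (ev (vsval (f s x)) (X x))).
Proof.
move=> H ft; exact: (H (fun x m => t x (ev (vsval m) (X x)))
  (functional_sub_val KV (functional_ev oU sX ft))).
Qed.

(** Below order 3 the field [tau] is absent, so the field equations cover every derivative that
    occurs. A coefficient required to vanish at order [k] contributes the derivative of zero, which
    keeps the order from rising by more than one. *)
Lemma tensorial_deriv k q : (k < 3)%N -> tensorial k q ->
  tensorial k.+1 (fun s => Hderiv X (q s)).
Proof.
move=> k3 tq; have [t0 [t1 [t2 [t3 [[f0 f1 f2 f3] [z1 z2 z3 qE]]]]]] := tq.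
have [r0 tr0 r0E] := deriv_sigma f0; have [r1 tr1 r1E] := deriv_mu f1.
have [r2 tr2 r2E] := deriv_rho f2.
have d0 : tensorial k.+1 (fun s => Hderiv X (fun y => t0 y (s.1.1.1 y))).
  apply: (@tensorial_congr _ (fun s x => t0 x (ev (vsval (s.1.1.2 x)) (X x)) + r0 s x)).
    by move=> W s x oW WU ss Wx; rewrite (r0E W).
  apply: tensorial_add; last exact: tensorial_leq tr0.
  apply: (@tensorial_leq 1) => //.
  exact: (tensorial_ev (f := fun s => s.1.1.2) tensorial1 f0).
have zero l : tensorial l (fun s x => 0 : R^o).
  apply: (@tensorial_leq 0) => //; have t00 := tensorial0 (functional0 U E).
  by apply: tensorial_congr t00.
have d1 : tensorial k.+1 (fun s => Hderiv X (fun y => t1 y (s.1.1.2 y))).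
  case: (ltnP k 1) => k1.
    apply: tensorial_congr (zero _) => W s x oW WU ss Wx.
    rewrite -[LHS](dir_cst 0 x (vsval (X x))); apply: (dir_congr _ oW Wx) => y Wy.
    by rewrite z1 //; exact: WU.
  apply: (@tensorial_congr _ (fun s x => t1 x (ev (vsval (s.1.2 x)) (X x)) + r1 s x)).
    by move=> W s x oW WU ss Wx; rewrite (r1E W).
  apply: tensorial_add; last exact: tensorial_leq tr1.
  apply: (@tensorial_leq 2) => //.
  exact: (tensorial_ev (f := fun s => s.1.2) tensorial2 f1).
have d2 : tensorial k.+1 (fun s => Hderiv X (fun y => t2 y (s.1.2 y))).
  case: (ltnP k 2) => k2.
    apply: tensorial_congr (zero _) => W s x oW WU ss Wx.
    rewrite -[LHS](dir_cst 0 x (vsval (X x))); apply: (dir_congr _ oW Wx) => y Wy.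
    by rewrite z2 //; exact: WU.
  apply: (@tensorial_congr _ (fun s x => t2 x (ev (vsval (s.2 x)) (X x)) + r2 s x)).
    by move=> W s x oW WU ss Wx; rewrite (r2E W).
  apply: tensorial_add; last exact: tensorial_leq (leqW k2) tr2.
  apply: (@tensorial_leq 3) => //.
  exact: (tensorial_ev (f := fun s => s.2) tensorial3 f2).
apply: tensorial_congr (tensorial_add (tensorial_add d0 d1) d2) => W s x oW WU ss Wx.
have [[s0 s1 s2 s3] _] := ss.
have [[_ g0] [_ g1] [_ g2]] := And3 f0 f1 f2.
have m0 := g0 _ _ oW WU s0; have m1 := g1 _ _ oW WU s1; have m2 := g2 _ _ oW WU s2.
rewrite /Hderiv -(dir_add _ oW Wx m0 m1) -(dir_add _ oW Wx (smooth_fun_add oW m0 m1) m2).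
apply: (dir_congr _ oW Wx) => y Wy; rewrite (qE W) // /pairing z3 ?addr0 //.
exact: WU.
Qed.

End AlongField.
End SolutionQuantities.

(** Here [n] is the derivative of [tau], [r] its obstructions and [g] their generalised inverse. The
    obstructions split into a part [t] depending on [tau], absorbed into the connection as [A], and
    a part [u] depending on the other fields, which becomes [N]. *)
Lemma subtract_defect (K : fieldType) (V : vectType K) (Z : {vspace V}) (J : finType)
    (n A N : V) (g : J -> V) (r t u : J -> K) :
  n - \sum_j r j *: g j \in Z -> (forall j, r j = t j + u j) ->
  A = \sum_j t j *: (-1 *: g j) -> N = \sum_j u j *: (-1 *: g j) -> n + A + N \in Z.
Proof.
move=> nZ rE -> ->; rewrite -addrA -big_split /=.
suff -> : \sum_j (t j *: (-1 *: g j) + u j *: (-1 *: g j)) = - \sum_j r j *: g j by [].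
rewrite -sumrN; apply: eq_bigr => j _.
by rewrite -scalerDl scaleN1r scalerN rE.
Qed.

(** * Local prolongation *)

Lemma isolate_bracket (K : comRingType) (p q u v ra rb rc rd c yp yq yu yv : K) :
  yp = p + ra -> yq = q + rb -> yu = u + rc -> yv = v + rd ->
  yp - yq - (yu - yv) = c -> c - (ra - rb - rc + rd) = p - q - u + v.
Proof. by move=> -> -> -> -> <-; ring. Qed.

Section Perturbation.
Variables (R : realType) (M : manifold3 R) (C : contact M).
Local Notation HB := (sub_bundle (distr C)).

Lemma functional_hom (A B : bundle M) (O : set M) (J : finType)
    (t : J -> forall x, fib A x -> R^o) (g : J -> section B) :
  vbundle B -> (forall j, functional O (t j)) -> (forall j, smooth_sec O (g j)) -> open O ->
  @smooth_sec R M (hom_bundle A B) O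
     (fun x => linfun (fun v => \sum_j (t j x v : R) *: g j x)) /\
  forall x v, O x -> (linfun (fun v => \sum_j (t j x v : R) *: g j x) : 'Hom(fib A x, fib B x)) v =
    \sum_j (t j x v : R) *: g j x.
Proof.
move=> vB ft sg oO.
have lt x : O x -> linear (fun v : fib A x => \sum_j (t j x v : R) *: g j x).
  move=> Ox; apply: linear_finsum => j k u v.
  by have [/(_ x Ox) l _] := ft j; rewrite l scalerDl scalerA.
have tE x v : O x -> (linfun (fun v => \sum_j (t j x v : R) *: g j x) : 'Hom(fib A x, fib B x)) v =
    \sum_j (t j x v : R) *: g j x by move=> /lt l; rewrite linfunE.
split=> // W s oW WO ss.
have sW : smooth_sec W ((fun x => \sum_j (t j x (s x) : R) *: g j x) : section B).
  apply: (vb_sum vB _ oW) => j; apply: (vb_scale vB oW).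
    by have [_ sm] := ft j; exact: sm oW WO ss.
  by have [rB _ _] := vB; exact: rB oO oW WO (sg j).
apply: (vb_congr vB oW _ sW) => x Wx; apply: esym; exact: tE (WO _ Wx).
Qed.

(** Connections form an affine space over such homomorphisms: the added term is linear over
    functions and leaves the Leibniz rule intact. *)
Lemma local_conn_perturb (V : bundle M) (O : set M) nab (A : section (hom_bundle V (LamH C V))) :
  vbundle V -> open O -> @local_conn R M C V O nab -> smooth_sec O A ->
  local_conn O (fun s x => nab s x + (A x : 'Hom(fib V x, fib (LamH C V) x)) (s x)).
Proof.
move=> vV oO [c1 c2 c3 c4] sA; split.
- by move=> W s t oW WO st x Wx; rewrite (c1 W s t oW WO st x Wx) st.
- move=> W s oW WO ss; exact: (vb_add (vbundle_LamH C vV) oW (c2 W s oW WO ss) (sA W s oW WO ss)).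
- move=> W s t oW WO ss st x Wx; rewrite (c3 W s t oW WO ss st x Wx) linearD.
  by rewrite addrACA.
- move=> W f s oW WO sf ss x a Wx.
  rewrite !(linD (ev_linear_l _)) (c4 W f s oW WO sf ss x a Wx) linearZ.
  by rewrite (linZ (ev_linear_l _)) scalerDr addrAC.
Qed.

Lemma basis_spans2 (h : 'I_2 -> section HB) x :
  basis_of (distr C x) [seq vsval (h j x) | j <- enum 'I_2] ->
  spans2 (h 0 x) (h 1 x) /\ h 0 x != 0.
Proof.
move=> bh; have [b1 b2 b3] := basis_expansion bh; split.
  move=> v; have [a va] := b2 _ (subvsP v).
  exists (a 0 0), (a 0 1); apply: val_inj.
  change (vsval v = vsval (a 0 0 *: h 0 x + a 0 1 *: h 1 x)).
  by rewrite linearD !linearZ /= va sum2.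
apply/eqP => h0; have v0 : vsval (h 0 x) = 0 by rewrite h0 linear0.
have : \sum_j (delta_mx 0 0 : 'rV[R]_2) 0 j *: vsval (h j x) = 0.
  by rewrite sum2 !mxE /= v0 scaler0 scale0r addr0.
move=> /b3 /rowP /(_ 0); rewrite !mxE /= => /eqP.
by rewrite oner_eq0.
Qed.

End Perturbation.

Section LocalProlongation.
Variables (R : realType) (M : manifold3 R) (C : contact M) (E : bundle M)
  (K : forall x : M, {vspace fib (LamH C E) x})
  (K' : forall x : M, {vspace fib (LamH C (sub_bundle K)) x})
  (K'' : forall x : M, {vspace fib (LamH C (sub_bundle K')) x})
  (nE : partial_connection C E)
  (nK : partial_connection C (sub_bundle K))
  (nK' : partial_connection C (sub_bundle K'))
  (L : section (hom_bundle E (LamH C (sub_bundle K))))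
  (Mh : section (hom_bundle (sum_bundle E (sub_bundle K)) (LamH C (sub_bundle K')))).
Hypotheses (vE : vbundle E) (vK : vbundle (sub_bundle K))
  (vK' : vbundle (sub_bundle K')) (vK'' : vbundle (sub_bundle K''))
  (hL : smooth_hom L) (hM : smooth_hom Mh).
Local Notation HB := (sub_bundle (distr C)).
Local Notation sol := (@solution R M C E K K' K'' nE nK nK' L Mh).

Lemma Hderiv_sub (Z : section HB) W (f g : M -> R^o) x : open W -> W x ->
  smooth_fun W f -> smooth_fun W g ->
  Hderiv Z (fun y => f y - g y : R^o) x = Hderiv Z f x - Hderiv Z g x.
Proof.
move=> oW Wx sf sg; rewrite /Hderiv (dir_add _ oW Wx sf (smooth_fun_opp oW sg)).
by rewrite (dir_opp _ oW Wx sg).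
Qed.

Section OnOpenSet.
Variable U : set M.
Hypothesis oU : open U.
Hypotheses (fE : framed E U) (fK : framed (sub_bundle K) U)
  (fK' : framed (sub_bundle K') U) (fK'' : framed (sub_bundle K'') U).
Variable nab : section (sub_bundle K'') -> section (LamH C (sub_bundle K'')).
Hypothesis cn : local_conn U nab.
Local Notation tens := (@tensorial R M C E K K' K'' nE nK nK' L Mh U).
Implicit Types (W : set M) (x : M) (s : @fields R M C E K K' K'').

Lemma tens_deriv (Z : section HB) k q : smooth_sec U Z -> (k < 3)%N -> tens k q ->
  tens k.+1 (fun s => Hderiv Z (q s)).
Proof.
move=> sZ k3 tq; exact: (tensorial_deriv vE vK vK' hL hM oU fE fK fK' sZ k3 tq).
Qed.

Section Derivatives.
Variables (t : forall x, fib E x -> R^o) (Z1 Z2 Z3 Z4 : section HB).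
Hypotheses (ft : functional U t) (s1 : smooth_sec U Z1) (s2 : smooth_sec U Z2)
  (s3 : smooth_sec U Z3) (s4 : smooth_sec U Z4).

Definition mu_comp (s : fields K'') : M -> R^o := fun y => t (ev (vsval (s.1.1.2 y)) (Z4 y)).

Lemma functional_mu : functional U (fun x (m : fib (sub_bundle K) x) => t (ev (vsval m) (Z4 x))).
Proof. exact: (functional_sub_val K (functional_ev oU s4 ft)). Qed.

Lemma tens_mu_comp : tens 1 mu_comp.
Proof. exact: tensorial1 functional_mu. Qed.

Lemma functional_full4 : functional U
  (fun x (T : fib (LamH C (sub_bundle K'')) x) => t (full_ev4 T (Z1 x) (Z2 x) (Z3 x) (Z4 x))).
Proof.
have f2 := functional_sub_val K' (functional_ev oU s3 functional_mu).
exact: (functional_ev oU s1 (functional_sub_val K'' (functional_ev oU s2 f2))).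
Qed.

(** The derivatives along [Z3], [Z2], [Z1] reach [rho], [tau] and the derivative of [tau] in turn,
    each supplying the slot in front of the previous one. The remainder of the first step has order
    1 and is differentiated twice, that of the second has order 2 and is differentiated once, so all
    stay within order 3. *)
Lemma third_derivative : exists2 r, tens 3 r &
  forall W s x, open W -> W `<=` U -> sol W s -> W x ->
    Hderiv Z1 (Hderiv Z2 (Hderiv Z3 (mu_comp s))) x =
    t (full_ev4 (nab s.2 x) (Z1 x) (Z2 x) (Z3 x) (Z4 x)) + r s x.
Proof.
have [r1 tr1 r1E] := deriv_mu K'' nE nK nK' Mh vK hL oU fK s3 functional_mu.
have f2 := functional_sub_val K' (functional_ev oU s3 functional_mu).
have [r2 tr2 r2E] := deriv_rho K'' nE nK nK' L vE vK vK' hM oU fK' s2 f2.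
have f3 := functional_sub_val K'' (functional_ev oU s2 f2).
have [r3 tr3 r3E] := deriv_tau nE nK nK' L Mh vK'' oU fK'' s1 cn f3.
have tq := tensorial_add tr2 (tens_deriv (k := 1) s2 isT tr1).
exists (fun s x => r3 s x + Hderiv Z1 (fun y => r2 s y + Hderiv Z2 (r1 s) y : R^o) x).
  exact: tensorial_add tr3 (tens_deriv (k := 2) s1 isT tq).
move=> W s x oW WU ss Wx.
have [r0 _ _] := vbundle_H C.
have sW2 : smooth_sec W Z2 by exact: r0 s2.
have m3 k' q (tq' : tens k' q) : smooth_fun W (q s) := tensorial_smooth tq' oW WU ss.
have a1 y : W y -> Hderiv Z2 (Hderiv Z3 (mu_comp s)) y =
    t (ev (vsval (ev (vsval (ev (vsval (s.2 y)) (Z2 y))) (Z3 y))) (Z4 y)) +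
    (r2 s y + Hderiv Z2 (r1 s) y).
  move=> Wy; rewrite (@Hderiv_congr _ _ _ W Z2 _
    (fun y => t (ev (vsval (ev (vsval (s.1.2 y)) (Z3 y))) (Z4 y)) + r1 s y)) //.
    rewrite [LHS](dir_add _ oW Wy (m3 _ _ (tensorial2 _ _ _ _ _ _ f2)) (m3 _ _ tr1)).
    by rewrite -[dir _ y _]/(Hderiv Z2
        (fun y => t (ev (vsval (ev (vsval (s.1.2 y)) (Z3 y))) (Z4 y))) y) (r2E W) // addrA.
  by move=> z Wz; exact: (r1E W).
rewrite (Hderiv_congr _ oW Wx a1).
rewrite [LHS](dir_add _ oW Wx (m3 _ _ (tensorial3 _ _ _ _ _ f3)) (m3 _ _ tq)).
by rewrite -[dir (fun y => t _) x _]/(Hderiv Z1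
  (fun y => t (ev (vsval (ev (vsval (ev (vsval (s.2 y)) (Z2 y))) (Z3 y))) (Z4 y))) x) (r3E W) // -addrA.
Qed.

End Derivatives.

Section Bracket.
Variables (X : 'I_2 -> section HB) (a b d : 'I_2 -> M -> R^o).
Hypotheses (sX : forall j, smooth_sec U (X j))
  (sabd : forall j, [/\ smooth_fun U (a j), smooth_fun U (b j) & smooth_fun U (d j)])
  (comm : forall j W f x, open W -> W `<=` U -> smooth_fun W f -> W x ->
    Hderiv (X j) (Treeb (X 0) (X 1) f) x - Treeb (X 0) (X 1) (Hderiv (X j) f) x =
    a j x * Hderiv (X 0) f x + b j x * Hderiv (X 1) f x + d j x * Treeb (X 0) (X 1) f x).
Variable t : forall x, fib E x -> R^o.
Hypothesis ft : functional U t.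

Definition tree_bracket j k x (T : fib (LamH C (sub_bundle K'')) x) : fib E x :=
  bracket3 (fun u v w => full_ev4 T u v w (X k x)) (X j x) (X 0 x) (X 1 x).

Lemma tree_bracketE j k x (T : fib (LamH C (sub_bundle K'')) x) : U x ->
  t (tree_bracket j k T) =
  bracket3 (fun u v w => t (full_ev4 T u v w (X k x)) : R^o) (X j x) (X 0 x) (X 1 x).
Proof. by move=> Ux; rewrite bracket3_comp //; have [l _] := ft; exact: l. Qed.

Lemma functional_congr V (p q : forall x, fib V x -> R^o) :
  (forall x v, U x -> p x v = q x v) -> functional U p -> functional U q.
Proof.
move=> pq [l sm]; split.
  by move=> x Ux k u v; rewrite -!pq //; exact: l.
move=> W s oW WU ss; apply: (smooth_fun_congr oW _ (sm W s oW WU ss)) => x Wx.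
by rewrite pq //; exact: WU.
Qed.

Lemma functional_tree j k : functional U (fun x T => t (@tree_bracket j k x T)).
Proof.
have F := fun Z1 Z2 Z3 => functional_full4 ft (sX Z1) (sX Z2) (sX Z3) (sX k).
have N p (fp : @functional R M (LamH C (sub_bundle K'')) U p) := functional_scale (smooth_fun_cst (-1) oU) fp.
apply: functional_congr (functional_add (functional_add (functional_add
  (F j 0 1) (N _ (F j 1 0))) (N _ (F 0 1 j))) (F 1 0 j)).
by move=> x T Ux; rewrite tree_bracketE // /bracket3 !mulN1r.
Qed.

(* Both sides of the contact commutation relation are applied to the component
   of mu along X k: on solutions the left side is the bracket of the symbol of
   nab tau plus tensorial terms, the right side is tensorial. *)
Lemma tens_bracket j k : tens 3 (fun s x => t (@tree_bracket j k x (nab s.2 x))).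
Proof.
have D Z1 Z2 Z3 := third_derivative ft (sX Z1) (sX Z2) (sX Z3) (sX k).
have [ra tra raE] := D j 0 1; have [rb trb rbE] := D j 1 0.
have [rc trc rcE] := D 0 1 j; have [rd trd rdE] := D 1 0 j.
have t1 : tens 1 (mu_comp t (X k)) := tens_mu_comp ft (sX k).
have t2 i : tens 2 (fun s => Hderiv (X i) (mu_comp t (X k) s)) := tens_deriv (k := 1) (sX i) isT t1.
have t3 i l : tens 3 (fun s => Hderiv (X i) (Hderiv (X l) (mu_comp t (X k) s))) :=
  tens_deriv (k := 2) (sX i) isT (t2 l).
have tT : tens 3 (fun s => Treeb (X 0) (X 1) (mu_comp t (X k) s)).
  exact: tensorial_sub (t3 0 1) (t3 1 0).
have [sa sb sd] := sabd j.
have tl := tensorial_add (tensorial_add (tensorial_mul sa (tensorial_leq (isT : (2 <= 3)%N) (t2 0)))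
  (tensorial_mul sb (tensorial_leq (isT : (2 <= 3)%N) (t2 1)))) (tensorial_mul sd tT).
have tr := tensorial_sub oU tl (tensorial_add (tensorial_sub oU (tensorial_sub oU tra trb) trc) trd).
apply: (tensorial_congr _ tr).
move=> W s x oW WU ss Wx; have Ux := WU _ Wx.
have [r0 _ _] := vbundle_H C.
have sW i : smooth_sec W (X i) by exact: r0 (sX i).
have m3 k' q (tq' : tens k' q) : smooth_fun W (q s) := tensorial_smooth tq' oW WU ss.
rewrite tree_bracketE // /bracket3.
have := comm j oW WU (m3 _ _ t1) Wx.
rewrite [Treeb _ _ (Hderiv _ _) x]/Treeb.
rewrite (Hderiv_sub (X j) oW Wx (m3 _ _ (t3 0 1)) (m3 _ _ (t3 1 0))).
exact: isolate_bracket (raE W s x oW WU ss Wx) (rbE W s x oW WU ss Wx)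
  (rcE W s x oW WU ss Wx) (rdE W s x oW WU ss Wx).
Qed.

End Bracket.
End OnOpenSet.

Variable K''' : forall x : M, {vspace fib (LamH C (sub_bundle K'')) x}.
Hypotheses (hK'' : is_K2 K'') (hK3 : is_K3 K''') (sK3 : is_subbundle K''').

Lemma local_prolongation (p : M) : exists U
    (nab : section (sub_bundle K'') -> section (LamH C (sub_bundle K'')))
    (N : section (hom_bundle (sum_bundle (sum_bundle E (sub_bundle K)) (sub_bundle K'))
                             (LamH C (sub_bundle K'')))),
  [/\ open U, U p, local_conn U nab, smooth_sec U N &
    forall W (s : fields K'') x, open W -> W `<=` U -> sol W s -> W x ->
      nab s.2 x + (N x : 'Hom(fib (sum_bundle (sum_bundle E (sub_bundle K)) (sub_bundle K')) x,
                              fib (LamH C (sub_bundle K'')) x))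
                    (s.1.1.1 x, s.1.1.2 x, s.1.2 x) \in K''' x].
Proof.
have vL := vbundle_LamH C vK''.
have [U0 [X [a [b [d [oU0 U0p sX bX [sabd comm]]]]]]] := contact_commutator C p.
have [_ _ /(_ p)[U1 [oU1 U1p fr1]]] := vE; have [_ _ /(_ p)[U2 [oU2 U2p fr2]]] := vK.
have [_ _ /(_ p)[U3 [oU3 U3p fr3]]] := vK'; have [_ _ /(_ p)[U4 [oU4 U4p fr4]]] := vK''.
have [_ _ /(_ p)[U5 [oU5 U5p fr5]]] := vL.
pose U := U0 `&` (U1 `&` (U2 `&` (U3 `&` (U4 `&` U5)))).
have oU : open U by do 4 (apply: openI => //); exact: openI.
have Up : U p by [].
have UU0 : U `<=` U0 by move=> x [].
have UU1 : U `<=` U1 by move=> x [_ []].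
have UU2 : U `<=` U2 by move=> x [_ [_ []]].
have UU3 : U `<=` U3 by move=> x [_ [_ [_ []]]].
have UU4 : U `<=` U4 by move=> x [_ [_ [_ [_ []]]]].
have UU5 : U `<=` U5 by move=> x [_ [_ [_ [_ []]]]].
have {}fr1 := framed_sub UU1 fr1; have {}fr2 := framed_sub UU2 fr2.
have {}fr3 := framed_sub UU3 fr3; have {}fr4 := framed_sub UU4 fr4.
have {}fr5 := framed_sub UU5 fr5.
have [r0 _ _] := vbundle_H C.
have {}sX j : smooth_sec U (X j) := r0 _ _ _ oU0 oU UU0 (sX j).
have {}sabd j : [/\ smooth_fun U (a j), smooth_fun U (b j) & smooth_fun U (d j)].
  by have [? ? ?] := sabd j; split; exact: smooth_fun_sub UU0 _.
have {}comm j W f x : open W -> W `<=` U -> smooth_fun W f -> W x -> _ :=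
  fun oW WU => comm j W f x oW (subset_trans WU UU0).
have [nab cn] := flat_connection C vK'' oU fr4.
have [I [e [c fe]]] := fr1; have [f1 f2 f3 f4] := fe.
have fc i : functional U (c i).
  split; first by move=> x Ux; exact: f1.
  by move=> W s oW WU ss; have /f4 := ss; apply.
(* An obstruction is indexed by the outer field of the double bracket, the field in the fourth slot
   and a coordinate of [E]. *)
pose J : finType := ('I_2 * 'I_2 * I)%type.
pose r (q : J) x (T : fib (LamH C (sub_bundle K'')) x) : R^o :=
  c q.2 x (tree_bracket X q.1.1 q.1.2 T).
have fr q : functional U (r q) := functional_tree oU sX (fc q.2) q.1.1 q.1.2.
have tr q : tensorial nE nK nK' L Mh U 3 (fun s x => r q x (nab s.2 x)).
  exact: (tens_bracket oU fr1 fr2 fr3 fr4 cn sX sabd comm (fc q.2) q.1.1 q.1.2).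
have rZ x v : U x -> v \in K''' x <-> forall q, r q x v = 0.
  move=> Ux; split.
    move=> vK3 q; rewrite /r /tree_bracket (K3_bracket3 hK3 _ _ _ _ vK3).
    exact: lin0 (f1 x q.2 Ux).
  (* Frame vectors suffice: the coframe detects zero in [E], linearity extends the fourth slot to
     all of H, and [in_K3] takes care of the first three. *)
  move=> rv; have [sp h0] := basis_spans2 (bX x (UU0 _ Ux)).
  have [Lf [lf l1 l2 l12]] := contact_levi sp h0.
  have T0 j k : tree_bracket X j k v = 0.
    apply: (coframe_inj fe Ux) => i.
    by rewrite (lin0 (f1 x i Ux)); exact: (rv (j, k, i)).
  have T1 j u : bracket3 (fun a b c => full_ev4 v a b c u) (X j x) (X 0 x) (X 1 x) = 0.
    have l a' b' c' : linear (fun u => full_ev4 v a' b' c' u).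
      by move=> k' u1 u2; rewrite /full_ev4 /full_ev3 ev_linear.
    pose F u := bracket3 (fun a b c => full_ev4 v a b c u) (X j x) (X 0 x) (X 1 x).
    have lF : linear F.
      exact: linear_add (linear_sub (linear_sub (l _ _ _) (l _ _ _)) (l _ _ _)) (l _ _ _).
    exact: (lin_span2 sp lF (T0 j 0) (T0 j 1)).
  exact: (in_K3 hK'' hK3 sp lf l1 l2 l12 (T1 0) (T1 1)).
have [Q [g [oO Op OU sg gZ]]] := generalized_inverse vL sK3 oU Up fr5
  (fun q x Ux => (fr q).1 x Ux) (fun q => (fr q).2) rZ.
(* The functionals expressing each obstruction along solutions are fixed once for all; the
   corrections are built from them and not from the solutions. *)
have /choice[th thP] : forall q, exists t : (forall x, fib E x -> R^o) *
    (forall x, fib (sub_bundle K) x -> R^o) * (forall x, fib (sub_bundle K') x -> R^o) *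
    (forall x, fib (sub_bundle K'') x -> R^o),
    [/\ functional Q t.1.1.1, functional Q t.1.1.2, functional Q t.1.2 & functional Q t.2] /\
    forall W (s : fields K'') x, open W -> W `<=` U -> sol W s -> W x ->
      r q x (nab s.2 x) = pairing t.1.1.1 t.1.1.2 t.1.2 t.2 s x.
  move=> q; have [t0 [t1 [t2 [t3 [[g0 g1 g2 g3] [_ _ _ tE]]]]]] := tr q.
  by exists (t0, t1, t2, t3); split => //; split; exact: functional_sub OU _.
pose S := sum_bundle (sum_bundle E (sub_bundle K)) (sub_bundle K').
(* The part in [sigma], [mu], [rho], destined for [N]; the remaining functional of [tau] corrects
   the connection. *)
pose t012 q x (v : fib S x) : R^o :=
  (th q).1.1.1 x v.1.1 + (th q).1.1.2 x v.1.2 + (th q).1.2 x v.2.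
have f012 q : functional Q (t012 q).
  have [[g0 g1 g2 _] _] := thP q.
  apply: functional_add.
    apply: functional_add.
      apply: (@functional_comp _ _ _ S E (fun x v => v.1.1)) => //.
      by move=> W s oW WO [[]].
    apply: (@functional_comp _ _ _ S (sub_bundle K) (fun x v => v.1.2)) => //.
    by move=> W s oW WO [[]].
  apply: (@functional_comp _ _ _ S (sub_bundle K') (fun x v => v.2)) => //.
  by move=> W s oW WO [].
have f3' q : functional Q (th q).2 by have [[]] := thP q.
have sng q : smooth_sec Q ((fun x => (-1 : R) *: g q x) : section (LamH C (sub_bundle K''))).
  exact: (@vb_scale _ _ _ vL Q (fun _ => -1) (g q) oO (smooth_fun_cst (-1) oO) (sg q)).
have [sN NE] := functional_hom vL f012 sng oO.
have [sA AE] := functional_hom vL f3' sng oO.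
have cnO := local_conn_perturb vK'' oO (local_conn_sub OU cn) sA.
exists Q; eexists; eexists; split; [exact: oO|exact: Op|exact: cnO|exact: sN|].
move=> W s x oW WO ss Wx; have Ox := WO _ Wx.
apply: (subtract_defect (gZ x (nab s.2 x) Ox) _ (AE x (s.2 x) Ox)
  (NE x (s.1.1.1 x, s.1.1.2 x, s.1.2 x) Ox)) => q.
have [_ /(_ W s x oW (subset_trans WO OU) ss Wx) E1] := thP q.
exact: etrans E1 (addrC _ _).
Qed.

End LocalProlongation.

(** * Partitions of unity and gluing *)

(** Each [x] lies in a basic set contained in [V x], and for every code of a basic set contained in
    some [V q] one such [q] is selected. *)
Lemma lindelof (T : topologicalType) (V : T -> set T) (p0 : T) :
  @second_countable T -> (forall x, open (V x) /\ V x x) ->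
  exists p : nat -> T, forall x, exists n, V (p n) x.
Proof.
move=> [B /countable_injP[f fB] [_ bB]] oV.
pose Q n p := exists2 b, B b /\ f b = n & b `<=` V p.
have /choice[p pP] : forall n, exists p, (exists q, Q n q) -> Q n p.
  (* For codes without such a point the value is the default [p0]. *)
  move=> n; have [[q Qq]|nQ] := pselect (exists q, Q n q); first by exists q.
  by exists p0.
exists p => x; have [b [Bb bx] bV] := bB x _ (open_nbhs_nbhs (oV x)).
have : Q (f b) (p (f b)) by apply: pP; exists x, b.
move=> [b' [Bb' fb'] b'V]; exists (f b); apply: b'V.
by rewrite (fB _ _ _ _ fb') // inE.
Qed.

Section Partition.
Variables (R : realType) (M : manifold3 R).

(** In a chart the function is [flat 0] of a squared radius minus the squared Euclidean distance to
    [p], extended by zero. Its support lies in the image of a compact box, which is closed because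
    [M] is Hausdorff; this makes the extension smooth. *)
Lemma bump (U : set M) (p : M) : open U -> U p ->
  exists (f : M -> R^o) (F : set M), [/\ smooth_fun setT f, forall x, 0 <= f x & 0 < f p] /\
    [/\ closed F, F `<=` U & forall x, ~ F x -> f x = 0].
Proof.
move=> oU Up; pose c := chart_at p; have dp := chart_at_dom p.
have oi := open_chart_image (i := c) oU.
have ip : (cmap c @` (U `&` cdom c)) (cmap c p) by exists p.
have /nbhs_ballP[e /= e0 eB] := open_nbhs_nbhs (conj oi ip).
(* Halving the radius puts the closed box inside the open ball of radius [e] for the maximum
   norm. *)
pose r := e / 2; have r0 : 0 < r by rewrite divr_gt0.
pose I k : set R := [set` `[cmap c p 0 k - r, cmap c p 0 k + r]].
pose box : set 'rV[R]_3 := [set y | forall k, I k (y ord0 k)].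
have cbox : compact box by apply: (@rV_compact R 3 I) => k; exact: segment_compact.
have boxU : box `<=` cmap c @` (U `&` cdom c).
  move=> y yb; apply: eB; split => // i k; rewrite (ord1 i) /ball /= distrC.
  have re : r < e by rewrite /r ltr_pdivrMr // ltr_pMr // ltr1n.
  apply: le_lt_trans re; rewrite ler_distl.
  by have := yb k; rewrite /I /= in_itv.
pose F := cinv c @` box.
have FU : F `<=` U `&` cdom c.
  move=> _ [y yb <-]; have [z [Uz dz] <-] := boxU _ yb.
  by rewrite cmapK.
have clF : closed F.
  apply: compact_closed; first exact: manifold_hausdorff.
  apply: continuous_compact => //; apply: continuous_in_subspaceT => y /set_mem yb.
  apply: cinv_continuous; have [z [_ dz] <-] := boxU _ yb.
  by exists z.
pose q x : R^o := \sum_k (cmap c x 0 k - cmap c p 0 k) ^+ 2.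
pose h x : R^o := flat 0 (r ^+ 2 - q x).
pose f x : R^o := if x \in cdom c then h x else 0.
have fF x : ~ F x -> f x = 0.
  move=> nF; rewrite /f; case: ifPn => // /set_mem dx.
  apply: flat_npos; rewrite subr_le0 leNgt; apply/negP => qr; apply: nF.
  exists (cmap c x); last by rewrite cmapK.
  move=> k; rewrite /I /= in_itv /=.
  have : (cmap c x 0 k - cmap c p 0 k) ^+ 2 <= r ^+ 2.
    apply/ltW/le_lt_trans/qr; rewrite /q (bigD1 k) //= lerDl.
    by apply: sumr_ge0 => i _; exact: sqr_ge0.
  rewrite -[X in X <= _]real_normK ?num_real // ler_sqr ?nnegrE ?normr_ge0 ?(ltW r0) //.
  by rewrite ler_distl.
have oc : open (cdom c) by exact: cdom_open.
have sh : smooth_fun (cdom c) h.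
  apply: (smooth_fun_flat _ oc); apply: (smooth_fun_add oc (smooth_fun_cst _ oc)).
  apply: (smooth_fun_opp oc); apply: (smooth_fun_sum _ oc) => k _.
  have s1 : smooth_fun (cdom c) (fun x => cmap c x 0 k - cmap c p 0 k : R^o).
    exact: (smooth_fun_add oc (@smooth_fun_coord R M c k) (smooth_fun_cst (- cmap c p 0 k) oc)).
  by apply: (smooth_fun_congr oc _ (smooth_fun_mul oc s1 s1)) => x _; rewrite expr2.
exists f, F; split; last by split=> // x /FU[].
split.
- apply: smooth_fun_glue => x _; have [Fx|nF] := pselect (F x).
    exists (cdom c); split; [exact: oc|by have [] := FU _ Fx|].
    rewrite setTI; apply: (smooth_fun_congr oc _ sh) => y dy.
    by rewrite /f mem_set.
  exists (~` F); split; [exact: closed_openC|by []|rewrite setTI].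
  apply: (smooth_fun_congr _ _ (smooth_fun_cst 0 _)); [exact: closed_openC| |exact: closed_openC].
  by move=> y nFy; rewrite fF.
- by move=> x; rewrite /f; case: ifP => // _; exact: flat_ge0.
- rewrite /f mem_set // /h; apply: flat_pos.
  rewrite /q big1 ?subr0 ?exprn_gt0 // => k _.
  by rewrite subrr expr0n.
Qed.

Lemma sum_tail (V : nmodType) (f : nat -> V) m m' :
  (forall n, (m <= n)%N -> f n = 0) -> (forall n, (m' <= n)%N -> f n = 0) ->
  \sum_(n < m) f n = \sum_(n < m') f n.
Proof.
have H k l : (k <= l)%N -> (forall n, (k <= n)%N -> f n = 0) -> \sum_(n < k) f n = \sum_(n < l) f n.
  move=> kl f0; rewrite -!(big_mkord xpredT f) (big_cat_nat (leq0n k) kl) /=.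
  by rewrite [X in _ + X]big_nat_cond [X in _ + X]big1 ?addr0 // => i /andP[/andP[/f0]].
move=> f0 f0'; rewrite (H _ (maxn m m')) ?leq_maxl // (H m' (maxn m m')) ?leq_maxr //.
Qed.

Lemma partition_of_unity (U : M -> set M) (p0 : M) : (forall p, open (U p) /\ U p p) ->
  exists (p : nat -> M) (psi : nat -> M -> R^o),
  [/\ forall n, smooth_fun setT (psi n),
      forall n, exists F : set M, [/\ closed F, F `<=` U (p n) & forall x, ~ F x -> psi n x = 0] &
      forall x, exists (B : set M) (m : nat), [/\ open B, B x &
        forall y, B y -> (forall n, (m <= n)%N -> psi n y = 0) /\ \sum_(n < m) psi n y = 1]].
Proof.
move=> oU.
have /choice[f fP] : forall p, exists f : M -> R^o, exists F : set M,
    [/\ smooth_fun setT f, forall x, 0 <= f x & 0 < f p] /\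
    [/\ closed F, F `<=` U p & forall x, ~ F x -> f x = 0].
  by move=> p; have [oUp Up] := oU p; exact: bump.
have sf p : smooth_fun setT (f p) by have [F [[]]] := fP p.
have f0 p x : 0 <= f p x by have [F [[]]] := fP p.
have fp0 p : 0 < f p p by have [F [[]]] := fP p.
have oT := @openT M.
have oV t p : open [set x | t < f p x].
  rewrite openE => x /= fx.
  have cf := smooth_fun_continuous oT (I : [set: M] x) (sf p).
  exact: (cf [set y : R | t < y] (lt_nbhsr fx)).
have [p pP] := lindelof p0 (@manifold_second_countable R M)
  (fun q => conj (oV 0 q) (fp0 q)).
pose phi n := f (p n).
(* The factor cut n k vanishes where phi k >= 1 / (n + 1), which makes the
   family chi locally finite. *)
pose cut n k x : R^o := flat 0 (n.+1%:R^-1 - phi k x).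
pose chi n x : R^o := (phi n x : R) * \prod_(k < n) (cut n k x : R).
have chi0 n x : 0 <= chi n x.
  by apply: mulr_ge0; [exact: f0|apply: prodr_ge0 => k _; exact: flat_ge0].
have schi n : smooth_fun setT (chi n).
  apply: (smooth_fun_mul oT (sf _)); apply: (smooth_fun_prod _ oT) => k _.
  apply: (smooth_fun_flat _ oT).
  exact: (smooth_fun_add oT (smooth_fun_cst _ oT) (smooth_fun_opp oT (sf _))).
(* At the least [n] with [phi n x] positive, all earlier [phi k x] vanish, so none of the cuts
   does. *)
have chi_pos x : exists n, 0 < chi n x.
  have := pP x => ex; exists (ex_minn ex).
  case: ex_minnP => n fn nmin; apply: mulr_gt0; first exact: fn.
  apply: prodr_gt0 => k _; apply: flat_pos; rewrite subr_gt0.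
  have -> : phi k x = 0.
    apply/eqP; rewrite eq_le f0 andbT leNgt; apply/negP => /nmin.
    by rewrite leqNgt ltn_ord.
  by rewrite invr_gt0 ltr0n.
have lf x : exists (B : set M) (m : nat), [/\ open B, B x &
    forall y, B y -> forall n, (m <= n)%N -> chi n y = 0].
  have [k fk] := pP x.
  have [m mP] : exists m : nat, m.+1%:R^-1 < phi k x.
    by have [m] := ltr_add_invr fk; rewrite add0r => mk; exists m.
  (* From [k.+1] on, the product contains the factor of index [k]; from [m] on, the threshold of
     that factor is at most [m.+1%:R^-1], so it vanishes on this set. *)
  exists [set y | m.+1%:R^-1 < phi k y], (maxn m k.+1); split => //; first exact: oV.
  move=> y /= fy n; rewrite geq_max => /andP[mn kn].
  rewrite /chi (bigD1 (Ordinal kn)) //= [cut n k y]flat_npos ?mul0r ?mulr0 //.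
  rewrite subr_le0; apply: ltW; apply: le_lt_trans fy.
  by rewrite lef_pV2 ?posrE ?ltr0n // ler_nat.
have /choice[B /choice[m mP]] := lf.
pose S x : R^o := \sum_(n < m x) chi n x.
have SE x y : B x y -> S y = \sum_(n < m x) chi n y.
  move=> Oy; have [_ Oyy H] := mP y; have [_ _ H'] := mP x.
  exact: (sum_tail (H y Oyy) (H' y Oy)).
have sS : smooth_fun setT S.
  apply: smooth_fun_glue => x _; have [oO Ox _] := mP x; exists (B x); split => //.
  rewrite setTI; apply: (smooth_fun_congr oO (f := fun y => \sum_(n < m x) chi n y : R^o)).
    by move=> y Oy; rewrite (SE x).
  by apply: (smooth_fun_sum _ oO) => n _; apply: smooth_fun_sub (schi n).
have S0 x : S x != 0.
  have [n cn] := chi_pos x; have [_ Ox H] := mP x.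
  have nm : (n < m x)%N by rewrite ltnNge; apply/negP => /(H x Ox) c0; rewrite c0 ltxx in cn.
  rewrite gt_eqF // /S (bigD1 (Ordinal nm)) //=; apply: ltr_wpDr cn.
  by apply: sumr_ge0.
exists p, (fun n x => (chi n x : R) * (S x)^-1 : R^o); split.
- by move=> n; apply: (smooth_fun_mul oT (schi n)); apply: smooth_fun_inv.
- move=> n; have [F [_ [clF FU F0]]] := fP (p n); exists F; split => // x nF.
  by rewrite /chi /phi F0 // !mul0r.
- move=> x; have [oO Ox H] := mP x; exists (B x), (m x); split => // y Oy; split.
    by move=> n mn; rewrite (H y Oy n mn) mul0r.
  by rewrite -mulr_suml -(SE x y Oy) mulfV.
Qed.

End Partition.

(** Membership of the last row in [K'''] is linear, so it passes to weighted sums; indices of weight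
    zero, whose local data mean nothing at the point, drop out. *)
Lemma combination_mem (K : fieldType) (A V : vectType K) (Z : {vspace V}) k (c : nat -> K)
    (a : nat -> V) (T : nat -> 'Hom(A, V)) v :
  (forall n, c n != 0 -> a n + T n v \in Z) ->
  \sum_(n < k) c n *: a n + (\sum_(n < k) c n *: T n) v \in Z.
Proof.
move=> aT; rewrite sum_lfunE -big_split /=; apply: memv_suml => n _.
rewrite scale_lfunE -scalerDr; have [->|/aT aTn] := eqVneq (c n) 0.
  by rewrite scale0r mem0v.
exact: memvZ.
Qed.

(** * Weighted sums of local sections, connections and homomorphisms *)

Section Gluing.
Variables (R : realType) (M : manifold3 R) (U : M -> set M).
Hypothesis oU : forall q, open (U q).
Variables (p : nat -> M) (psi : nat -> M -> R^o) (B : M -> set M) (m : M -> nat).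
Hypotheses (spsi : forall n, smooth_fun setT (psi n))
  (supp : forall n, exists F : set M, [/\ closed F, F `<=` U (p n) & forall x, ~ F x -> psi n x = 0])
  (lf : forall x, [/\ open (B x), B x x & forall y, B x y ->
     (forall n, (m x <= n)%N -> psi n y = 0) /\ \sum_(n < m x) psi n y = 1]).
Implicit Types (W : set M) (V : bundle M).

Lemma sum_psi x : \sum_(n < m x) psi n x = 1.
Proof. by have [_ Bx H] := lf x; have [] := H x Bx. Qed.

Lemma supp_dom n x : psi n x != 0 -> U (p n) x.
Proof.
move=> px; have [F [_ FU F0]] := supp n; apply: FU; apply: contrapT => /F0 p0.
by rewrite p0 eqxx in px.
Qed.

(** The length [m x] of the sum may jump with [x], but near any point all these sums agree with one
    of fixed length, the additional weights being zero. *)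
Definition glued V (t : nat -> section V) : section V :=
  fun x => \sum_(n < m x) psi n x *: t n x.

(** The section is smooth only on [U (p n)]; the weight vanishes off a closed subset of it, so the
    product extends smoothly by zero. *)
Lemma cutoff_smooth V W n (t : section V) : vbundle V -> open W ->
  smooth_sec (W `&` U (p n)) t -> smooth_sec W ((fun x => psi n x *: t x) : section V).
Proof.
move=> vV oW st; have [_ gV _] := vV; apply: gV => // x Wx.
have [Ux|nU] := pselect (U (p n) x).
  exists (U (p n)); split => //.
  have oWU := openI oW (oU (p n)).
  exact: (@vb_scale _ _ _ vV _ (psi n) t oWU (smooth_fun_sub (@subsetT _ _) (spsi n)) st).
have [F [clF FU F0]] := supp n; exists (~` F); split; first exact: closed_openC.
  by move=> /FU.
have oF : open (W `&` ~` F) by apply: openI => //; exact: closed_openC.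
by apply: (vb_congr vV oF _ (vb_zero vV oF)) => y [_ nF]; rewrite F0 // scale0r.
Qed.

Lemma glued_smooth V W (t : nat -> section V) : vbundle V -> open W ->
  (forall n, smooth_sec (W `&` U (p n)) (t n)) -> smooth_sec W (glued t).
Proof.
move=> vV oW st; have [rV gV _] := vV; apply: gV => // x Wx.
have [oB Bx H] := lf x; exists (B x); split => //.
have oWB := openI oW oB.
have sB : smooth_sec (W `&` B x) ((fun y => \sum_(n < m x) psi n y *: t n y) : section V).
  apply: (vb_sum vV _ oWB) => n.
  exact: rV oW oWB (@subIsetl _ _ _) (cutoff_smooth vV oW (st n)).
apply: (vb_congr vV oWB _ sB) => y [_ By]; rewrite /glued.
have [_ Byy H'] := lf y; have [z1 _] := H y By; have [z2 _] := H' y Byy.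
apply: (sum_tail (f := fun n => psi n y *: t n y)) => n mn.
  by rewrite (z1 n mn) scale0r.
by rewrite (z2 n mn) scale0r.
Qed.

Lemma sum_psi_eq (V : lmodType R) x (s t : nat -> V) :
  (forall n, U (p n) x -> s n = t n) ->
  \sum_(n < m x) psi n x *: s n = \sum_(n < m x) psi n x *: t n.
Proof.
move=> st; apply: eq_bigr => n _.
have [->|/supp_dom/st -> //] := eqVneq (psi n x) 0.
by rewrite !scale0r.
Qed.

Section Connection.
Variables (C : contact M) (V : bundle M).
Hypothesis vV : vbundle V.
Variable nab : M -> section V -> section (LamH C V).
Hypothesis cn : forall q, local_conn (U q) (nab q).

Definition glued_nabla (s : section V) : section (LamH C V) :=
  glued (fun n => nab (p n) s).

Lemma glued_connection : exists nb : partial_connection C V,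
  forall s, nb s = glued_nabla s.
Proof.
have oWU W n : open W -> open (W `&` U (p n)) by move=> oW; exact: openI.
have [rV _ _] := vV.
have loc W (s t : section V) : open W -> eq_on W s t -> eq_on W (glued_nabla s) (glued_nabla t).
  move=> oW st x Wx; apply: (@sum_psi_eq (fib (LamH C V) x) x (fun n => nab (p n) s x)
    (fun n => nab (p n) t x)) => n Ux.
  have [c1 _ _ _] := cn (p n).
  exact: (c1 _ s t (oWU W n oW) (@subIsetr _ _ _) (fun y Wy => st y Wy.1) x (conj Wx Ux)).
have smo W (s : section V) : open W -> smooth_sec W s -> smooth_sec W (glued_nabla s).
  move=> oW ss; apply: (glued_smooth (vbundle_LamH C vV) oW) => n.
  have [_ c2 _ _] := cn (p n); apply: c2 (oWU W n oW) (@subIsetr _ _ _) _.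
  exact: rV oW (oWU W n oW) (@subIsetl _ _ _) ss.
have add W (s t : section V) : open W -> smooth_sec W s -> smooth_sec W t ->
    eq_on W (glued_nabla (fun x => s x + t x)) (fun x => glued_nabla s x + glued_nabla t x).
  move=> oW ss st x Wx; rewrite /glued_nabla /glued -big_split /=.
  under [RHS]eq_bigr => n _ do rewrite -scalerDr.
  apply: (@sum_psi_eq (fib (LamH C V) x) x (fun n => nab (p n) (fun x => s x + t x) x)
    (fun n => nab (p n) s x + nab (p n) t x)) => n Ux.
  have [_ _ c3 _] := cn (p n).
  have oW' := oWU W n oW.
  have ss' := rV _ _ _ oW oW' (@subIsetl _ _ _) ss.
  have st' := rV _ _ _ oW oW' (@subIsetl _ _ _) st.
  exact: (c3 _ s t oW' (@subIsetr _ _ _) ss' st' x (conj Wx Ux)).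
have lei W (f : M -> R^o) (s : section V) : open W -> smooth_fun W f -> smooth_sec W s ->
    forall x (a : Hfib C x), W x -> ev (glued_nabla (fun y => f y *: s y) x) a =
      f x *: ev (glued_nabla s x) a + dH f a *: s x.
  move=> oW sf ss x a Wx; have el := @ev_linear_l R M C x V a.
  rewrite /glued_nabla /glued !(lin_sum el) scaler_sumr.
  (* The Leibniz rule survives because the weights add up to 1: the term with [dH f a] is
     distributed over the summands. *)
  rewrite -[dH f a]mul1r -(sum_psi x) mulr_suml scaler_suml -big_split /=.
  have E n : f x *: ev (psi n x *: nab (p n) s x) a + (psi n x * dH f a) *: s x =
      psi n x *: (f x *: ev (nab (p n) s x) a + dH f a *: s x).
    by rewrite (linZ el) scalerDr !scalerA mulrC.
  under [RHS]eq_bigr => n _ do rewrite E.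
  under eq_bigr => n _ do rewrite (linZ el).
  apply: (@sum_psi_eq (fib V x) x (fun n => ev (nab (p n) (fun y => f y *: s y) x) a)
    (fun n => f x *: ev (nab (p n) s x) a + dH f a *: s x)) => n Ux.
  have [_ _ _ c4] := cn (p n); have oW' := oWU W n oW.
  have ss' := rV _ _ _ oW oW' (@subIsetl _ _ _) ss.
  have sf' := smooth_fun_sub (@subIsetl _ W (U (p n))) sf.
  exact: (c4 _ f s oW' (@subIsetr _ _ _) sf' ss' x a (conj Wx Ux)).
by exists (PartialConnection loc smo add lei).
Qed.

End Connection.

Lemma glued_hom (A V : bundle M) (N : M -> section (hom_bundle A V)) :
  sec_restrict A -> vbundle V -> (forall q, smooth_sec (U q) (N q)) ->
  smooth_hom (glued (fun n => N (p n))).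
Proof.
move=> rA vV sN W s oW _ ss.
have sg : smooth_sec W (glued (fun n x => (N (p n) x : 'Hom(fib A x, fib V x)) (s x))).
  apply: (glued_smooth vV oW) => n; have oW' := openI oW (oU (p n)).
  apply: (sN (p n)) => //.
  exact: rA oW oW' (@subIsetl _ _ _) ss.
apply: (vb_congr vV oW _ sg) => x Wx; rewrite /glued sum_lfunE.
by apply: eq_bigr => n _; rewrite scale_lfunE.
Qed.

End Gluing.

Lemma sec_restrict_sum (R : realType) (M : manifold3 R) (A B : bundle M) :
  sec_restrict A -> sec_restrict B -> sec_restrict (sum_bundle A B).
Proof.
move=> rA rB W W' s oW oW' WW [s1 s2]; split; [exact: rA s1|exact: rB s2].
Qed.

(** * The prolongation on the whole manifold *)

Section GlobalProlongation.
Variables (R : realType) (M : manifold3 R) (C : contact M) (E : bundle M)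
  (K : forall x : M, {vspace fib (LamH C E) x})
  (K' : forall x : M, {vspace fib (LamH C (sub_bundle K)) x})
  (K'' : forall x : M, {vspace fib (LamH C (sub_bundle K')) x})
  (K3 : forall x : M, {vspace fib (LamH C (sub_bundle K'')) x})
  (nE : partial_connection C E)
  (nK : partial_connection C (sub_bundle K))
  (nK' : partial_connection C (sub_bundle K'))
  (L : section (hom_bundle E (LamH C (sub_bundle K))))
  (Mh : section (hom_bundle (sum_bundle E (sub_bundle K)) (LamH C (sub_bundle K')))).
Hypotheses (vE : vbundle E) (vK : vbundle (sub_bundle K))
  (vK' : vbundle (sub_bundle K')) (vK'' : vbundle (sub_bundle K''))
  (hL : smooth_hom L) (hM : smooth_hom Mh)
  (hK'' : is_K2 K'') (hK3 : is_K3 K3) (sK3 : is_subbundle K3).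
Local Notation S := (sum_bundle (sum_bundle E (sub_bundle K)) (sub_bundle K')).

(** The partition of unity is indexed by points and starts from one of them, so the empty manifold
    is treated apart. *)
Lemma empty_connection (V : bundle M) : vbundle V -> (M -> False) ->
  exists nb : partial_connection C V, True.
Proof.
move=> vV M0; pose z (s : section V) : section (LamH C V) := fun x => 0.
have loc W (s t : section V) : open W -> eq_on W s t -> eq_on W (z s) (z t) by [].
have smo W (s : section V) : open W -> smooth_sec W s -> smooth_sec W (z s).
  by move=> oW _; exact: (vb_zero (vbundle_LamH C vV) oW).
have add W (s t : section V) : open W -> smooth_sec W s -> smooth_sec W t ->
    eq_on W (z (fun x => s x + t x)) (fun x => z s x + z t x).
  by move=> _ _ _ x; have := M0 x.
have lei W (f : M -> R^o) (s : section V) : open W -> smooth_fun W f -> smooth_sec W s ->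
    forall x (a : Hfib C x), W x -> ev (z (fun y => f y *: s y) x) a =
      f x *: ev (z s x) a + dH f a *: s x.
  by move=> _ _ _ x; have := M0 x.
by exists (PartialConnection loc smo add lei).
Qed.

Lemma global_prolongation : exists (nb : partial_connection C (sub_bundle K''))
    (N : section (hom_bundle S (LamH C (sub_bundle K'')))),
  smooth_hom N /\
  forall W (s : fields K'') x, open W -> solution nE nK nK' L Mh W s -> W x ->
    nb s.2 x + (N x : 'Hom(fib S x, fib (LamH C (sub_bundle K'')) x))
                 (s.1.1.1 x, s.1.1.2 x, s.1.2 x) \in K3 x.
Proof.
have vL := vbundle_LamH C vK''.
have [[p0 _]|M0] := pselect (exists p : M, True); last first.
  have {}M0 : M -> False by move=> x; apply: M0; exists x.
  have [nb _] := empty_connection vK'' M0.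
  exists nb, (fun x => 0); split; last by move=> W s x; have := M0 x.
  by move=> W s oW _ _; apply: (vb_congr vL oW _ (vb_zero vL oW)) => x; have := M0 x.
have /choice[U /choice[nab /choice[N P]]] :=
  local_prolongation nE nK nK' vE vK vK' vK'' hL hM hK'' hK3 sK3.
have oU q : open (U q) by have [] := P q.
have [p [psi [spsi supp lf]]] := partition_of_unity p0 (fun q => conj (oU q)
  (let: And5 _ Uq _ _ _ := P q in Uq)).
have {lf}/choice[B /choice[m lf]] := lf.
have cn q : local_conn (U q) (nab q) by have [] := P q.
have sN q : smooth_sec (U q) (N q) by have [] := P q.
have [nb nbE] := glued_connection oU spsi supp lf vK'' cn.
have rS : sec_restrict S.
  have [[rE _ _] [rK _ _] [rK' _ _]] := And3 vE vK vK'.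
  by do 2 (apply: sec_restrict_sum => //).
exists nb, (glued psi m (fun n => N (p n))); split.
  exact: (glued_hom oU spsi supp lf rS vL sN).
move=> W s x oW ss Wx; rewrite nbE.
apply: (combination_mem (m x) (c := fun n => psi n x) (a := fun n => nab (p n) s.2 x)
  (T := fun n => N (p n) x)) => n /(supp_dom supp) Ux.
have [_ _ _ _ mem] := P (p n).
have oW' := openI oW (oU (p n)).
apply: (mem _ s x oW' (@subIsetr _ _ _)) => //.
(* The local result concerns solutions over open subsets of [U (p n)], so the solution is first
   restricted to the intersection. *)
exact: solution_sub oW oW' (@subIsetl _ _ _) ss.
Qed.

End GlobalProlongation.

Theorem proposition5p3 (R : realType) (M : manifold3 R) (C : contact M)
    (E : vector_bundle M)
    (K : forall x : M, {vspace fib (LamH C E) x})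
    (K' : forall x : M, {vspace fib (LamH C (sub_bundle K)) x})
    (K'' : forall x : M, {vspace fib (LamH C (sub_bundle K')) x})
    (hK : is_subbundle K) (hK' : is_subbundle K')
    (hK'' : is_K2 K'') (hK''_sub : is_subbundle K'')
    (nE : partial_connection C E)
    (nK : partial_connection C (sub_bundle K))
    (nK' : partial_connection C (sub_bundle K'))
    (L : section (hom_bundle E (LamH C (sub_bundle K))))
    (hL : smooth_hom L)
    (Mh : section (hom_bundle (sum_bundle E (sub_bundle K))
                              (LamH C (sub_bundle K'))))
    (hMh : smooth_hom Mh)
    (K''' : forall x : M, {vspace fib (LamH C (sub_bundle K'')) x})
    (hK''' : is_K3 K''') (hK'''_sub : is_subbundle K''') :
  exists (nK'' : partial_connection C (sub_bundle K''))
         (N : section (hom_bundle (sum_bundle (sum_bundle E (sub_bundle K))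
                                              (sub_bundle K'))
                                  (LamH C (sub_bundle K'')))),
    smooth_hom N /\
    forall W : set M, open W ->
    [/\ (forall sigma mu rho tau,
           in_ker_DH' K''' nE nK nK' nK'' L Mh N W sigma mu rho tau ->
           in_ker_DH K'' nE nK nK' L Mh W sigma mu rho),
        (forall sigma mu rho tau sigma' mu' rho' tau',
           in_ker_DH' K''' nE nK nK' nK'' L Mh N W sigma mu rho tau ->
           in_ker_DH' K''' nE nK nK' nK'' L Mh N W sigma' mu' rho' tau' ->
           [/\ eq_on W sigma sigma', eq_on W mu mu' & eq_on W rho rho'] ->
           eq_on W tau tau') &
        (forall sigma mu rho,
           in_ker_DH K'' nE nK nK' L Mh W sigma mu rho ->
           exists tau,
             in_ker_DH' K''' nE nK nK' nK'' L Mh N W sigma mu rho tau)].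
Proof.
have vE := vbundle_vector E; have vK := vbundle_sub (vbundle_LamH C vE) hK.
have vK' := vbundle_sub (vbundle_LamH C vK) hK'.
have vK'' := vbundle_sub (vbundle_LamH C vK') hK''_sub.
have [nb [N [sN mem]]] := global_prolongation nE nK nK' vE vK vK' vK'' hL hMh
  hK'' hK''' hK'''_sub.
exists nb, N; split => // W oW; split.
- move=> s m r t [s0 s1 s2 s3 eqs]; split => // x Wx.
  have [e1 e2 e3 _] := eqs x Wx; split => //.
  by rewrite (subr0_eq e3); exact: subvsP.
- move=> s m r t s' m' r' t' [_ _ _ _ eqs] [_ _ _ _ eqs'] [es em er] x Wx.
  have [_ _ e _] := eqs x Wx; have [_ _ e' _] := eqs' x Wx.
  apply: val_inj; apply: etrans (esym (subr0_eq e)) (etrans _ (subr0_eq e')).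
  (* The third row expresses [tau] through the other fields. These agree only on [W], hence the
     appeal to locality of the connection. *)
  by rewrite (nabla_local nK' oW er Wx) (es x Wx) (em x Wx).
- move=> s m r [s0 s1 s2 eqs].
  pose v : section (LamH C (sub_bundle K')) := fun x => nK' r x + Mapp Mh (s x) (m x).
  (* The third row forces [tau] to equal [v] on [W], where [v] takes values in [K'']; the projection
     changes nothing there and supplies irrelevant values elsewhere. *)
  pose t : section (sub_bundle K'') := fun x => vsproj (K'' x) (v x).
  have vt x : W x -> vsval (t x) = v x by move=> /eqs[_ _ vx]; exact: vsprojK.
  have sv : smooth_sec W v.
    apply: (vb_add (vbundle_LamH C vK') oW (nabla_smooth nK' oW s2)).
    exact: (@hMh W (fun x => (s x, m x)) oW (@subsetT _ _) (conj s0 s1)).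
  have st : smooth_sec W t.
    apply: (vb_congr (vbundle_LamH C vK') oW _ sv) => x Wx; exact: esym (vt x Wx).
  have sol : solution nE nK nK' L Mh W (s, m, r, t).
    split => // x Wx; have [e1 e2 _] := eqs x Wx; split.
    - exact: subr0_eq e1.
    - by rewrite -(subr0_eq e2) addrK.
    - exact: canRL (addrK _) (esym (vt x Wx)).
  exists t; split => // x Wx; have [e1 e2 _] := eqs x Wx; split => //.
    by rewrite vt // /v subrr.
  exact: (mem W (s, m, r, t) x oW sol Wx).
Qed.
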